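(* Let $d\geq 2$ be an integer, let $p\in(0,1)$, and let $\{\eta_t\}_{t\ge 0}$ be the symmetric simple exclusion process on the regular tree $\mathbb{T}^d$ started from the product measure $\nu_p$ (law $\mathbb{P}_{\nu_p}$). Let $\{a_t\}_{t\geq 0}$ be positive numbers such that $$\lim_{t\rightarrow+\infty}\frac{a_t}{t}=\lim_{t\rightarrow+\infty}\frac{\sqrt{t}}{a_t}=0.$$ Let $m\geq 1$ be an integer, let $x_1,\ldots,x_m\in \mathbb{T}^d$, and let $\Lambda_t=\left(\xi_t^{x_1},\ldots,\xi_t^{x_m}\right)^T$, where $\xi_t^x=\int_0^t(\eta_s(x)-p)\,ds$. Then, with the rate function $I=I_{\{x_i\}_{i=1}^m}:\mathbb{R}^m\to[0,+\infty]$ defined in the context: (i) for every closed set $\mathcal{C}\subseteq \mathbb{R}^m$, $$\limsup_{t\rightarrow+\infty}\frac{t}{a_t^2}\log \mathbb{P}_{\nu_p}\left(\frac{1}{a_t}\Lambda_t\in \mathcal{C}\right)\leq -\inf_{u\in \mathcal{C}}I(u);$$ (ii) for every open set $\mathcal{O}\subseteq \mathbb{R}^m$, $$\liminf_{t\rightarrow+\infty}\frac{t}{a_t^2}\log \mathbb{P}_{\nu_p}\left(\frac{1}{a_t}\Lambda_t\in \mathcal{O}\right)\geq -\inf_{u\in \mathcal{O}}I(u).$$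
   Context: $\mathbb{T}^d$ is the infinite regular tree in which every vertex has $d+1$ neighbors; $x\sim y$ means $x$ and $y$ are neighbors. The symmetric simple exclusion process (SSEP) $\{\eta_t\}_{t\ge0}$ is the (Feller, càdlàg) continuous-time Markov process on $\{0,1\}^{\mathbb{T}^d}$ whose generator $\mathcal{L}$ acts on functions $f:\{0,1\}^{\mathbb{T}^d}\to\mathbb{R}$ depending on finitely many coordinates by $$\mathcal{L}f(\eta)=\frac12\sum_{x\in\mathbb{T}^d}\sum_{y\sim x}\left[f(\eta^{x,y})-f(\eta)\right],$$ where $\eta^{x,y}$ is obtained from $\eta$ by exchanging the values at $x$ and $y$. $\nu_p$ is the product measure on $\{0,1\}^{\mathbb{T}^d}$ under which $\{\eta(x)\}_{x\in\mathbb{T}^d}$ are independent with $\nu_p(\eta(x)=1)=p=1-\nu_p(\eta(x)=0)$; it is reversible for the SSEP. $\mathbb{P}_{\nu_p}$ is the law of the SSEP with initial distribution $\nu_p$. $p_t(x,z)=\mathbb{P}(V_t=z\mid V_0=x)$ denotes the transition probability of the continuous-time simple random walk $\{V_t\}_{t\ge0}$ on $\mathbb{T}^d$ with generator $\Omega_1h(x)=\sum_{y\sim x}(h(y)-h(x))$ (jump at rate $1$ to each neighbor). For $d\ge2$, $\int_0^{+\infty}p_s(x,y)\,ds<+\infty$ for all $x,y\in\mathbb{T}^d$. Rate function: for $u\in\mathbb{R}^m$, $$I_{\{x_i\}_{i=1}^m}(u)=\sup_{c\in\mathbb{R}^m}\left\{c\cdot u-\frac12c^T\Gamma c\right\},$$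 where $\Gamma=\Gamma_{\{x_i\}_{i=1}^m}$ is the $m\times m$ matrix with entries $\Gamma(j,k)=2p(1-p)\int_0^{+\infty}p_s(x_j,x_k)\,ds$, and $c\cdot u$ is the Euclidean inner product. Conventions: $\log 0=-\infty$ and $\inf\emptyset=+\infty$. *)

(* Defs.v *)
From HB Require Import structures.
From mathcomp Require Export all_boot all_order all_algebra.
From mathcomp Require Export all_classical all_reals all_analysis.
Export Order.TTheory GRing.Theory Num.Theory numFieldNormedType.Exports.

Set Implicit Arguments.
Unset Strict Implicit.
Unset Printing Implicit Defensive.

Local Open Scope classical_set_scope.
Local Open Scope ring_scope.

(* [ucycle E c] only excludes repeated vertices, so in a loopless undirected
   graph the sequences [:: ] and [:: x; y] with [E x y] satisfy it; a genuine
   cycle has length at least 3. *)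
Record regular_tree (V : choiceType) (d : nat) (E : rel V) : Prop :=
  RegularTree {
    rtree_sym : symmetric E;
    rtree_irr : irreflexive E;
    rtree_connected :
      forall x y : V, exists s : seq V, path E x s /\ last x s = y;
    rtree_acyclic : forall c : seq V, ucycle E c -> (size c <= 2)%N;
    rtree_degree : forall x : V, ([set y | E x y] #= `I_d.+1)%card }.

(* The product topology is the one for which cylinder functions are continuous
   and the configuration space is compact. *)
Notation config V := {ptws V -> bool}.

Definition exchange (V : choiceType) (x y : V) (zeta : config V) : config V :=
  fun z => if z == x then zeta y else if z == y then zeta x else zeta z.

Definition cylinder_fun (R : realType) (V : choiceType) (f : config V -> R) :=
  exists A : seq V, forall zeta zeta' : config V,
    {in A, forall x, zeta x = zeta' x} -> f zeta = f zeta'.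

(* For a cylinder function on a locally finite graph only finitely many x give
   a nonzero term, so the finitely supported sum is the actual sum. *)
Definition ssep_generator (R : realType) (V : choiceType) (E : rel V)
    (f : config V -> R) (zeta : config V) : R :=
  2^-1 * \sum_(x \in [set: V]) \sum_(y \in [set y | E x y])
           (f (exchange x y zeta) - f zeta).

(* Liggett's Markov semigroups on C(X), X compact; operators are total on
   X -> R and only their values at continuous functions and t >= 0 matter. *)
Record feller_semigroup (R : realType) (X : topologicalType)
    (S : R -> (X -> R) -> X -> R) : Prop := FellerSemigroup {
  feller_continuous : forall (t : R) (f : X -> R),
    0 <= t -> continuous f -> continuous (S t f);
  feller_linear : forall (t k : R) (f g : X -> R),
    0 <= t -> continuous f -> continuous g ->
    S t (fun z => k * f z + g z) = (fun z => k * S t f z + S t g z);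
  feller_pos : forall (t : R) (f : X -> R), 0 <= t -> continuous f ->
    (forall z, 0 <= f z) -> forall z, 0 <= S t f z;
  feller_one : forall t : R, 0 <= t -> S t (fun=> 1) = (fun=> 1);
  feller_zero : forall f : X -> R, continuous f -> S 0 f = f;
  feller_add : forall (s t : R) (f : X -> R), 0 <= s -> 0 <= t ->
    continuous f -> S (s + t) f = S s (S t f);
  feller_strong : forall f : X -> R, continuous f ->
    {uniform, S t f @[t --> 0^'+] --> f} }.

(* f belongs to the domain of the (sup-norm) infinitesimal generator of S, and
   the generator maps it to g. *)
Definition semigroup_derivative (R : realType) (X : topologicalType)
    (S : R -> (X -> R) -> X -> R) (f g : X -> R) : Prop :=
  {uniform, (fun z => t^-1 * (S t f z - f z)) @[t --> 0^'+] --> g}.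

Definition history (R : realType) (dsp : measure_display)
    (Omega : measurableType dsp) (V : choiceType)
    (eta : R -> Omega -> config V) (s : R) : set (set Omega) :=
  <<s [set A | exists (u : R) (x : V), 0 <= u <= s /\ A = [set w | eta u w x]] >>.

(* E[f(eta_{s+t}) | F_s] = (S_t f)(eta_s), with F_s the natural filtration *)
Definition markov_with_semigroup (R : realType) (dsp : measure_display)
    (Omega : measurableType dsp) (P : probability Omega R) (V : choiceType)
    (eta : R -> Omega -> config V)
    (S : R -> (config V -> R) -> config V -> R) : Prop :=
  forall (s t : R) (f : config V -> R) (A : set Omega),
    0 <= s -> 0 <= t -> continuous f -> history eta s A ->
    \int[P]_(w in A) f (eta (s + t) w) = \int[P]_(w in A) S t f (eta s w).

Definition cadlag (R : realType) (X : topologicalType) (g : R -> X) : Prop :=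
  (forall t : R, 0 <= t -> g s @[s --> t^'+] --> g t) /\
  (forall t : R, 0 < t -> exists l : X, g s @[s --> t^'-] --> l).

(* The SSEP on the graph E, with an arbitrary initial law. Cylinder functions
   form a core, so S is determined by the generator clause. *)
Record is_ssep (R : realType) (dsp : measure_display)
    (Omega : measurableType dsp) (P : probability Omega R)
    (V : choiceType) (E : rel V) (eta : R -> Omega -> config V) : Prop :=
  IsSsep {
    ssep_measurable : forall (t : R) (x : V), 0 <= t ->
      measurable_fun [set: Omega] (fun w => eta t w x);
    ssep_cadlag : forall w, cadlag (fun t => eta t w);
    ssep_markov : exists S : R -> (config V -> R) -> config V -> R,
      [/\ feller_semigroup S,
          forall f : config V -> R, cylinder_fun f ->
            semigroup_derivative S f (ssep_generator E f)
        & markov_with_semigroup P eta S] }.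

(* The random configuration zeta has law nu_p *)
Definition has_law_nu (R : realType) (dsp : measure_display)
    (Omega : measurableType dsp) (P : probability Omega R)
    (V : choiceType) (p : R) (zeta : Omega -> config V) : Prop :=
  forall (A : seq V) (b : V -> bool), uniq A ->
    P [set w | {in A, forall x, zeta w x = b x}]
    = (\prod_(x <- A) (if b x then p else 1 - p))%:E.

Definition walk_generator (R : realType) (V : choiceType) (E : rel V)
    (h : V -> R) (x : V) : R :=
  \sum_(y \in [set y | E x y]) (h y - h x).

(* q t x z = P(V_t = z | V_0 = x) for the continuous-time walk; the generator
   is tested on finitely supported functions. *)
Record walk_transition (R : realType) (V : choiceType) (E : rel V)
    (q : R -> V -> V -> R) : Prop := WalkTransition {
  walk_ge0 : forall (t : R) (x z : V), 0 <= t -> 0 <= q t x z;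
  walk_mass : forall (t : R) (x : V), 0 <= t ->
    (\esum_(z in [set: V]) (q t x z)%:E = 1)%E;
  walk_zero : forall x z : V, q 0 x z = (x == z)%:R;
  walk_add : forall (s t : R) (x z : V), 0 <= s -> 0 <= t ->
    ((q (s + t) x z)%:E = \esum_(y in [set: V]) (q s x y * q t y z)%:E)%E;
  walk_derivative : forall (h : V -> R) (x : V),
    finite_set [set z | h z != 0] ->
    t^-1 * (\sum_(z \in [set: V]) (q t x z * h z) - h x) @[t --> 0^'+]
      --> walk_generator E h x }.

Definition occupation (R : realType) (Omega : Type) (V : choiceType) (p : R)
    (eta : R -> Omega -> config V) (t : R) (x : V) (w : Omega) : R :=
  \int[lebesgue_measure]_(s in `[0, t]) ((eta s w x)%:R - p).

Definition occupation_vector (R : realType) (Omega : Type) (V : choiceType)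
    (p : R) (eta : R -> Omega -> config V) (m : nat) (x : 'I_m -> V)
    (t : R) (w : Omega) : 'cV[R]_m :=
  \col_i occupation p eta t (x i) w.

Definition Gamma (R : realType) (V : choiceType) (p : R)
    (q : R -> V -> V -> R) (m : nat) (x : 'I_m -> V) : 'M[R]_m :=
  \matrix_(j, k) (2 * p * (1 - p) *
    \int[lebesgue_measure]_(s in `[0, +oo[) q s (x j) (x k)).

Definition rate (R : realType) (m : nat) (G : 'M[R]_m) (u : 'cV[R]_m) : \bar R :=
  ereal_sup [set ((c^T *m u) 0 0 - 2^-1 * (c^T *m G *m c) 0 0)%:E
            | c in [set: 'cV[R]_m]].

(* Main.v *)
(* Write F_h = sum_z h(z) (eta(z) - p). For a finitely supported h with
   Lap h close to - sum_i c_i delta_(x_i) (a truncated Green function; the tree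
   is transient), exp(lambda F_h) turns the generator into the additive
   functional lambda sum_i c_i xi^(x_i), its quadratic variation and errors of
   two kinds: linear statistics of the small residue, and the fluctuations of
   (eta(x) - eta(y))^2 around 2p(1-p) on edges. The former are controlled by
   convexity and stationarity. The latter are superexponentially small: routing
   a unit flow from the edge to infinity writes them as a sum of gradients with
   summable energy, and the Feynman-Kac bound in L^2(nu_p) applies. Hoelder's
   inequality on both sides of the exponential martingale then gives
   (t/a^2) log E exp((a/t) sum_i c_i xi^(x_i)) --> c^T Gamma c / 2, and the
   Gartner-Ellis theorem concludes; Gamma comes from
   int_0^oo p_s(x, y) ds = d / (d^2 - 1) * d^(- dist(x, y)).
   Time integrals are replaced throughout by right Riemann sums, for which the
   Markov property can be iterated, and the mesh is sent to 0 at the end. *)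
Require Import Defs.
From mathcomp Require Import measurable_realfun ring lra.

Set Implicit Arguments.
Unset Strict Implicit.
Unset Printing Implicit Defensive.

(** * Levels of a tree *)

(** The semigroup is known only through its generator on cylinder functions, and the Markov property
    only at fixed times, so neither spectral calculus nor stochastic integrals are at hand. They are
    replaced by one fact: applied to a pattern read at k sites, the generator yields patterns read
    at k sites, with total weight multiplied by at most a constant depending on k and d. Hence
    explicit Euler products converge uniformly, and symmetry, energy decay and quasilocality pass
    from them to the semigroup. The balance of errors is as follows. With l = a_t / t one has l^2 t
    = a_t^2 / t, which diverges while l tends to 0. Hoelder's inequality with weight ka multiplies
    the error by about 1 / ka, and the logarithmic moment of this multiple has to be o(l^2 t). The
    truncation is refined with t (residue energy t^-2), yet the bounds on the truncated function
    stay fixed, since spheres grow like d^j while the square of the Green function decays like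
    d^(-2j). All errors then cost O(1 + l^3 t) for fixed ka, and ka is chosen beforehand in terms of
    the final precision. *)

Section Tree.
Variables (V : choiceType) (E : rel V).
Hypotheses (Esym : symmetric E) (Eirr : irreflexive E).
Hypothesis Econn : forall x y : V, exists s : seq V, path E x s /\ last x s = y.
Hypothesis Eacyc : forall c : seq V, ucycle E c -> (size c <= 2)%N.

(** If the two paths leave [x] through different neighbours, following one and returning along the
    other joins these neighbours without meeting [x]. After removal of repetitions, [x] closes this
    into a cycle of length at least 3. *)
Lemma simple_path_uniq x p p' : path E x p -> uniq (x :: p) ->
  path E x p' -> uniq (x :: p') -> last x p = last x p' -> p = p'.
Proof.
elim: p x p' => [|y p IH] x [|y' p'] //=.
- by move=> _ _ _ /andP[xn _] e; move: xn; rewrite {1}e mem_last.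
- by move=> _ /andP[xn _] _ _ e; move: xn; rewrite -{1}e mem_last.
move=> /andP[Exy py] /andP[xn up] /andP[Exy' py'] /andP[xn' up'] e.
have [eyy|nyy] := eqVneq y y'.
  by subst y'; congr cons; apply: IH e.
have ph : path E y (p ++ rev (belast y' p')).
  by rewrite cat_path py /= e rev_path; apply: sub_path py' => a b; rewrite Esym.
have eh : last y (p ++ rev (belast y' p')) = y'.
  rewrite last_cat e; case: (p') => [|z t] //=.
  by rewrite rev_cons last_rcons.
move: eh; case/shortenP: ph => r pr ur sr er.
have xnr : x \notin y :: r.
  apply/negP; rewrite inE => /orP[/eqP xy|/sr].
    by move: xn; rewrite xy mem_head.
  rewrite mem_cat => /orP[xp|]; first by move: xn; rewrite inE xp orbT.
  by rewrite mem_rev => /mem_belast xp; move: xn'; rewrite xp.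
have : ucycle E (x :: y :: r).
  apply/andP; split; last by rewrite cons_uniq xnr.
  by rewrite /= Exy rcons_path pr /= er Esym.
move/Eacyc; case: (r) er => [|//] /= eyy _.
by rewrite eyy eqxx in nyy.
Qed.

Lemma simple_path_ex x y :
  exists p, [&& path E x p, uniq (x :: p) & last x p == y].
Proof.
have [s [ps <-]] := Econn x y.
case/shortenP: ps => p' pp up _; exists p'; by rewrite pp up eqxx.
Qed.

Variable o : V.

Definition geodesic (x : V) : seq V := xchoose (simple_path_ex o x).
Definition depth (x : V) : nat := size (geodesic x).
(** At the root the geodesic is empty, and the default of [last] makes [o] its own parent. *)
Definition parent (x : V) : V := last o (belast o (geodesic x)).

Lemma geodesicP x :
  [/\ path E o (geodesic x), uniq (o :: geodesic x) & last o (geodesic x) = x].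
Proof.
by have /and3P[? ? /eqP ?] := xchooseP (simple_path_ex o x).
Qed.

Lemma geodesic_eq x p : path E o p -> uniq (o :: p) -> last o p = x ->
  geodesic x = p.
Proof.
move=> pp up <-; have [pg ug eg] := geodesicP (last o p).
exact: simple_path_uniq pg ug pp up eg.
Qed.

Lemma depth0 : depth o = 0%N.
Proof. by rewrite /depth (@geodesic_eq o [::]). Qed.

Lemma depth_eq0 x : depth x = 0%N -> x = o.
Proof. by move/size0nil => e; have [_ _] := geodesicP x; rewrite e. Qed.

Lemma geodesic_rcons x p y : path E o (rcons p y) -> uniq (o :: rcons p y) ->
  y = x -> depth x = (size p).+1 /\ parent x = last o p.
Proof.
move=> pp up yx.
have eg : geodesic x = rcons p y.
  by apply: geodesic_eq => //; rewrite last_rcons.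
by rewrite /depth /parent eg size_rcons belast_rcons.
Qed.

(** If [y] is off the geodesic to [x], appending it gives the geodesic to [y]. If [y] lies on it,
    the rest of the geodesic from [y] to [x] closes up with the edge between them, so acyclicity
    leaves no room for intermediate vertices. *)
Lemma neighbor_cases x y : E x y ->
  (depth y = (depth x).+1 /\ parent y = x) \/
  (depth x = (depth y).+1 /\ y = parent x).
Proof.
move=> Exy; have [pg ug eg] := geodesicP x.
have [yin|ynin] := boolP (y \in o :: geodesic x); last first.
  left; have [|||-> ->] := @geodesic_rcons y (geodesic x) y; rewrite ?eg //.
    by rewrite rcons_path pg eg.
  by rewrite -rcons_cons rcons_uniq ynin ug.
right; case: (splitPl yin) pg ug eg => p1 p2 ey pg ug eg.
have pp1 : path E o p1 by move: pg; rewrite cat_path => /andP[].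
have up1 : uniq (o :: p1) by move: ug; rewrite -cat_cons cat_uniq => /andP[].
have gy : geodesic y = p1 by apply: geodesic_eq.
have p2y : path E y p2 by move: pg; rewrite cat_path ey => /andP[].
have u2 : uniq (y :: p2).
  move: ug; rewrite -cat_cons lastI -cats1 -catA cat_uniq ey => /and3P[_ _].
  by [].
have e2 : last y p2 = x by move: eg; rewrite last_cat ey.
have s2 : p2 = [:: x].
  have /Eacyc : ucycle E (y :: p2).
    by rewrite /ucycle u2 andbT /= rcons_path p2y e2.
  case: (p2) e2 => [|z [|//]] /=; last by move=> ->.
  by move=> yx; rewrite yx Eirr in Exy.
have gx : geodesic x = rcons p1 x.
  by apply: geodesic_eq; rewrite ?last_rcons // -cats1 -s2.
by rewrite /depth /parent gx gy size_rcons belast_rcons /= ey.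
Qed.

Lemma parent_adj x : x != o -> E (parent x) x /\ depth x = (depth (parent x)).+1.
Proof.
move=> xo; have [] := geodesicP x; have := erefl (geodesic x).
case: {2 3 4 5}(geodesic x) / lastP => [|p z] eg pg ug /=.
  by move=> ox; rewrite ox eqxx in xo.
rewrite last_rcons => zx; subst z.
have Epx : E (last o p) x by move: pg; rewrite rcons_path => /andP[].
have -> : parent x = last o p by rewrite /parent eg belast_rcons.
split => //.
have -> : depth x = (size p).+1 by rewrite /depth eg size_rcons.
rewrite /depth (@geodesic_eq (last o p) p) //.
  by move: pg; rewrite rcons_path => /andP[].
by move: ug; rewrite -rcons_cons rcons_uniq => /andP[].
Qed.

Variables (nb : V -> seq V) (d : nat).
Hypotheses (nbP : forall x y, (y \in nb x) = E x y)
  (nb_uniq : forall x, uniq (nb x)) (nb_size : forall x, size (nb x) = d.+1).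

(** An oriented edge stands for the subtree behind its head; removing the tail forbids going
    back. *)
Definition children (e : V * V) : seq (V * V) :=
  [seq (e.2, w) | w <- nb e.2 & w != e.1].

(** The initial list is a parameter because two cases are needed: the whole star of [o], which gives
    spheres, and a single edge, which gives the branch carrying a flow to infinity. *)
Fixpoint level (I : seq (V * V)) (j : nat) : seq (V * V) :=
  if j is j'.+1 then flatten (map children (level I j')) else I.

Lemma size_children e : E e.1 e.2 -> size (children e) = d.
Proof.
move=> Ee; rewrite size_map -rem_filter // size_rem ?nb_size //.
by rewrite nbP Esym.
Qed.

Section Level.
Variable I : seq (V * V).
Hypotheses (I_root : forall e, e \in I -> e.1 = o /\ E o e.2) (I_uniq : uniq I).

Lemma level_spec j e : e \in level I j ->
  [/\ E e.1 e.2, depth e.2 = j.+1 & parent e.2 = e.1].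
Proof.
elim: j e => [|j IH] e /=.
  case: e => a b /I_root /= [-> Eob]; split => //.
    have [[-> _]|[]] := neighbor_cases Eob; by rewrite depth0.
  by have [[_ ->]|[]] := neighbor_cases Eob; rewrite ?depth0.
move=> /flattenP[s /mapP[e' e'in ->]] /mapP[w].
rewrite mem_filter nbP => /andP[wn Ew] -> /=.
have [Ee' de' pe'] := IH _ e'in.
have [[-> ->]|[_ wp]] := neighbor_cases Ew; first by rewrite de'.
by rewrite wp pe' eqxx in wn.
Qed.

Lemma level_size j : size (level I j) = (size I * d ^ j)%N.
Proof.
elim: j => [|j IH] /=; first by rewrite expn0 muln1.
rewrite size_flatten /shape -map_comp.
have -> : map (size \o children) (level I j) = map (fun=> d) (level I j).
  by apply/eq_in_map => e /level_spec[Ee _ _]; rewrite /= size_children.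
by rewrite sumnE big_map big_const_seq iter_addn_0 count_predT IH expnS mulnCA.
Qed.

(** A head determines its tail, namely its parent, and this tail is the head of the edge one level
    below; so two equal heads come from the same edge there. *)
Lemma level_uniq2 j : uniq (map snd (level I j)).
Proof.
elim: j => [|j IH] /=.
  rewrite map_inj_in_uniq // => -[a b] [a' b'] /I_root[/= -> _] /I_root[/= -> _].
  by move=> ->.
rewrite map_flatten -map_comp.
suff flat s : {subset s <= level I j} -> uniq (map snd s) ->
  uniq (flatten (map (map snd \o children) s)) by exact: flat IH.
elim: s => [//|e s IHs] sub /= /andP[en us].
rewrite cat_uniq IHs //; last by move=> x xs; apply: sub; rewrite inE xs orbT.
have ee : e \in level I j by apply: sub; rewrite mem_head.
rewrite andbT; apply/andP; split.
  rewrite /children -map_comp map_inj_uniq; last by move=> x y.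
  exact: filter_uniq.
apply/negP => /hasP[w /flattenP[t /mapP[e' e's ->]]] /mapP[f' f'in ->].
move=> /mapP[f fin /= eff].
have e'e : e' \in level I j by apply: sub; rewrite inE e's orbT.
have f'l : f' \in level I j.+1 by apply/flattenP; exists (children e') => //; apply: map_f.
have fl : f \in level I j.+1 by apply/flattenP; exists (children e) => //; apply: map_f.
have [_ _ pf'] := level_spec f'l.
have [_ _ pf] := level_spec fl.
move/mapP: fin => [w1 _ ef]; move/mapP: f'in => [w2 _ ef'].
have ee2 : e.2 = e'.2.
  by transitivity f.1; [rewrite ef|transitivity f'.1; [rewrite -pf -pf' eff|rewrite ef']].
move: en; rewrite ee2 => /negP; apply.
exact: map_f.
Qed.

Lemma level_uniq j : uniq (level I j).
Proof. exact: map_uniq (level_uniq2 j). Qed.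

Lemma levels_uniq n : uniq (flatten [seq level I j | j <- iota 0 n]).
Proof.
elim: n => [//|n IH]; rewrite -addn1 iotaD map_cat flatten_cat cat_uniq IH /=.
rewrite cats0 level_uniq andbT; apply/hasP => -[e /level_spec[_ de _]].
move=> /flattenP[s /mapP[j]]; rewrite mem_iota add0n => /andP[_ jn] ->.
by move=> /level_spec[_ de' _]; move: jn; rewrite -ltnS -de' de ltnn.
Qed.

End Level.

Definition star : seq (V * V) := [seq (o, w) | w <- nb o].

Lemma star_root e : e \in star -> e.1 = o /\ E o e.2.
Proof. by move=> /mapP[w]; rewrite nbP => Eow ->. Qed.

Lemma star_uniq : uniq star.
Proof. by rewrite map_inj_uniq // => x y []. Qed.

Lemma level_star x j : depth x = j.+1 -> (parent x, x) \in level star j.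
Proof.
elim: j x => [|j IH] x dx.
  have xo : x != o by apply/eqP => xo; rewrite xo depth0 in dx.
  have [Ep] := parent_adj xo; rewrite dx => -[/esym/depth_eq0 po].
  by rewrite po; apply: map_f; rewrite nbP -{1}po.
have xo : x != o by apply/eqP => xo; rewrite xo depth0 in dx.
have [Ep] := parent_adj xo; rewrite dx => -[/esym dp].
apply/flattenP; exists (children (parent (parent x), parent x)).
  exact/map_f/IH.
apply/mapP; exists x => //; rewrite mem_filter nbP Ep andbT /=.
apply/eqP => xp.
have po : parent x != o by apply/eqP => po; rewrite po depth0 in dp.
have [_] := parent_adj po; rewrite -xp dx dp => e.
by have := ltnSn j.+1; rewrite {1}e -ltnS ltnNge leqnSn.
Qed.

Definition sphere (j : nat) : seq V :=
  if j is j'.+1 then map snd (level star j') else [:: o].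

Lemma sphereP j x : (x \in sphere j) = (depth x == j).
Proof.
case: j => [|j] /=.
  rewrite inE; apply/eqP/eqP => [->|]; [exact: depth0|exact: depth_eq0].
apply/mapP/eqP => [[e /(level_spec star_root)[_ de _] -> //]|dx].
by exists (parent x, x) => //; exact: level_star.
Qed.

Lemma sphere_uniq j : uniq (sphere j).
Proof. by case: j => [//|j] /=; apply: level_uniq2 star_root star_uniq _. Qed.

(** An equality for positive [j]. At [j = 0] the truncated predecessor turns the right side into
    [d.+1], which is merely an upper bound. *)
Lemma sphere_size j : (size (sphere j) <= d.+1 * d ^ j.-1)%N.
Proof.
case: j => [|j] /=; first by rewrite muln1.
by rewrite size_map (level_size star_root) size_map nb_size.
Qed.

Definition tree_ball (n : nat) : seq V := flatten [seq sphere j | j <- iota 0 n].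

Lemma tree_ballP n x : (x \in tree_ball n) = (depth x < n)%N.
Proof.
apply/flattenP/idP => [[s /mapP[j]]|dx].
  by rewrite mem_iota add0n => /andP[_ jn] ->; rewrite sphereP => /eqP ->.
exists (sphere (depth x)); last by rewrite sphereP.
by apply: map_f; rewrite mem_iota.
Qed.

Lemma tree_ball_uniq n : uniq (tree_ball n).
Proof.
rewrite /tree_ball; elim: n => [//|n IH].
rewrite -addn1 iotaD map_cat flatten_cat cat_uniq IH /= cats0 sphere_uniq andbT.
apply/hasP => -[e]; rewrite sphereP => /eqP de.
move=> /flattenP[s /mapP[j]]; rewrite mem_iota add0n => /andP[_ jn] ->.
by rewrite sphereP => /eqP de'; move: jn; rewrite -de' de ltnn.
Qed.

End Tree.

Local Open Scope classical_set_scope.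
Local Open Scope ring_scope.

(** * Elementary bounds on the exponential *)

(** Squaring the tangent bound at [- (x / 2)] gives an upper bound [(1 - x / 2) ^- 2] for the
    exponential. Comparing it with the quadratic polynomial comes down to [1 - 3 * x + x ^+ 2] being
    nonnegative. *)
Lemma expR_le_quadratic (R : realType) (x : R) : `|x| <= 4^-1 ->
  expR x <= 1 + x + x ^+ 2.
Proof.
rewrite ler_norml => /andP[x1 x2].
have h := expR_ge1Dx (- (x / 2)).
have e2 : expR x * (expR (- (x / 2)) * expR (- (x / 2))) = 1.
  by rewrite -!expRD (_ : x + _ = 0) ?expR0 //; field.
have u0 : 0 < 1 - x / 2 by lra.
have sq : (1 - x / 2) ^+ 2 <= expR (- (x / 2)) * expR (- (x / 2)).
  by rewrite expr2 ler_pM ?(ltW u0).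
have h2 : expR x * (1 - x / 2) ^+ 2 <= 1.
  by rewrite -[leRHS]e2 ler_pM2l ?expR_gt0.
have h3 : 1 <= (1 + x + x ^+ 2) * (1 - x / 2) ^+ 2.
  have -> : (1 + x + x ^+ 2) * (1 - x / 2) ^+ 2 = 1 + x ^+ 2 / 4 * (1 - 3 * x + x ^+ 2).
    by field.
  rewrite lerDl mulr_ge0 ?divr_ge0 ?sqr_ge0 ?ler0n //.
  have := sqr_ge0 x; lra.
by rewrite -(ler_pM2r (exprn_gt0 2 u0)) (le_trans h2 h3).
Qed.

(** Mean value theorem: the derivative of the remainder is [expR c - 1 - c], already known to lie
    between 0 and [c ^+ 2]. *)
Lemma expR_taylor2 (R : realType) (x : R) : `|x| <= 4^-1 ->
  `|expR x - 1 - x - x ^+ 2 / 2| <= `|x| ^+ 3.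
Proof.
move=> xs; pose h (y : R) := expR y - 1 - y - y ^+ 2 / 2.
pose dh (y : R) := expR y - 1 - y.
have dhP (y : R) : is_derive y (1 : R) h (dh y).
  rewrite /h; apply: is_derive_eq; rewrite /dh /GRing.scale /=; by field.
have ch : continuous h.
  by move=> y; apply/differentiable_continuous/derivable1_diffP; case: (dhP y).
have h0 : h 0 = 0 by rewrite /h expR0; ring.
have dh_le c : `|c| <= `|x| -> `|dh c| <= `|x| ^+ 2.
  move=> cx; have := expR_ge1Dx c; have := expR_le_quadratic (le_trans cx xs).
  have : c ^+ 2 <= `|x| ^+ 2 by rewrite -normrX -[leLHS]ger0_norm ?sqr_ge0 // !normrX lerXn2r ?nnegrE.
  by rewrite /dh => h1 h2 h3; rewrite ger0_norm; lra.
rewrite -/(h x).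
have [x0|x0|<-] := ltgtP 0 x; last by rewrite h0 normr0 exprn_ge0.
- have [|c] := MVT x0 (fun y _ => dhP y); first exact: continuous_subspaceT.
  rewrite in_itv /= h0 !subr0 => /andP[c0 cx] ->.
  by rewrite normrM exprSr ler_wpM2r // dh_le // !gtr0_norm // ltW.
- have [|c] := MVT x0 (fun y _ => dhP y); first exact: continuous_subspaceT.
  rewrite in_itv /= h0 !sub0r => /andP[c0 cx] e.
  have -> : h x = dh c * x by lra.
  by rewrite normrM exprSr ler_wpM2r // dh_le // !ltr0_norm // lerN2 ltW.
Qed.

(** * The generator on cylinder functions *)

Section Cylinder.
Context (R : realType) (V : choiceType).
Implicit Types (f g : config V -> R) (A : seq V) (zeta : config V).

Definition depends_on A f := forall zeta zeta' : config V,
  {in A, forall x, zeta x = zeta' x} -> f zeta = f zeta'.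

Lemma cylinder_cst c : cylinder_fun (fun _ : config V => c : R).
Proof. by exists [::]. Qed.

Lemma cylinder_coord (F : bool -> R) x : cylinder_fun (fun zeta : config V => F (zeta x)).
Proof. by exists [:: x] => z z' ->; rewrite ?mem_head. Qed.

Lemma cylinder_op1 (F : R -> R) f : cylinder_fun f -> cylinder_fun (fun z => F (f z)).
Proof. by move=> [A hA]; exists A => z z' e; rewrite (hA z z'). Qed.

Lemma cylinder_op2 (F : R -> R -> R) f g : cylinder_fun f -> cylinder_fun g ->
  cylinder_fun (fun z => F (f z) (g z)).
Proof.
move=> [A hA] [B hB]; exists (A ++ B) => z z' e; rewrite (hA z z') ?(hB z z') //.
- by move=> x xB; apply: e; rewrite mem_cat xB orbT.
- by move=> x xA; apply: e; rewrite mem_cat xA.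
Qed.

Lemma cylinder_sum (I : Type) (s : seq I) (f : I -> config V -> R) :
  (forall i, cylinder_fun (f i)) -> cylinder_fun (fun z => \sum_(i <- s) f i z).
Proof.
move=> cf; elim: s => [|i s IH].
  by under [X in cylinder_fun X]eq_fun do rewrite big_nil; exact: cylinder_cst.
under [X in cylinder_fun X]eq_fun do rewrite big_cons.
exact: (cylinder_op2 +%R).
Qed.

Lemma depends_on_exchange A f x y : depends_on A f ->
  depends_on [:: x, y & A] (fun z => f (exchange x y z)).
Proof.
move=> h z z' e; apply: h => u uA; rewrite /exchange.
case: ifP => _; first by apply: e; rewrite !inE eqxx orbT.
case: ifP => _; first by apply: e; rewrite !inE eqxx.
by apply: e; rewrite !inE uA !orbT.
Qed.

Lemma cylinder_exchange f x y : cylinder_fun f ->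
  cylinder_fun (fun z => f (exchange x y z)).
Proof. by move=> [A hA]; exists [:: x, y & A]; exact: depends_on_exchange. Qed.

Lemma exchange_out A f x y zeta : depends_on A f -> x \notin A -> y \notin A ->
  f (exchange x y zeta) = f zeta.
Proof.
move=> h xA yA; apply: h => u uA; rewrite /exchange.
by case: eqP => [ux|_]; [rewrite -ux uA in xA|case: eqP => [uy|//]; rewrite -uy uA in yA].
Qed.

Lemma exchangeK x y : involutive (@exchange V x y).
Proof.
move=> z; apply/funext => u; rewrite /exchange /=.
case: (eqVneq u x) => [->|ux].
  by case: (eqVneq y x) => [-> //|_]; rewrite eqxx.
by case: (eqVneq u y) => [->|uy] //; rewrite eqxx.
Qed.

Definition local_config (n : nat) (a : {ffun 'I_n -> V}) zeta : {ffun 'I_n -> bool} :=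
  [ffun i => zeta (a i)].

(** Repetitions are removed from the list of sites because the product law evaluates only patterns
    read at distinct sites. *)
Lemma cylinder_rep f : cylinder_fun f -> exists n (a : {ffun 'I_n -> V})
  (F : {ffun 'I_n -> bool} -> R),
  injective a /\ f = (fun zeta => F (local_config a zeta)).
Proof.
move=> [A hA]; pose B := undup A.
exists (size B), [ffun i => tnth (in_tuple B) i].
pose ext (b : {ffun 'I_(size B) -> bool}) : config V := fun v =>
  if insub (index v B) is Some i then b i else false.
exists (fun b => f (ext b)); split.
  have /tuple_uniqP tinj : uniq (in_tuple B) := undup_uniq A.
  by move=> i j; rewrite !ffunE => /tinj.
apply/funext => z; apply: hA => x; rewrite -mem_undup -/B => xA.
rewrite /ext insubT ?index_mem // => xl; rewrite !ffunE (tnth_nth x) /=.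
by rewrite nth_index.
Qed.

Lemma cylinder_bounded f : cylinder_fun f -> exists M, 0 <= M /\ forall z, `|f z| <= M.
Proof.
move=> /cylinder_rep[n [a [F [_ ->]]]]; exists (\sum_b `|F b|); split.
  by apply: sumr_ge0.
by move=> z; rewrite (bigD1 (local_config a z)) //= lerDl sumr_ge0.
Qed.

Lemma cylinder_nbhs A zeta :
  nbhs zeta [set zeta' : config V | {in A, forall x, zeta' x = zeta x}].
Proof.
elim: A => [|x A IH].
  by apply: (@filterS _ _ _ setT); [move=> z _ x | exact: filterT].
have nx : nbhs zeta [set z' : config V | z' x = zeta x].
  have := (@proj_continuous V (fun=> bool) x zeta) [set b | b = zeta x].
  apply; exact: discrete_set1.
apply: filterS2 nx IH => z' /= e h u; rewrite inE => /orP[/eqP ->//|]; exact: h.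
Qed.

Lemma cylinder_continuous f : cylinder_fun f -> continuous f.
Proof.
move=> [A hA] zeta B nB; rewrite /nbhs /=.
apply: filterS (cylinder_nbhs A zeta) => z' /= e; rewrite (hA z' zeta) //.
exact: nbhs_singleton nB.
Qed.

(** The working class of observables: unlike cylinder functions it is stable under the semigroup,
    and its members are continuous, bounded and measurable along the process. *)
Definition quasilocal f := forall e, 0 < e ->
  exists2 g, cylinder_fun g & forall z, `|f z - g z| <= e.

Lemma cylinder_quasilocal f : cylinder_fun f -> quasilocal f.
Proof. by move=> cf e e0; exists f => // z; rewrite subrr normr0 ltW. Qed.

Lemma quasilocal_bounded f : quasilocal f -> exists M, 0 <= M /\ forall z, `|f z| <= M.
Proof.
move=> /(_ 1 ltr01)[g /cylinder_bounded[M [M0 hM]] fg]; exists (1 + M); split.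
  by rewrite addr_ge0.
move=> z; have -> : f z = (f z - g z) + g z by rewrite subrK.
exact: le_trans (ler_normD _ _) (lerD _ _).
Qed.

Lemma quasilocal_continuous f : quasilocal f -> continuous f.
Proof.
move=> qf zeta; apply/cvgrPdist_le => e e0.
have [g cg fg] := qf _ (divr_gt0 e0 (ltr0n _ 3)).
have cgz : g z @[z --> zeta] --> g zeta by exact: cylinder_continuous.
have /cvgrPdist_le/(_ _ (divr_gt0 e0 (ltr0n _ 3))) := cgz.
apply: filterS => z h.
have -> : f zeta - f z = (f zeta - g zeta) + (g zeta - g z) - (f z - g z) by ring.
rewrite (le_trans (ler_normB _ _)) // (le_trans (lerD (ler_normD _ _) (lexx _))) //.
have := fg zeta; have := fg z; lra.
Qed.

Lemma quasilocal_add f g : quasilocal f -> quasilocal g ->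
  quasilocal (fun z => f z + g z).
Proof.
move=> qf qg e e0; have e2 : 0 < e / 2 by rewrite divr_gt0.
have [f' cf ff] := qf _ e2; have [g' cg gg] := qg _ e2.
exists (fun z => f' z + g' z); first exact: (cylinder_op2 +%R).
move=> z; have -> : f z + g z - (f' z + g' z) = (f z - f' z) + (g z - g' z) by ring.
by rewrite (le_trans (ler_normD _ _)) //; have := ff z; have := gg z; lra.
Qed.

Lemma quasilocal_mul f g : quasilocal f -> quasilocal g ->
  quasilocal (fun z => f z * g z).
Proof.
move=> qf qg e e0.
have [M [M0 hM]] := quasilocal_bounded qf.
have [N [N0 hN]] := quasilocal_bounded qg.
have d1 : 0 < e / (2 * (N + 1)) by rewrite divr_gt0 // mulr_gt0 // ltr_wpDl.
have [f' cf ff] := qf _ d1.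
have [M' [M'0 hM']] := cylinder_bounded cf.
have d2 : 0 < e / (2 * (M' + 1)) by rewrite divr_gt0 // mulr_gt0 // ltr_wpDl.
have [g' cg gg] := qg _ d2.
exists (fun z => f' z * g' z); first exact: (cylinder_op2 *%R).
move=> z.
have -> : f z * g z - f' z * g' z = (f z - f' z) * g z + f' z * (g z - g' z) by ring.
rewrite (le_trans (ler_normD _ _)) // !normrM.
have h1 : `|f z - f' z| * `|g z| <= e / 2.
  apply: le_trans (_ : e / (2 * (N + 1)) * (N + 1) <= _).
    by apply: ler_pM => //; rewrite (le_trans (hN z)) // lerDl.
  by rewrite le_eqVlt; apply/orP; left; apply/eqP; field; rewrite gt_eqF // ltr_wpDl.
have h2 : `|f' z| * `|g z - g' z| <= e / 2.
  apply: le_trans (_ : (M' + 1) * (e / (2 * (M' + 1))) <= _).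
    by apply: ler_pM => //; rewrite (le_trans (hM' z)) // lerDl.
  by rewrite le_eqVlt; apply/orP; left; apply/eqP; field; rewrite gt_eqF // ltr_wpDl.
lra.
Qed.

Lemma quasilocal_scale c f : quasilocal f -> quasilocal (fun z => c * f z).
Proof. by apply: quasilocal_mul; apply: cylinder_quasilocal; exact: cylinder_cst. Qed.

Lemma quasilocal_exchange f x y : quasilocal f ->
  quasilocal (fun z => f (exchange x y z)).
Proof.
move=> qf e e0; have [g cg fg] := qf e e0.
by exists (fun z => g (exchange x y z)) => //; exact: cylinder_exchange.
Qed.

Lemma quasilocal_lim f : (forall e, 0 < e ->
  exists2 g, quasilocal g & forall z, `|f z - g z| <= e) -> quasilocal f.
Proof.
move=> h e e0; have e2 : 0 < e / 2 by rewrite divr_gt0.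
have [g qg fg] := h _ e2; have [k ck gk] := qg _ e2; exists k => // z.
have -> : f z - k z = (f z - g z) + (g z - k z) by ring.
by rewrite (le_trans (ler_normD _ _)) //; have := fg z; have := gk z; lra.
Qed.

End Cylinder.

Section Generator.
Context (R : realType) (V : choiceType) (E : rel V) (d : nat).
Hypotheses (Esym : symmetric E) (Eirr : irreflexive E).
Variable nb : V -> seq V.
Hypotheses (nbP : forall x y, (y \in nb x) = E x y)
  (nb_uniq : forall x, uniq (nb x)) (nb_size : forall x, size (nb x) = d.+1).
Implicit Types (f g : config V -> R) (A B : seq V).

Definition nbhd A : seq V := undup (A ++ flatten (map nb A)).

Lemma nbhd_uniq A : uniq (nbhd A).
Proof. exact: undup_uniq. Qed.

Lemma nbhd_sub A : {subset A <= nbhd A}.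
Proof. by move=> x xA; rewrite mem_undup mem_cat xA. Qed.

Lemma nbhd_adj A x y : x \in A -> E x y -> y \in nbhd A.
Proof.
move=> xA Exy; rewrite mem_undup mem_cat; apply/orP; right.
by apply/flattenP; exists (nb x); [exact: map_f|rewrite nbP].
Qed.

Lemma nbhd_mono A B : {subset A <= B} -> {subset nbhd A <= nbhd B}.
Proof.
move=> AB x; rewrite !mem_undup !mem_cat => /orP[/AB -> //|/flattenP[s]].
move=> /mapP[y /AB yB ->] xy; apply/orP; right; apply/flattenP; exists (nb y) => //.
exact: map_f.
Qed.

Lemma nbhd_size A : (size (nbhd A) <= size A * d.+2)%N.
Proof.
rewrite (leq_trans (size_undup _)) // size_cat.
have -> : size (flatten (map nb A)) = (size A * d.+1)%N.
  by elim: A => //= x A IH; rewrite size_cat nb_size IH mulSn.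
by rewrite [X in (_ <= X)%N]mulnS.
Qed.

Definition arcs B : seq (V * V) := [seq e <- [seq (x, y) | x <- B, y <- B] | E e.1 e.2].

Lemma mem_arcs B e : (e \in arcs B) = [&& E e.1 e.2, e.1 \in B & e.2 \in B].
Proof.
rewrite mem_filter; congr andb; case: e => x y /=.
by apply/allpairsP/andP => [[[a b] /= [aB bB [-> ->]]]|[xB yB]] //; exists (x, y).
Qed.

Lemma arcs_uniq B : uniq B -> uniq (arcs B).
Proof.
by move=> uB; apply: filter_uniq; apply: allpairs_uniq => // -[a b] [a' b'] _ _ /= [-> ->].
Qed.

Lemma arcs_size B : (size (arcs B) <= size B * size B)%N.
Proof. by rewrite size_filter (leq_trans (count_size _ _)) // size_allpairs. Qed.

Lemma big_arcs B (F : V -> V -> R) :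
  \sum_(e <- arcs B) F e.1 e.2 = \sum_(x <- B) \sum_(y <- B | E x y) F x y.
Proof.
rewrite big_filter big_mkcond big_allpairs /=; apply: eq_bigr => x _.
by rewrite -big_mkcond.
Qed.

Lemma big_arcs_sym B (F : V -> V -> R) :
  \sum_(e <- arcs B) F e.1 e.2 = \sum_(e <- arcs B) F e.2 e.1.
Proof.
rewrite big_arcs (big_arcs B (fun x y => F y x)).
under eq_bigr do rewrite big_mkcond.
rewrite exchange_big /=; apply: eq_bigr => x _; rewrite [RHS]big_mkcond.
by apply: eq_bigr => y _; rewrite Esym.
Qed.

Definition gen B f (zeta : config V) : R :=
  2^-1 * \sum_(e <- arcs B) (f (exchange e.1 e.2 zeta) - f zeta).

(** An exchange away from [A] does nothing, and every edge meeting [A] has both ends in [nbhd A].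
    Since any larger window works as well, several functions can be treated over a common one. *)
Lemma genE A B f : uniq B -> {subset nbhd A <= B} -> depends_on A f ->
  ssep_generator E f = gen B f.
Proof.
move=> uB AB hf; apply/funext => z; rewrite /ssep_generator /gen; congr (_ * _).
rewrite (big_arcs B (fun x y => f (exchange x y z) - f z)).
have inner x : \sum_(y \in [set y | E x y]) (f (exchange x y z) - f z) =
    \sum_(y <- nb x) (f (exchange x y z) - f z).
  rewrite [RHS]fsbig_seq //; apply: eq_fsbigl.
  by apply/seteqP; split => y /=; rewrite nbP.
under eq_fsbigr do rewrite inner.
have supp x : x \notin B -> \sum_(y <- nb x) (f (exchange x y z) - f z) = 0.
  move=> xB; rewrite big1_seq // => y /andP[_]; rewrite nbP => Exy.
  rewrite (@exchange_out _ _ A) ?subrr //.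
    by apply: contra xB => xA; apply/AB/nbhd_sub.
  by apply: contra xB => yA; apply/AB/(nbhd_adj yA); rewrite Esym.
rewrite (@fsbigE _ _ _ _ [set: V] B) //; last by move=> x _; exact: supp.
rewrite big_mkcond /=; apply: eq_big_seq => x xB; rewrite in_setT.
rewrite -[RHS]big_filter (bigID [pred y | y \in B]) /= [X in _ + X]big1_seq ?addr0.
  rewrite -big_filter; apply: perm_big; apply: uniq_perm; rewrite ?filter_uniq //.
  by move=> y; rewrite !mem_filter nbP andbC.
move=> y /andP[yB]; rewrite nbP => Exy.
rewrite (@exchange_out _ _ A) ?subrr //; last first.
  by apply: contra yB => yA; apply/AB/nbhd_sub.
by apply: contra yB => xA; apply/AB/(nbhd_adj xA).
Qed.

Lemma gen_cylinder f : cylinder_fun f -> cylinder_fun (ssep_generator E f).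
Proof.
move=> [A hA]; rewrite (genE (nbhd_uniq A) (fun x h => h) hA).
apply: (cylinder_op1 (fun r => 2^-1 * r)); apply: cylinder_sum => e.
apply: (cylinder_op2 (fun a b => a - b)); last by exists A.
by apply: cylinder_exchange; exists A.
Qed.

Lemma genD f g c : cylinder_fun f -> cylinder_fun g ->
  ssep_generator E (fun z => f z + c * g z) =
  (fun z => ssep_generator E f z + c * ssep_generator E g z).
Proof.
move=> [A hA] [B hB]; set C := nbhd (A ++ B).
have sA : {subset A <= A ++ B} by move=> x xA; rewrite mem_cat xA.
have sB : {subset B <= A ++ B} by move=> x xB; rewrite mem_cat xB orbT.
rewrite (@genE A C f) ?nbhd_uniq //; last exact: nbhd_mono.
rewrite (@genE B C g) ?nbhd_uniq //; last exact: nbhd_mono.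
rewrite (@genE (A ++ B) C) ?nbhd_uniq //; last first.
  move=> z z' e; rewrite (hA z z') ?(hB z z') //.
    by move=> x /sB; exact: e.
  by move=> x /sA; exact: e.
apply/funext => z; rewrite /gen mulrCA -mulrDr; congr (_ * _).
by rewrite mulr_sumr -big_split /=; apply: eq_bigr => e _; ring.
Qed.

End Generator.

(** * Green function and truncated potentials *)

Lemma sum_seq_le_supp (R : realType) (V : eqType) (A B : seq V) (F : V -> R) :
  uniq A -> uniq B -> (forall z, 0 <= F z) -> (forall z, F z != 0 -> z \in A) ->
  \sum_(z <- B) F z <= \sum_(z <- A) F z.
Proof.
move=> uA uB F0 FA.
rewrite (bigID (mem A)) /= [X in _ + X]big1 ?addr0; last first.
  by move=> z zA; apply/eqP; apply: contraNT zA => /FA.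
rewrite [leRHS](bigID (mem B)) /= -[leLHS]big_filter -[X in _ <= X + _]big_filter.
rewrite (perm_big [seq z <- A | z \in B]).
  by rewrite lerDl; apply: sumr_ge0.
by apply: uniq_perm; rewrite ?filter_uniq // => z; rewrite !mem_filter andbC.
Qed.

Lemma sqr_sum_le (R : realType) (m : nat) (a : 'I_m -> R) :
  (\sum_i a i) ^+ 2 <= m%:R * \sum_i a i ^+ 2.
Proof.
have -> : (\sum_i a i) ^+ 2 = \sum_i \sum_j a i * a j.
  by rewrite expr2 mulr_suml; apply: eq_bigr => i _; rewrite mulr_sumr.
apply: le_trans (_ : \sum_i \sum_j (2^-1 * a i ^+ 2 + 2^-1 * a j ^+ 2) <= _).
  apply: ler_sum => i _; apply: ler_sum => j _.
  have := sqr_ge0 (a i - a j); lra.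
set s := \sum_i a i ^+ 2.
have -> : \sum_i \sum_j (2^-1 * a i ^+ 2 + 2^-1 * a j ^+ 2) =
    \sum_(i < m) (m%:R * (2^-1 * a i ^+ 2) + 2^-1 * s).
  apply: eq_bigr => i _; rewrite big_split /= sumr_const card_ord -mulr_sumr.
  by rewrite -[_ *+ m]mulr_natl.
rewrite big_split /= sumr_const card_ord -mulr_sumr -mulr_sumr -/s -[_ *+ m]mulr_natl.
lra.
Qed.

Section Potential.
Context (R : realType) (V : choiceType) (E : rel V) (d : nat).
Hypotheses (Esym : symmetric E) (Eirr : irreflexive E).
Hypothesis Econn : forall x y : V, exists s : seq V, path E x s /\ last x s = y.
Hypothesis Eacyc : forall c : seq V, ucycle E c -> (size c <= 2)%N.
Variable nb : V -> seq V.
Hypotheses (nbP : forall x y, (y \in nb x) = E x y)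
  (nb_uniq : forall x, uniq (nb x)) (nb_size : forall x, size (nb x) = d.+1).
Hypothesis d2 : (2 <= d)%N.

Let D : R := d%:R.
Let D2 : 2 <= D. Proof. by rewrite ler_nat. Qed.
Let D0 : 0 < D. Proof. by rewrite ltr0n (leq_trans _ d2). Qed.

Definition lap (h : V -> R) (x : V) : R := \sum_(y <- nb x) (h y - h x).

(** Away from the root, [D ^- k] solves the radial harmonic equation. At the root the Laplacian of
    [c / D ^+ k] equals [- c * (D ^+ 2 - 1) / D], and this constant makes it -1. *)
Definition green_cst : R := d%:R / (d%:R ^+ 2 - 1).
Definition green (x y : V) : R := green_cst / d%:R ^+ (@depth V E Econn x y).

Let C := green_cst.
Let CE : C = D / (D ^+ 2 - 1). Proof. by []. Qed.

Let Dsq : 0 < D ^+ 2 - 1.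
Proof. have := D2; rewrite expr2 => h; have : 2 * 2 <= D * D by rewrite ler_pM. lra. Qed.

Lemma green_cst_gt0 : 0 < green_cst.
Proof. exact: divr_gt0. Qed.

Lemma green_cst_le1 : green_cst <= 1.
Proof.
rewrite -/C CE ler_pdivrMr // mul1r.
have h : 2 * D <= D ^+ 2 by rewrite expr2 ler_pM2r.
have := D2; lra.
Qed.

(** * Truncated Green function around one vertex *)

Section OneSource.
Variable o : V.
Let dep := @depth V E Econn o.

Lemma lap_radial (f : nat -> R) z : lap (fun y => f (dep y)) z =
  if z == o then (D + 1) * (f 1%N - f 0%N)
  else (f (dep z).-1 - f (dep z)) + D * (f (dep z).+1 - f (dep z)).
Proof.
have d0 : dep o = 0%N := depth0 Esym Econn Eacyc o.
have size_nb : (size (nb z))%:R = D + 1 :> R by rewrite nb_size -natr1.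
case: (eqVneq z o) => [->|zo].
  rewrite /lap (eq_big_seq (fun=> f 1%N - f 0%N)); last first.
    move=> y; rewrite nbP => Ey.
    have [[e _]|[e _]] := neighbor_cases Esym Eirr Econn Eacyc o Ey; rewrite -/dep d0 // in e.
    by rewrite e d0.
  rewrite big_const_seq count_predT iter_addr_0 -[_ *+ size _]mulr_natl.
  by rewrite nb_size -natr1.
have [Ep dz] := parent_adj Esym Econn Eacyc zo.
set q := @parent V E Econn o z in Ep dz.
have qnb : q \in nb z by rewrite nbP Esym.
rewrite /lap (bigD1_seq q) //= -/dep; congr (_ + _).
  by rewrite -/dep in dz; rewrite dz.
rewrite -big_filter (eq_big_seq (fun=> f (dep z).+1 - f (dep z))); last first.
  move=> y; rewrite mem_filter nbP => /andP[yq Ey].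
  have [[e _]|[_ e]] := neighbor_cases Esym Eirr Econn Eacyc o Ey.
    by rewrite -/dep in e; rewrite e.
  by rewrite e eqxx in yq.
rewrite big_const_seq count_predT iter_addr_0 -mulr_natl; congr (_ * _).
rewrite -rem_filter // size_rem // nb_size //.
Qed.

Variable N : nat.
Hypothesis N0 : (0 < N)%N.

Let f k : R := if (k < N)%N then C * ((D ^+ k)^-1 - (D ^+ N)^-1) else 0.

(** The value at depth [N] is subtracted before truncating, so the function reaches 0 continuously
    on that sphere. The Laplacian is then wrong only at depth [N], and there by at most [D ^- N]. *)
Definition cutoff (z : V) : R :=
  if (@depth V E Econn o z < N)%N then
    green_cst * ((d%:R ^+ (@depth V E Econn o z))^-1 - (d%:R ^+ N)^-1) else 0.

Let fE k : (k <= N)%N -> f k = C * ((D ^+ k)^-1 - (D ^+ N)^-1).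
Proof.
rewrite leq_eqVlt /f => /orP[/eqP ->|->//].
by rewrite ltnn subrr mulr0.
Qed.

Let Dk_gt0 k : 0 < (D ^+ k)^-1. Proof. by rewrite invr_gt0 exprn_gt0. Qed.

Let DN_le k : (k <= N)%N -> (D ^+ N)^-1 <= (D ^+ k)^-1.
Proof.
move=> kN; rewrite lef_pV2 ?posrE ?exprn_gt0 // ler_weXn2l //.
by have := D2; lra.
Qed.

Lemma cutoff_bound z : 0 <= cutoff z <= (d%:R ^+ (dep z))^-1.
Proof.
rewrite /cutoff -/dep; case: ifP => dz; last by rewrite lexx ltW.
have h := DN_le (ltnW dz); have := Dk_gt0 N => n0.
rewrite mulr_ge0 ?(ltW green_cst_gt0) ?subr_ge0 //=.
apply: le_trans (_ : 1 * ((D ^+ dep z)^-1 - (D ^+ N)^-1) <= _).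
  by rewrite ler_wpM2r ?subr_ge0 // green_cst_le1.
rewrite mul1r /D in n0 *; lra.
Qed.

Let lapf z : lap cutoff z + (z == o)%:R =
  if dep z == N then C * (D - 1) / D ^+ N else 0.
Proof.
have -> : lap cutoff z = lap (fun y => f (dep y)) z by [].
rewrite lap_radial.
have d0 : dep o = 0%N := depth0 Esym Econn Eacyc o.
have Dn0 : D != 0 by rewrite gt_eqF.
have D1n0 : D ^+ 2 - 1 != 0 by rewrite gt_eqF.
have DN0 k : D ^+ k != 0 by rewrite expf_neq0.
case: (eqVneq z o) => [->|zo].
  rewrite d0 (fE N0) (fE (leq0n N)) (ltn_eqF N0) expr1 expr0 CE mulr1n.
  by field; rewrite Dn0 DN0 D1n0.
rewrite mulr0n addr0; have [_] := parent_adj Esym Econn Eacyc zo.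
rewrite -/dep; set k := dep (parent _ _ _) => dz; rewrite dz /=.
have [kN|Nk|kN] := ltngtP k.+1 N.
- rewrite (fE kN) (fE (ltnW kN)) (fE (ltnW (ltnW kN))) !exprS.
  by field; rewrite !DN0 Dn0.
- have nk j : (N < j)%N -> f j = 0 by move=> /ltnW Nj; rewrite /f ltnNge Nj.
  have fk : f k = 0 by rewrite /f ltnNge -ltnS Nk.
  by rewrite fk (nk _ Nk) (nk _ (ltnW Nk : (N < k.+2)%N)) subrr mulr0 addr0.
- have f2 : f k.+2 = 0 by rewrite /f kN ltnNge leqnSn.
  have kN' : (k <= N)%N by rewrite -kN.
  rewrite f2 (fE kN') -kN /f kN ltnn -kN exprS.
  by field; rewrite DN0 Dn0.
Qed.

Definition residue z : R := lap cutoff z + (z == o)%:R.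

Lemma residue_bound z : `|residue z| <= if dep z == N then (d%:R ^+ N)^-1 else 0.
Proof.
rewrite /residue lapf; case: ifP => _; last by rewrite normr0.
have := D2 => D2'.
have D1 : 0 <= D - 1 by lra.
rewrite ger0_norm; last first.
  exact: mulr_ge0 (mulr_ge0 (ltW green_cst_gt0) D1) (ltW (Dk_gt0 N)).
rewrite -/D ler_piMl ?(ltW (Dk_gt0 N)) // CE mulrAC ler_pdivrMr // mul1r.
by rewrite mulrBr mulr1 -expr2 lerD2l lerN2; lra.
Qed.

Lemma cutoff_supp z : cutoff z != 0 -> z \in tree_ball o nb N.
Proof.
rewrite (tree_ballP Esym Eirr Econn Eacyc o nbP) /cutoff; case: ifP => //.
by rewrite eqxx.
Qed.

Let sphere_sizeD j : (size (sphere o nb j))%:R <= (D + 1) * D ^+ j.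
Proof.
apply: le_trans (_ : (d.+1 * d ^ j.-1)%:R <= _).
  by rewrite ler_nat (sphere_size Esym Eirr Econn Eacyc).
rewrite natrM natrX -natr1 -/D ler_wpM2l ?addr_ge0 ?(ltW D0) //.
by rewrite ler_weXn2l ?leq_pred // (le_trans _ D2) // ler1n.
Qed.

(** About [D ^+ N] sites carry a defect of square at most [D ^- (2 * N)]. *)
Lemma residue_energy B : uniq B ->
  \sum_(z <- B) residue z ^+ 2 <= (d%:R + 1) / d%:R ^+ N.
Proof.
move=> uB.
pose F z : R := if dep z == N then ((D ^+ N)^-1) ^+ 2 else 0.
apply: le_trans (_ : \sum_(z <- B) F z <= _).
  apply: ler_sum => z _; have := residue_bound z; rewrite /F -real_normK ?num_real //.
  case: ifP => _ h; first by rewrite lerXn2r ?nnegrE ?(ltW (Dk_gt0 N)).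
  by rewrite normr_le0 in h; rewrite (eqP h) normr0 expr0n.
apply: le_trans (sum_seq_le_supp (sphere_uniq Esym Eirr Econn Eacyc o nbP nb_uniq N) uB _ _) _.
- by move=> z; rewrite /F; case: ifP => _; rewrite ?sqr_ge0.
- move=> z; rewrite (sphereP Esym Eirr Econn Eacyc o nbP) /F -/dep; case: ifP => //.
  by rewrite eqxx.
rewrite (eq_big_seq (fun=> ((D ^+ N)^-1) ^+ 2)); last first.
  by move=> z; rewrite (sphereP Esym Eirr Econn Eacyc o nbP) /F -/dep => ->.
rewrite big_const_seq count_predT iter_addr_0 -[_ *+ size _]mulr_natl.
apply: le_trans (_ : (D + 1) * D ^+ N * ((D ^+ N)^-1) ^+ 2 <= _).
  by rewrite ler_wpM2r ?sqr_ge0.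
rewrite le_eqVlt; apply/orP; left; apply/eqP.
by rewrite -/D; field; rewrite expf_neq0 // gt_eqF.
Qed.

(** Depth [j] contributes at most [(D + 1) * D ^+ j] sites with squares at most [D ^- (2 * j)], so
    the geometric series bounds the sum uniformly in the truncation radius. *)
Lemma cutoff_energy B : uniq B ->
  \sum_(z <- B) cutoff z ^+ 2 <= 2 * (d%:R + 1).
Proof.
move=> uB.
apply: le_trans (sum_seq_le_supp (tree_ball_uniq Esym Eirr Econn Eacyc o nbP nb_uniq N) uB _ _) _.
- by move=> z; exact: sqr_ge0.
- by move=> z z0; apply: cutoff_supp; apply: contra_neq z0 => ->; rewrite expr0n.
rewrite /tree_ball big_flatten /= big_map.
apply: le_trans (_ : \sum_(j <- iota 0 N) (D + 1) * (D ^+ j)^-1 <= _).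
  apply: ler_sum => j _.
  apply: le_trans (_ : \sum_(z <- sphere o nb j) ((D ^+ j)^-1) ^+ 2 <= _).
    rewrite big_seq [leRHS]big_seq; apply: ler_sum => z.
    rewrite (sphereP Esym Eirr Econn Eacyc o nbP) => /eqP dz.
    have /andP[c0 c1] := cutoff_bound z; rewrite /dep dz in c1.
    by rewrite lerXn2r ?nnegrE // (le_trans c0 c1).
  rewrite big_const_seq count_predT iter_addr_0 -[_ *+ size _]mulr_natl.
  apply: le_trans (_ : (D + 1) * D ^+ j * ((D ^+ j)^-1) ^+ 2 <= _).
    by rewrite ler_wpM2r ?sqr_ge0.
  rewrite le_eqVlt; apply/orP; left; apply/eqP.
  by field; rewrite expf_neq0 // gt_eqF.
rewrite -mulr_sumr mulrC ler_wpM2r ?addr_ge0 ?(ltW D0) //.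
suff : forall n, \sum_(j <- iota 0 n) (D ^+ j)^-1 <= 2 - 2 * (2 ^+ n)^-1 :> R.
  move=> h; apply: le_trans (h N) _.
  by rewrite lerBlDr lerDl mulr_ge0 // invr_ge0 exprn_ge0.
elim=> [|n IH]; first by rewrite big_nil expr0 invr1 mulr1 subrr.
rewrite -addn1 iotaD big_cat big_seq1 add0n addn1 /=.
have h1 : (D ^+ n)^-1 <= (2 ^+ n)^-1.
  by rewrite lef_pV2 ?posrE ?exprn_gt0 // lerXn2r ?nnegrE ?(ltW D0).
have h2 : (2 ^+ n)^-1 = 2 * (2 ^+ n.+1)^-1 :> R.
  by rewrite exprS invfM mulrA divff ?mul1r.
lra.
Qed.

Lemma cutoff_green z : (@depth V E Econn o z < N)%N ->
  `|cutoff z - green o z| <= (d%:R ^+ N)^-1.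
Proof.
move=> dz; rewrite /cutoff dz /green mulrBr addrC addKr normrN normrM.
rewrite (gtr0_norm green_cst_gt0) gtr0_norm ?Dk_gt0 //.
by rewrite ler_piMl ?(ltW (Dk_gt0 N)) // green_cst_le1.
Qed.

End OneSource.

Lemma lap_sum m (c : 'I_m -> R) (h : 'I_m -> V -> R) x :
  lap (fun z => \sum_i c i * h i z) x = \sum_i c i * lap (h i) x.
Proof.
rewrite /lap; under [RHS]eq_bigr do rewrite mulr_sumr.
rewrite exchange_big /=; apply: eq_bigr => y _.
by rewrite -sumrB; apply: eq_bigr => i _; rewrite mulrBr.
Qed.

(* A finitely supported almost-solution of [lap h = - sum_i c_i delta_(x_i)];
   [A] contains the support of [h] and the sources. *)
Definition approx_potential m (x : 'I_m -> V) (c : 'I_m -> R) (K dl : R)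
    (A : seq V) (h : V -> R) : Prop :=
  [/\ uniq A /\ (forall i, x i \in A), (forall z, h z != 0 -> z \in A),
      (forall z, `|h z| <= K) /\ \sum_(z <- nbhd nb A) h z ^+ 2 <= K,
      \sum_(z <- nbhd nb A) (lap h z + \sum_i c i * (z == x i)%:R) ^+ 2 <= dl
    & forall j, `|h (x j) - \sum_i c i * green (x i) (x j)| <= dl].

(** The order of the quantifiers is the point: [K] is fixed before the precision. Enlarging the
    truncation radius improves residue and values at the sources like [D ^- N], while the bounds on
    size and energy do not move. *)
Lemma approx_potential_ex m (x : 'I_m -> V) (c : 'I_m -> R) :
  exists2 K, 0 <= K & forall dl, 0 < dl -> exists A h, approx_potential x c K dl A h.
Proof.
pose S1 := \sum_i `|c i|; pose S2 := m%:R * \sum_i c i ^+ 2 * (2 * (D + 1)).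
have S10 : 0 <= S1 by apply: sumr_ge0.
have D10 : 0 <= D + 1 by rewrite addr_ge0 ?(ltW D0).
have S20 : 0 <= S2.
  apply: mulr_ge0 => //; apply: sumr_ge0 => i _.
  by apply: mulr_ge0; [exact: sqr_ge0|exact: mulr_ge0].
exists (S1 + S2); first by rewrite addr_ge0.
move=> dl dl0.
(* [N0] puts every source inside every truncation ball; [N1] makes [(S1 + S2) / D ^+ N] at most
   [dl], through [n < 2 ^ n]. *)
pose N0 := (\max_i \max_j (@depth V E Econn (x i) (x j))).+1.
pose N1 := Num.bound ((S1 + S2) / dl).
pose N := maxn N0 N1.
have Npos : (0 < N)%N by rewrite leq_max ltn0Sn.
have depN i j : (@depth V E Econn (x i) (x j) < N)%N.
  apply: leq_trans (leq_maxl _ _); rewrite ltnS.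
  by apply: leq_trans (leq_bigmax (F := fun i => \max_j _) i); exact: leq_bigmax.
have DN : (S1 + S2) / D ^+ N <= dl.
  rewrite ler_pdivrMr ?exprn_gt0 // mulrC -ler_pdivrMr //.
  apply: le_trans (ltW (archi_boundP _)) _; first by rewrite divr_ge0 ?addr_ge0 // ltW.
  apply: le_trans (_ : N%:R <= _); first by rewrite ler_nat leq_maxr.
  apply: le_trans (_ : 2 ^+ N <= _); first by rewrite -natrX ler_nat ltnW // ltn_expl.
  by rewrite lerXn2r ?nnegrE ?(ltW D0).
have DN0 : 0 < (D ^+ N)^-1 by rewrite invr_gt0 exprn_gt0.
pose h z := \sum_i c i * cutoff (x i) N z.
pose A := undup (codom x ++ flatten [seq tree_ball (x i) nb N | i <- enum 'I_m]).
have sumsq (B : seq V) (k : 'I_m -> V -> R) M : (forall i, \sum_(z <- B) k i z ^+ 2 <= M) ->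
    \sum_(z <- B) (\sum_i c i * k i z) ^+ 2 <= m%:R * \sum_i c i ^+ 2 * M.
  move=> kM; apply: le_trans (_ : \sum_(z <- B) m%:R * \sum_i c i ^+ 2 * k i z ^+ 2 <= _).
    apply: ler_sum => z _; apply: le_trans (sqr_sum_le _) _.
    by rewrite ler_wpM2l //; under eq_bigr do rewrite exprMn.
  rewrite -mulr_sumr ler_wpM2l // exchange_big /=; apply: ler_sum => i _.
  by rewrite -mulr_sumr ler_wpM2l // sqr_ge0.
exists A, h; split.
- split; first exact: undup_uniq.
  by move=> i; rewrite mem_undup mem_cat codom_f.
- move=> z hz; rewrite mem_undup mem_cat; apply/orP; right.
  have [i ci] : exists i, cutoff (x i) N z != 0.
    apply/existsP; apply: contraNT hz; rewrite negb_exists => /forallP hz.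
    by rewrite /h big1 // => i _; have := hz i; rewrite negbK => /eqP ->; rewrite mulr0.
  apply/flattenP; exists (tree_ball (x i) nb N); last exact: cutoff_supp.
  by apply/mapP; exists i; rewrite ?mem_enum.
- split.
    move=> z; apply: le_trans (_ : S1 <= _); last by rewrite lerDl.
    apply: le_trans (ler_norm_sum _ _ _) _; apply: ler_sum => i _.
    have /andP[c0 c1] := cutoff_bound (x i) N z.
    rewrite normrM ler_piMr // ger0_norm // (le_trans c1) // invf_le1 ?exprn_gt0 //.
    by rewrite exprn_ege1 //; have := D2; rewrite /D; lra.
  apply: le_trans (_ : S2 <= _); last by rewrite lerDr.
  by apply: sumsq => i; apply: cutoff_energy; exact: nbhd_uniq.
- have e z : lap h z + \sum_i c i * (z == x i)%:R = \sum_i c i * residue (x i) N z.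
    by rewrite lap_sum -big_split /=; apply: eq_bigr => i _; rewrite mulrDr.
  under eq_bigr do rewrite e.
  apply: le_trans (sumsq _ _ _ (fun i => residue_energy (x i) Npos (nbhd_uniq _ _))) _.
  apply: le_trans DN; rewrite -/D.
  apply: le_trans (_ : S2 / D ^+ N <= _); last by rewrite ler_wpM2r ?(ltW DN0) // lerDr.
  rewrite /S2 -mulrA ler_wpM2l // mulr_suml; apply: ler_sum => i _.
  have q0 : 0 <= (D + 1) / D ^+ N by rewrite mulr_ge0 // ltW.
  rewrite -[leRHS]mulrA; apply: ler_wpM2l; first exact: sqr_ge0.
  by rewrite -[leRHS]mulrA; lra.
- move=> j; apply: le_trans DN.
  apply: le_trans (_ : S1 / D ^+ N <= _); last by rewrite ler_wpM2r ?(ltW DN0) // lerDl.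
  rewrite /h -sumrB mulr_suml; apply: le_trans (ler_norm_sum _ _ _) _.
  apply: ler_sum => i _; rewrite -mulrBr normrM ler_wpM2l //.
  by apply: cutoff_green; exact: depN.
Qed.

End Potential.

(** * The random walk *)

Section EsumScale.
Context (R : realType) (T : choiceType).
Implicit Types a : T -> \bar R.
Local Open Scope ereal_scope.

Let esum_scale_le (c : R) a : (0 <= c)%R -> (forall i, 0 <= a i) ->
  \esum_(i in [set: T]) (c%:E * a i) <= c%:E * \esum_(i in [set: T]) a i.
Proof.
move=> c0 a0; apply: ge_ereal_sup => _ [X [finX XI]] <-.
rewrite -ge0_mule_fsumr //; apply: lee_wpmul2l; first by rewrite lee_fin.
by apply: esum_ge; exists X.
Qed.

Lemma esum_scale (c : R) a : (0 <= c)%R -> (forall i, 0 <= a i) ->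
  \esum_(i in [set: T]) (c%:E * a i) = c%:E * \esum_(i in [set: T]) a i.
Proof.
rewrite le_eqVlt => /orP[/eqP <-|c0] a0.
  by rewrite mul0e esum1 // => i _; rewrite mul0e.
apply/eqP; rewrite eq_le esum_scale_le ?(ltW c0) //=.
rewrite -[leRHS]mul1e -(@divff _ c) ?gt_eqF // EFinM -muleA.
apply: lee_wpmul2l; first by rewrite lee_fin ltW.
apply: le_trans (esum_scale_le _ _) => [|//|i]; last 2 first.
- by rewrite invr_ge0 ltW.
- by rewrite mule_ge0 // lee_fin ltW.
by apply: le_esum => i _; rewrite muleA -EFinM mulVf ?gt_eqF // mul1e.
Qed.

Lemma esum_ge_seq a (s : seq T) : (forall i, 0 <= a i) -> uniq s ->
  \sum_(i <- s) a i <= \esum_(i in [set: T]) a i.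
Proof.
move=> a0 us; apply: esum_ge; exists [set` s]; first by split.
by rewrite fsbig_seq.
Qed.

End EsumScale.

Section Walk.
Context (R : realType) (V : choiceType) (E : rel V) (d : nat).
Hypothesis Eirr : irreflexive E.
Variable nb : V -> seq V.
Hypotheses (nbP : forall x y, (y \in nb x) = E x y)
  (nb_uniq : forall x, uniq (nb x)) (nb_size : forall x, size (nb x) = d.+1).
Variable q : R -> V -> V -> R.
Hypothesis hq : walk_transition E q.
Implicit Types (g : V -> R) (x y z : V).

Let q0 t x z : 0 <= t -> 0 <= q t x z := @walk_ge0 _ _ _ _ hq t x z.

(** The semigroup of the walk. It is used only on bounded nonnegative functions, where the sum is
    finite; the value at [M - g] takes care of the opposite sign. *)
Definition average t g x : R := fine (\esum_(z in [set: V]) (q t x z * g z)%:E).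

Definition bounded_by M g := forall z, 0 <= g z <= M.

Let averageE t g x M : 0 <= t -> bounded_by M g ->
  (average t g x)%:E = (\esum_(z in [set: V]) (q t x z * g z)%:E)%E.
Proof.
move=> t0 gM; rewrite /average fineK // ge0_fin_numE; last first.
  by apply: esum_ge0 => z _; rewrite lee_fin mulr_ge0 ?q0 //; case/andP: (gM z).
have M0 : 0 <= M by have /andP[/le_trans] := gM x; exact.
apply: le_lt_trans (_ : \esum_(z in [set: V]) (M%:E * (q t x z)%:E) < _)%E.
  apply: le_esum => z _; rewrite -EFinM lee_fin mulrC ler_wpM2r ?q0 //.
  by case/andP: (gM z).
rewrite esum_scale // => [|z]; last by rewrite lee_fin q0.
by rewrite (walk_mass hq) // mule1 ltry.
Qed.

Let average_ge0 t g x M : 0 <= t -> bounded_by M g -> 0 <= average t g x.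
Proof.
move=> t0 gM; apply: fine_ge0; apply: esum_ge0 => z _.
by rewrite lee_fin mulr_ge0 ?q0 //; case/andP: (gM z).
Qed.

Local Opaque average.

Let average_le t g g' x M M' : 0 <= t -> bounded_by M g -> bounded_by M' g' ->
  (forall z, g z <= g' z) -> average t g x <= average t g' x.
Proof.
move=> t0 gM gM' gg; rewrite -lee_fin (averageE _ t0 gM) (averageE _ t0 gM').
by apply: le_esum => z _; rewrite lee_fin ler_wpM2l ?q0.
Qed.

Let averageD t g g' x M M' : 0 <= t -> bounded_by M g -> bounded_by M' g' ->
  average t (fun z => g z + g' z) x = average t g x + average t g' x.
Proof.
move=> t0 gM gM'.
have gM2 : bounded_by (M + M') (fun z => g z + g' z).
  by move=> z; have /andP[? ?] := gM z; have /andP[? ?] := gM' z; rewrite addr_ge0 ?lerD.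
have pos1 z : (0 <= (q t x z * g z)%:E)%E.
  by rewrite lee_fin mulr_ge0 ?q0 //; case/andP: (gM z).
have pos2 z : (0 <= (q t x z * g' z)%:E)%E.
  by rewrite lee_fin mulr_ge0 ?q0 //; case/andP: (gM' z).
apply: EFin_inj; apply: etrans (averageE _ t0 gM2) _; rewrite EFinD.
rewrite (eq_esum (b := fun z => (q t x z * g z)%:E + (q t x z * g' z)%:E)%E); last first.
  by move=> z _; rewrite mulrDr EFinD.
by rewrite esumD //; congr (_ + _)%E; apply: esym; apply: averageE.
Qed.

Let average_scale t c g x M : 0 <= t -> 0 <= c -> bounded_by M g ->
  average t (fun z => c * g z) x = c * average t g x.
Proof.
move=> t0 c0 gM.
have gM2 : bounded_by (c * M) (fun z => c * g z).
  by move=> z; have /andP[? ?] := gM z; rewrite mulr_ge0 //= ler_wpM2l.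
have pos z : (0 <= (q t x z * g z)%:E)%E.
  by rewrite lee_fin mulr_ge0 ?q0 //; case/andP: (gM z).
apply: EFin_inj; apply: etrans (averageE _ t0 gM2) _; rewrite EFinM.
rewrite (eq_esum (b := fun z => c%:E * (q t x z * g z)%:E)%E); last first.
  by move=> z _; rewrite -EFinM mulrCA.
by rewrite esum_scale //; congr (_ * _)%E; apply: esym; apply: averageE.
Qed.

Let average_cst t c x : 0 <= t -> 0 <= c -> average t (fun=> c) x = c.
Proof.
move=> t0 c0; have bc : bounded_by c (fun=> c) by move=> z; rewrite c0 lexx.
apply: EFin_inj; rewrite (averageE _ t0 bc).
rewrite (eq_esum (b := fun z => c%:E * (q t x z)%:E)%E); last first.
  by move=> z _; rewrite -EFinM mulrC.
by rewrite esum_scale // ?(walk_mass hq) ?mule1 // => z; rewrite lee_fin q0.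
Qed.

Let average_bounded t g M : 0 <= t -> bounded_by M g -> bounded_by M (average t g).
Proof.
move=> t0 gM x; rewrite (average_ge0 _ t0 gM) /=.
have M0 : 0 <= M by have /andP[/le_trans] := gM x; exact.
have bM : bounded_by M (fun=> M) by move=> z; rewrite M0 lexx.
rewrite -[leRHS](average_cst x t0 M0); apply: (average_le _ t0 gM bM) => z.
by case/andP: (gM z).
Qed.

Let average_add s t g x M : 0 <= s -> 0 <= t -> bounded_by M g ->
  average (s + t) g x = average s (average t g) x.
Proof.
move=> s0 t0 gM; apply: EFin_inj; have st0 := addr_ge0 s0 t0.
have g0 z : 0 <= g z by case/andP: (gM z).
rewrite (averageE _ st0 gM) (averageE _ s0 (average_bounded t0 gM)).
transitivity (\esum_(z in [set: V]) \esum_(y in [set: V]) (q s x y * q t y z * g z)%:E)%E.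
  apply: eq_esum => z _; rewrite mulrC EFinM (walk_add hq) // -esum_scale //.
    by apply: eq_esum => y _; rewrite -EFinM mulrC.
  by move=> y; rewrite lee_fin mulr_ge0 ?q0.
transitivity (\esum_(y in [set: V]) \esum_(z in [set: V]) (q s x y * q t y z * g z)%:E)%E.
  have pos y z : (0 <= (q s x y * q t y z * g z)%:E)%E by rewrite lee_fin !mulr_ge0 ?q0.
  rewrite (@esum_esum R V V setT (fun=> setT) (fun z y => (q s x y * q t y z * g z)%:E)) //.
  rewrite (@esum_esum R V V setT (fun=> setT) (fun y z => (q s x y * q t y z * g z)%:E)) //.
  rewrite (@reindex_esum R _ _ ([set: V] `*`` fun=> [set: V]) ([set: V] `*`` fun=> [set: V])
    (fun k => (k.2, k.1))) //.
  by split => // [[a b] [a' b'] _ _ [-> ->] //|[a b] _]; exists (b, a).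
apply: eq_esum => y _; rewrite EFinM (averageE _ t0 gM) -esum_scale ?q0 // => [|z].
  by apply: eq_esum => z _; rewrite -EFinM mulrA.
by rewrite lee_fin mulr_ge0 ?q0.
Qed.

Let delta y z : R := (z == y)%:R.

Let delta_bounded y : bounded_by 1 (delta y).
Proof. by move=> z; rewrite /delta ler0n lern1 leq_b1. Qed.

Lemma average_delta t x y : 0 <= t -> average t (delta y) x = q t x y.
Proof.
move=> t0; apply: EFin_inj; rewrite (averageE _ t0 (@delta_bounded y)).
rewrite -(@esum_set1 R V y (fun z => (q t x z)%:E)) ?lee_fin ?q0 // [RHS]esum_mkcond.
apply: eq_esum => z _; rewrite /delta; have [->|zy] := eqVneq z y.
  by rewrite mulr1 mem_set.
by rewrite mulr0 memNset //= => e; rewrite e eqxx in zy.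
Qed.

Let q_le1 t x y : 0 <= t -> q t x y <= 1.
Proof.
by move=> t0; rewrite -average_delta //; have /andP[] := average_bounded t0 (@delta_bounded y) x.
Qed.

Let average_ge_seq t g x s M : 0 <= t -> bounded_by M g -> uniq s ->
  \sum_(z <- s) q t x z * g z <= average t g x.
Proof.
move=> t0 gM us; rewrite -lee_fin (averageE _ t0 gM) -sumEFin; apply: esum_ge_seq => // z.
by rewrite lee_fin mulr_ge0 ?q0 //; case/andP: (gM z).
Qed.

Let D : R := d.+1%:R.

Let q_add_ge s t x z u : 0 <= s -> 0 <= t -> uniq u ->
  \sum_(y <- u) q s x y * q t y z <= q (s + t) x z.
Proof.
move=> s0 t0 uu; rewrite -[leRHS]average_delta ?addr_ge0 //.
rewrite (average_add _ s0 t0 (@delta_bounded z)).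
under eq_bigr do rewrite -(average_delta _ _ t0).
exact: average_ge_seq (average_bounded t0 (@delta_bounded z)) _.
Qed.

Let sum_delta t x y : 0 <= t -> \sum_(z \in [set: V]) (q t x z * delta y z) = q t x y.
Proof.
move=> t0; rewrite (@fsbigE _ _ _ _ [set: V] [:: y]) //.
  by rewrite big_mkcond big_seq1 in_setT /delta eqxx mulr1.
by move=> z _; rewrite inE /delta => /negbTE ->; rewrite mulr0.
Qed.

Let generator_delta x y : walk_generator E (delta y) x = lap nb (delta y) x.
Proof.
rewrite /walk_generator /lap [RHS]fsbig_seq //; apply: eq_fsbigl.
by apply/seteqP; split => z /=; rewrite nbP.
Qed.

(** Only a lower bound is extracted, with a [dl] depending on the vertices; matching upper bounds
    will come from conservation of mass. *)
Let q_rate x y e : 0 < e -> exists2 dl, 0 < dl & forall h, 0 < h < dl ->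
  (delta y x + h * (lap nb (delta y) x - e)) <= q h x y.
Proof.
move=> e0; have fin : finite_set [set z | delta y z != 0].
  apply: (sub_finite_set (B := [set y])) => // z /=; rewrite /delta.
  by case: (eqVneq z y) => //=; rewrite eqxx.
have /cvgrPdist_le/(_ e e0) := @walk_derivative _ _ _ _ hq (delta y) x fin.
rewrite /at_right /within /= => /nbhs_ballP[dl /= dl0 hdl]; exists dl => // h /andP[h0 hd].
have bh : ball (0 : R) dl h by rewrite /ball /= sub0r normrN gtr0_norm.
have := hdl h bh h0; rewrite /=.
rewrite sum_delta ?(ltW h0) // generator_delta ler_norml => /andP[_].
set G := lap _ _ _; rewrite lerBlDr -lerBlDl ler_pdivlMl // => H; lra.
Qed.

Let lap_self x : lap nb (delta x) x = - D.
Proof.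
rewrite /lap /delta eqxx (eq_big_seq (fun=> -1)).
  by rewrite big_const_seq iter_addr_0 count_predT nb_size mulNrn.
move=> z; rewrite nbP; have [->|_] := eqVneq z x; first by rewrite Eirr.
by rewrite sub0r.
Qed.

Let lap_nb x y : E x y -> lap nb (delta y) x = 1.
Proof.
move=> Exy; rewrite /lap /delta.
have -> : x == y = false by apply/eqP => e; rewrite e Eirr in Exy.
rewrite (bigD1_seq y) ?nbP //= eqxx subr0 big1 ?addr0 //.
by move=> z /negbTE ->; rewrite subr0.
Qed.

Let small_step s (dl : R) : 0 < s -> 0 < dl -> exists n, 0 < s / n.+1%:R < dl.
Proof.
move=> s0 dl0; exists (Num.bound (s / dl)).
rewrite divr_gt0 //= ltr_pdivrMr // mulrC -ltr_pdivrMr //.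
apply: lt_trans (archi_boundP _) _; first by rewrite divr_ge0 // ltW.
by rewrite ltr_nat.
Qed.

(* Subdividing [0, s] makes the pointwise rates uniform in the vertex. *)
Let q_self s x : 0 <= s -> D * s <= 1 -> 1 - D * s <= q s x x.
Proof.
rewrite le_eqVlt => /orP[/eqP <- _|s0 Ds].
  by rewrite mulr0 subr0 (walk_zero hq) eqxx.
apply/ler_addgt0Pr => e e0; have es : 0 < e / s by rewrite divr_gt0.
have [dl dl0 hdl] := q_rate x x es; have [n /andP[h0 hd]] := small_step s0 dl0.
set h := s / n.+1%:R in h0 hd.
have sn : s = n.+1%:R * h by rewrite mulrCA divff ?mulr1 // gt_eqF.
have := hdl h; rewrite h0 hd lap_self {1}/delta eqxx mulr1n => /(_ isT) hh.
(* Standing at [x] after each of [j] short steps. As soon as one of the factors would be negative,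
   nonnegativity of [q] is enough. *)
have key j : 1 - j%:R * (h * (D + e / s)) <= q (j%:R * h) x x.
  elim: j => [|j IH]; first by rewrite !mul0r subr0 (walk_zero hq) eqxx.
  have jh : 0 <= j%:R * h by rewrite mulr_ge0 // ltW.
  have -> : j.+1%:R * h = h + j%:R * h by rewrite -natr1 mulrDl mul1r addrC.
  have [neg|pos] := ltP (1 - j%:R * (h * (D + e / s))) 0.
    apply: le_trans (q0 _ _ _); last by rewrite addr_ge0 // ltW.
    rewrite -natr1 mulrDl mul1r; have : 0 <= h * (D + e / s); last by lra.
    by rewrite mulr_ge0 ?addr_ge0 // ltW.
  have hpos : 0 <= h * (D + e / s) by rewrite mulr_ge0 ?addr_ge0 // ltW.
  have [neg|pos'] := ltP (1 - h * (D + e / s)) 0.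
    apply: le_trans (q0 _ _ _); last by rewrite addr_ge0 // ltW.
    have : h * (D + e / s) <= j.+1%:R * (h * (D + e / s)) by rewrite ler_peMl // ler1n.
    lra.
  have := @q_add_ge h (j%:R * h) x x [:: x] (ltW h0) jh isT.
  rewrite big_cons big_nil addr0; apply: le_trans.
  apply: le_trans (ler_pM pos' pos _ IH); last by lra.
  rewrite -natr1; set a := h * (D + e / s) in hpos *.
  have : 0 <= a * (j%:R * a) by apply: mulr_ge0 => //; exact: mulr_ge0.
  lra.
have := key n.+1; rewrite -sn => H; rewrite -lerBlDr; apply: le_trans H.
have -> : n.+1%:R * (h * (D + e / s)) = n.+1%:R * h * (D + e / s) by ring.
rewrite -sn mulrDr (mulrC s (e / s)) divfK ?gt_eqF //; lra.
Qed.

(** Cut [s] into short steps and keep only the trajectories that wait at [x], cross the edge in one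
    step and then wait at [y]; the waiting costs at most the factor [1 - D * s]. *)
Let q_nb s x y : E x y -> 0 <= s -> D * s <= 1 -> s * (1 - D * s) <= q s x y.
Proof.
move=> Exy; rewrite le_eqVlt => /orP[/eqP <- _|s0 Ds].
  by rewrite mul0r q0.
have xy : x != y by apply/eqP => e; rewrite e Eirr in Exy.
apply/ler_addgt0Pr => e e0; have es : 0 < e / s by rewrite divr_gt0.
have [dl dl0 hdl] := q_rate x y es; have [n /andP[h0 hd]] := small_step s0 dl0.
set h := s / n.+1%:R in h0 hd.
have sn : s = n.+1%:R * h by rewrite mulrCA divff ?mulr1 // gt_eqF.
have D0 : 0 <= D by [].
have := hdl h; rewrite h0 hd (lap_nb Exy) {1}/delta (negbTE xy) mulr0n => /(_ isT) hh.
have Dj j : (j <= n.+1)%N -> 0 <= 1 - D * (j%:R * h).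
  move=> jn; rewrite subr_ge0; apply: le_trans Ds; rewrite ler_wpM2l // [leRHS]sn.
  by rewrite ler_pM2r // ler_nat.
(* Conditioning on the first step: either the crossing is still to come, or it has just happened and
   the walk waits at [y]. *)
have key j : (j <= n.+1)%N ->
    j%:R * q h x y * (1 - D * (j%:R * h)) <= q (j%:R * h) x y.
  elim: j => [|j IH] jn; first by rewrite !mul0r q0.
  have jn' := ltnW jn; have {}IH := IH jn'.
  have jh : 0 <= j%:R * h by rewrite mulr_ge0 // ltW.
  have jh1 : D * (j%:R * h) <= 1 by have := Dj _ jn'; rewrite subr_ge0.
  have h1 : D * h <= 1.
    by have := Dj 1%N isT; rewrite mul1r subr_ge0.
  have -> : j.+1%:R * h = h + j%:R * h by rewrite -natr1 mulrDl mul1r addrC.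
  have := @q_add_ge h (j%:R * h) x y [:: x; y] (ltW h0) jh.
  rewrite !big_cons big_nil addr0 cons_uniq mem_seq1 xy => /(_ isT); apply: le_trans.
  have a1 : (1 - D * h) * (j%:R * q h x y * (1 - D * (j%:R * h))) <= q h x x * q (j%:R * h) x y.
    apply: ler_pM => //; rewrite ?subr_ge0 //.
      by rewrite !mulr_ge0 ?Dj ?q0 // ltW.
    exact: q_self (ltW h0) h1.
  have a2 : q h x y * (1 - D * (j%:R * h)) <= q h x y * q (j%:R * h) y y.
    by rewrite ler_wpM2l ?q0 ?(ltW h0) //; exact: q_self.
  apply: le_trans (lerD a1 a2); rewrite -natr1 -subr_ge0.
  have a0 : 0 <= D * h by rewrite mulr_ge0 // ltW.
  have -> : (1 - D * h) * (j%:R * q h x y * (1 - D * (j%:R * h))) +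
      q h x y * (1 - D * (j%:R * h)) -
      (j%:R + 1) * q h x y * (1 - D * (h + j%:R * h)) =
    q h x y * (j%:R * (D * h * (D * (j%:R * h))) + D * h) by ring.
  apply: mulr_ge0; first exact: q0 (ltW h0).
  by apply: addr_ge0 => //; apply: mulr_ge0 => //; apply: mulr_ge0 => //; exact: mulr_ge0.
have := key n.+1 (leqnn _); rewrite -sn => H; rewrite -lerBlDr; apply: le_trans H.
have : n.+1%:R * (h * (1 - e / s)) <= n.+1%:R * q h x y by rewrite ler_pM2l //; lra.
rewrite mulrA -sn => H.
have H2 : s * (1 - e / s) * (1 - D * s) <= n.+1%:R * q h x y * (1 - D * s).
  by rewrite ler_wpM2r // subr_ge0.
apply: le_trans H2.
have -> : s * (1 - e / s) = s - e by field; rewrite gt_eqF.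
have : 0 <= e * (D * s) by rewrite !mulr_ge0 // ltW.
lra.
Qed.

Let D0 : 0 <= D. Proof. by []. Qed.

Let lapE g x : lap nb g x = \sum_(y <- nb x) g y - D * g x.
Proof.
rewrite /lap sumrB; congr (_ - _).
by rewrite big_const_seq iter_addr_0 count_predT nb_size mulr_natl.
Qed.

Let average_lower s g x M : 0 <= s -> D * s <= 1 -> bounded_by M g ->
  g x + s * lap nb g x - D ^+ 2 * M * s ^+ 2 <= average s g x.
Proof.
move=> s0 Ds gM; have g0 z : 0 <= g z by case/andP: (gM z).
have us : uniq (x :: nb x) by rewrite /= nb_uniq nbP Eirr.
apply: le_trans (average_ge_seq x s0 gM us); rewrite big_cons.
have e1 : (1 - D * s) * g x <= q s x x * g x by rewrite ler_wpM2r // q_self.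
have e2 : s * (1 - D * s) * \sum_(y <- nb x) g y <= \sum_(y <- nb x) q s x y * g y.
  rewrite mulr_sumr big_seq [leRHS]big_seq; apply: ler_sum => y; rewrite nbP => Exy.
  by rewrite ler_wpM2r // q_nb.
apply: le_trans (lerD e1 e2); rewrite lapE.
have e3 : \sum_(y <- nb x) g y <= D * M.
  apply: le_trans (_ : \sum_(y <- nb x) M <= _).
    by apply: ler_sum => y _; case/andP: (gM y).
  by rewrite big_const_seq iter_addr_0 count_predT nb_size mulr_natl.
have : D * s ^+ 2 * \sum_(y <- nb x) g y <= D * s ^+ 2 * (D * M).
  by rewrite ler_wpM2l // mulr_ge0 ?sqr_ge0.
set S := \sum_(y <- _) _ => k; rewrite -subr_ge0.
have -> : (1 - D * s) * g x + s * (1 - D * s) * S -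
    (g x + s * (S - D * g x) - D ^+ 2 * M * s ^+ 2) = D * s ^+ 2 * (D * M) - D * s ^+ 2 * S.
  by ring.
by rewrite subr_ge0.
Qed.

(** The upper bound is the lower one applied to [M - g]: total mass 1 turns its average into [M]
    minus the average of [g]. *)
Let average_taylor s g x M : 0 <= s -> D * s <= 1 -> bounded_by M g ->
  `|average s g x - (g x + s * lap nb g x)| <= D ^+ 2 * M * s ^+ 2.
Proof.
move=> s0 Ds gM; have lo := average_lower x s0 Ds gM.
have gM' : bounded_by M (fun z => M - g z).
  by move=> z; have /andP[? ?] := gM z; rewrite subr_ge0 lerBlDl lerDr; apply/andP.
have M0 : 0 <= M by have /andP[/le_trans] := gM x; exact.
have up := average_lower x s0 Ds gM'.
have avM : average s (fun z => M - g z) x = M - average s g x.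
  apply/eqP; rewrite eq_sym subr_eq -(averageD x s0 gM' gM).
  by under [X in average _ X]eq_fun do rewrite subrK; rewrite average_cst.
have lapM : lap nb (fun z => M - g z) x = - lap nb g x.
  by rewrite /lap -sumrN; apply: eq_bigr => y _; ring.
by rewrite avM lapM in up; rewrite ler_norml; apply/andP; split; lra.
Qed.

Let average_close s g g' c x M M' : 0 <= s -> 0 <= c -> bounded_by M g -> bounded_by M' g' ->
  (forall z, g z <= g' z + c) -> average s g x <= average s g' x + c.
Proof.
move=> s0 c0 gM gM' gg.
have cb : bounded_by c (fun=> c) by move=> z; rewrite c0 lexx.
have gb : bounded_by (M' + c) (fun z => g' z + c).
  by move=> z; have /andP[? ?] := gM' z; rewrite addr_ge0 // lerD2r.
by rewrite -(average_cst x s0 c0) -(averageD x s0 gM' cb); exact: average_le gM gb gg.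
Qed.

Let q_lipschitz s h x y : 0 <= s -> 0 <= h -> D * h <= 1 ->
  `|q (s + h) x y - q s x y| <= 2 * D * h.
Proof.
move=> s0 h0 Dh; rewrite -(average_delta _ _ (addr_ge0 s0 h0)) -(average_delta _ _ s0).
have db := @delta_bounded y; rewrite (average_add _ s0 h0 db).
have Dh0 : 0 <= D * h by rewrite mulr_ge0.
have c0 : 0 <= 2 * D * h by rewrite -mulrA mulr_ge0.
have close z : `|average h (delta y) z - delta y z| <= 2 * D * h.
  have := average_taylor z h0 Dh db; rewrite mulr1 -exprMn => tay.
  have sq : (D * h) ^+ 2 <= D * h by rewrite expr2 ler_piMl.
  have lapb : `|h * lap nb (delta y) z| <= D * h.
    rewrite normrM ger0_norm // mulrC ler_wpM2r //; apply: le_trans (ler_norm_sum _ _ _) _.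
    apply: le_trans (_ : \sum_(u <- nb z) 1 <= _).
      apply: ler_sum => u _; rewrite /delta; case: (u == y); case: (z == y);
        by rewrite ?subrr ?subr0 ?sub0r ?normrN ?normr0 ?normr1.
    by rewrite big_const_seq iter_addr_0 count_predT nb_size.
  move: tay lapb; rewrite !ler_norml => /andP[? ?] /andP[? ?].
  by apply/andP; split; lra.
have up : average s (average h (delta y)) x <= average s (delta y) x + 2 * D * h.
  apply: (average_close x s0 c0 (average_bounded h0 db) db) => z.
  by have := close z; rewrite ler_norml => /andP[_]; lra.
have lo : average s (delta y) x <= average s (average h (delta y)) x + 2 * D * h.
  apply: (average_close x s0 c0 db (average_bounded h0 db)) => z.
  by have := close z; rewrite ler_norml => /andP[+ _]; lra.
by rewrite ler_norml; apply/andP; split; lra.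
Qed.

(** * Time integral of the transition function as a fundamental solution *)

Section FundamentalSolution.
Variables (y : V) (g : V -> R) (M : R).
Hypothesis gM : bounded_by M g.
Hypothesis lap_g : forall z, lap nb g z = - (z == y)%:R.

Let M0 : 0 <= M. Proof. by have /andP[/le_trans h /h] := gM y. Qed.

(** Over a short time [h] the function [g] loses [h] times the point mass at [y], up to a uniform
    second-order error; averaging over the earlier time [s] keeps the error and turns the point mass
    into [q s x y]. *)
Let forward s h x : 0 <= s -> 0 <= h -> D * h <= 1 ->
  `|average (s + h) g x - average s g x + h * q s x y| <= D ^+ 2 * M * h ^+ 2.
Proof.
move=> s0 h0 Dh; set c := D ^+ 2 * M * h ^+ 2.
have c0 : 0 <= c by rewrite /c; apply: mulr_ge0; rewrite ?sqr_ge0 // mulr_ge0 ?sqr_ge0.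
have db := @delta_bounded y.
have hb : bounded_by h (fun z => h * delta y z).
  by move=> z; have /andP[? ?] := db z; rewrite mulr_ge0 //= ler_piMr.
have ab := average_bounded h0 gM.
have sb : bounded_by (M + h) (fun z => average h g z + h * delta y z).
  by move=> z; have /andP[? ?] := ab z; have /andP[? ?] := hb z; rewrite addr_ge0 ?lerD.
have close z : `|average h g z + h * delta y z - g z| <= c.
  apply: le_trans (average_taylor z h0 Dh gM); rewrite le_eqVlt; apply/orP; left; apply/eqP.
  by congr (`|_|); rewrite lap_g /delta; ring.
have e : average s (fun z => average h g z + h * delta y z) x =
    average (s + h) g x + h * q s x y.
  by rewrite (averageD x s0 ab hb) (average_scale x s0 h0 db) average_delta //
    (average_add x s0 h0 gM).
have up := average_close x s0 c0 sb gM; have lo := average_close x s0 c0 gM sb.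
rewrite e in up lo; rewrite ler_norml; apply/andP; split.
  suff : average s g x <= average (s + h) g x + h * q s x y + c by lra.
  by apply: lo => z; have := close z; rewrite ler_norml => /andP[+ _]; lra.
suff : average (s + h) g x + h * q s x y <= average s g x + c by lra.
by apply: up => z; have := close z; rewrite ler_norml => /andP[_]; lra.
Qed.

Variables (psi : V -> R) (ga : R).
Hypotheses (psib : bounded_by 1 psi) (g_psi : forall z, g z <= psi z) (ga0 : 0 < ga).
Hypothesis lap_psi : forall z, lap nb psi z <= - ga * psi z.

(** Each step multiplies [psi] by at most [1 - ga * h] and adds [D ^+ 2 * h ^+ 2]; the added errors
    sum to a geometric series. *)
Let decay h n x : 0 < h -> D * h <= 1 -> ga * h <= 1 ->
  average (n%:R * h) psi x <= (1 - ga * h) ^+ n + D ^+ 2 * h / ga.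
Proof.
move=> h0 Dh gh; have h0' := ltW h0; have gh0 : 0 <= 1 - ga * h by rewrite subr_ge0.
have K0 : 0 <= D ^+ 2 * h / ga by rewrite divr_ge0 ?(ltW ga0) // mulr_ge0 ?sqr_ge0.
elim: n x => [|n IH] x.
  rewrite mul0r expr0; have /andP[_ h1] := average_bounded (lexx 0) psib x.
  by apply: le_trans h1 _; rewrite lerDl.
have nh : 0 <= n%:R * h by rewrite mulr_ge0.
have -> : n.+1%:R * h = n%:R * h + h by rewrite -natr1 mulrDl mul1r.
rewrite (average_add x nh h0' psib).
have sb : bounded_by (1 - ga * h) (fun z => (1 - ga * h) * psi z).
  by move=> z; have /andP[? ?] := psib z; rewrite mulr_ge0 //= ler_piMr.
have c0 : 0 <= D ^+ 2 * h ^+ 2 by rewrite mulr_ge0 ?sqr_ge0.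
apply: le_trans (average_close x nh c0 (average_bounded h0' psib) sb _) _.
  move=> z; have := average_taylor z h0' Dh psib; rewrite mulr1 ler_norml => /andP[_ t].
  have : h * lap nb psi z <= h * (- ga * psi z) by rewrite ler_pM2l.
  lra.
rewrite (average_scale x nh gh0 psib).
have := ler_wpM2l gh0 (IH x); rewrite mulrDr -exprS.
have -> : (1 - ga * h) * (D ^+ 2 * h / ga) = D ^+ 2 * h / ga - D ^+ 2 * h ^+ 2.
  by field; rewrite gt_eqF.
lra.
Qed.

Let gb1 : bounded_by 1 g.
Proof.
by move=> z; have /andP[-> _] := gM z; have /andP[_ /(le_trans (g_psi z))] := psib z.
Qed.

Let vanish x e : 0 < e -> exists T, forall s, T <= s -> average s g x <= e.
Proof.
(* The first entry keeps [D * h] and [ga * h] below 1, the second keeps the accumulated error of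
   [decay] below [e / 2]. *)
move=> e0; pose h := Num.min (D + ga)^-1 (e * ga / (2 * D ^+ 2)).
have Dg : 0 < D + ga by rewrite ltr_wpDl.
have Dp : 0 < D by rewrite ltr0n.
have h0 : 0 < h by rewrite lt_min invr_gt0 Dg divr_gt0 // mulr_gt0 // exprn_gt0.
have hD : (D + ga) * h <= 1.
  by rewrite -ler_pdivlMl // mulr1 ge_min lexx.
have D1 : D * h <= 1 by apply: le_trans hD; rewrite ler_pM2r // lerDl ltW.
have g1 : ga * h <= 1 by apply: le_trans hD; rewrite ler_pM2r // lerDr.
have he : D ^+ 2 * h / ga <= e / 2.
  have : h <= e * ga / (2 * D ^+ 2) by rewrite ge_min lexx orbT.
  rewrite ler_pdivlMr ?mulr_gt0 ?exprn_gt0 // ler_pdivrMr // => k; lra.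
clearbody h; have gh0 : 0 < ga * h by rewrite mulr_gt0.
have [n hn] : exists n, (1 - ga * h) ^+ n <= e / 2.
  exists (Num.bound ((e / 2)^-1 / (ga * h))); set n := Num.bound _.
  have nb1 : (e / 2)^-1 <= n%:R * (ga * h).
    rewrite -ler_pdivrMr //; apply: ltW; apply: archi_boundP.
    by rewrite divr_ge0 ?invr_ge0 ?divr_ge0 ?ltW.
  apply: le_trans (_ : expR (- (n%:R * (ga * h))) <= _).
    rewrite -[- (n%:R * _)]mulrN expRM_natl lerXn2r ?nnegrE ?expR_ge0 ?subr_ge0 //.
    exact: expR_ge1Dx.
  rewrite expRN -[leRHS]invrK lef_pV2 ?posrE ?expR_gt0 ?invr_gt0 ?divr_gt0 //.
  by apply: le_trans nb1 _; apply: le_trans (expR_ge1Dx _); rewrite lerDr.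
exists (n%:R * h) => s Ts; have T0 : 0 <= n%:R * h by rewrite mulr_ge0 // ltW.
have sT : 0 <= s - n%:R * h by rewrite subr_ge0.
have -> : s = (s - n%:R * h) + n%:R * h by rewrite subrK.
have eb : bounded_by e (average (n%:R * h) g).
  move=> z; have /andP[-> _] := average_bounded T0 gb1 z.
  apply: le_trans (average_le z T0 gb1 psib g_psi) _.
  by apply: le_trans (decay n z h0 D1 g1) _; lra.
by rewrite (average_add x sT T0 gb1); have /andP[] := average_bounded sT eb x.
Qed.

Let G x s : R := - average s g x.

(** For negative [h] the forward estimate is used from the earlier time [h + s], and the Lipschitz
    bound moves [q] back to time [s]. *)
Let G_taylor x s h : 0 < s -> `|h| <= s -> D * `|h| <= 1 ->
  `|G x (h + s) - G x s - h * q s x y| <= (D ^+ 2 * M + 2 * D) * h ^+ 2.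
Proof.
move=> s0 hs Dh; have [hp|hn] := leP 0 h.
  rewrite ger0_norm // in hs Dh.
  have := forward x (ltW s0) hp Dh; rewrite /G (addrC h s) => H.
  apply: le_trans (_ : D ^+ 2 * M * h ^+ 2 <= _); last first.
    by rewrite ler_wpM2r ?sqr_ge0 // lerDl mulr_ge0.
  rewrite -normrN; apply: le_trans H; rewrite le_eqVlt; apply/orP; left; apply/eqP.
  by congr (`|_|); ring.
rewrite ltr0_norm // in hs Dh; have hp : 0 <= - h by rewrite oppr_ge0 ltW.
have s'0 : 0 <= h + s by rewrite addrC -[h]opprK subr_ge0.
have e : h + s + - h = s by ring.
have := forward x s'0 hp Dh; rewrite e sqrrN => H1.
have := q_lipschitz x y s'0 hp Dh; rewrite e => H2.
have {}H2 : `|- h * (q s x y - q (h + s) x y)| <= 2 * D * h ^+ 2.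
  rewrite normrM (ger0_norm hp); apply: le_trans (ler_wpM2l hp H2) _.
  by rewrite le_eqVlt; apply/orP; left; apply/eqP; ring.
rewrite mulrDl; apply: le_trans (lerD H1 H2); apply: le_trans (ler_normD _ _).
by rewrite le_eqVlt /G; apply/orP; left; apply/eqP; congr (`|_|); ring.
Qed.

Let G_derive x s : 0 < s ->
  h^-1 * (G x (h + s) - G x s) @[h --> 0^'] --> q s x y.
Proof.
move=> s0; set K := D ^+ 2 * M + 2 * D.
have K0 : 0 <= K by rewrite addr_ge0 // ?mulr_ge0 ?sqr_ge0.
have Dp : 0 < D by rewrite ltr0n.
apply/cvgrPdist_le => e e0; rewrite /dnbhs /within /=.
exists (Num.min s (Num.min D^-1 (e / (K + 1)))) => /=.
  by rewrite !lt_min s0 invr_gt0 Dp divr_gt0 // ltr_wpDl.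
move=> h /=; rewrite sub0r normrN !lt_min => /and3P[hs hD he] h0.
have Dh : D * `|h| <= 1 by rewrite -ler_pdivlMl // mulr1 ltW.
have := G_taylor x s0 (ltW hs) Dh; rewrite -/K => T.
have -> : q s x y - h^-1 * (G x (h + s) - G x s) =
  - (h^-1 * (G x (h + s) - G x s - h * q s x y)) by field.
rewrite normrN normrM normfV ler_pdivrMl ?normr_gt0 //; apply: le_trans T _.
rewrite -[h ^+ 2]real_normK ?num_real // expr2 mulrA [leRHS]mulrC ler_wpM2r //.
apply: le_trans (_ : (K + 1) * `|h| <= _); first by rewrite ler_wpM2r // lerDl.
by rewrite mulrC -ler_pdivlMr ?ltW // ltr_wpDl.
Qed.

(** [G x] is an antiderivative of the integrand, equal to [- g x] at time 0 and tending to 0 because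
    [g] is dominated by the decaying [psi]. *)
Lemma integral_transition x :
  \int[lebesgue_measure]_(s in `[0, +oo[) q s x y = g x.
Proof.
have Dp : 0 < D by rewrite ltr0n.
have lip (F : R -> R) (L s : R) : 0 <= L ->
    (forall h, `|h| <= D^-1 -> 0 <= s + h -> `|F (s + h) - F s| <= L * `|h|) ->
    forall e, 0 < e -> exists2 dl, 0 < dl & forall u, 0 <= u -> `|s - u| < dl ->
      `|F s - F u| <= e.
  move=> L0 hF e e0; exists (Num.min D^-1 (e / (L + 1))).
    by rewrite lt_min invr_gt0 Dp divr_gt0 // ltr_wpDl.
  move=> u u0; rewrite lt_min => /andP[u1 u2].
  have := hF (u - s); rewrite addrCA subrr addr0 (distrC u s) => /(_ (ltW u1) u0) H.
  rewrite distrC; apply: le_trans H _.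
  apply: le_trans (_ : (L + 1) * `|s - u| <= _); first by rewrite ler_wpM2r // lerDl.
  by rewrite mulrC -ler_pdivlMr ?(ltW u2) // ltr_wpDl.
have qlip s : 0 <= s -> forall h, `|h| <= D^-1 -> 0 <= s + h ->
    `|q (s + h) x y - q s x y| <= 2 * D * `|h|.
  move=> s0 h hD sh; have Dh : D * `|h| <= 1 by rewrite -ler_pdivlMl // mulr1.
  have [hp|hn] := leP 0 h.
    by rewrite ger0_norm // in Dh *; exact: q_lipschitz.
  rewrite ltr0_norm // in Dh *; have hp : 0 <= - h by rewrite oppr_ge0 ltW.
  by have := q_lipschitz x y sh hp Dh; rewrite addrK distrC.
have D2 : 0 <= 2 * D by rewrite mulr_ge0.
have -> : g x = 0 - G x 0.
  rewrite /G sub0r opprK; apply: EFin_inj; rewrite (averageE _ (lexx 0) gM).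
  rewrite -(@esum_set1 R V x (fun z => (g z)%:E)); last by rewrite lee_fin; case/andP: (gM x).
  rewrite [LHS]esum_mkcond; apply: eq_esum => z _; rewrite (walk_zero hq).
  have [->|zx] := eqVneq x z; first by rewrite mem_set // mul1r.
  by rewrite mul0r memNset //= => e; rewrite e eqxx in zx.
apply: Rintegral_ge0_continuous_FTC2y.
- by move=> s s0; exact: q0.
- apply/continuous_within_itvcyP; split.
    move=> s; rewrite in_itv /= andbT => s0; apply/cvgrPdist_le => e e0.
    have [dl dl0 hdl] := lip (fun r => q r x y) (2 * D) s D2 (qlip s (ltW s0)) e e0.
    apply/nbhs_ballP; exists (Num.min s dl); first by rewrite /= lt_min s0.
    move=> u; rewrite /ball /= lt_min => /andP[us ud]; apply: hdl => //.
    by move: us; rewrite ltr_norml => /andP[_]; lra.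
  apply/cvgrPdist_le => e e0; have [dl dl0 hdl] := lip (fun r => q r x y) (2 * D) 0 D2 (qlip 0 (lexx 0)) e e0.
  rewrite /at_right /within /=; apply/nbhs_ballP; exists dl => // u.
  by rewrite /ball /= => ud u0; apply: hdl => //; exact: ltW.
- apply/cvgrPdist_le => e e0; have [T hT] := vanish x e0.
  apply: filterS2 (nbhs_pinfty_ge (num_real T)) (nbhs_pinfty_ge (num_real 0)) => s Ts s0.
  rewrite /G sub0r opprK ger0_norm; last exact: average_ge0 gM.
  exact: hT.
- move=> s s0; apply/cvg_ex; exists (q s x y).
  rewrite (_ : (fun h => _) = (fun h => h^-1 * (G x (h + s) - G x s))); first exact: G_derive.
  by apply/funext => h; rewrite /= [h *: 1]mulr1.
- have Glip h : `|h| <= D^-1 -> 0 <= 0 + h -> `|G x (0 + h) - G x 0| <= (D * M + 1) * `|h|.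
    rewrite add0r => hD hp; rewrite ger0_norm // in hD *.
    have Dh : D * h <= 1 by rewrite -ler_pdivlMl // mulr1.
    have := forward x (lexx 0) hp Dh; rewrite add0r => H.
    have hq1 : 0 <= h * q 0 x y <= h.
      by rewrite mulr_ge0 ?q0 //= ler_piMr // q_le1.
    have hh : D ^+ 2 * M * h ^+ 2 <= D * M * h.
      have -> : D ^+ 2 * M * h ^+ 2 = D * h * (D * M * h) by ring.
      by rewrite ler_piMl // !mulr_ge0.
    move: H hq1; rewrite /G !ler_norml => /andP[? ?] /andP[? ?].
    by apply/andP; split; lra.
  have L0 : 0 <= D * M + 1 by rewrite addr_ge0 // mulr_ge0.
  apply/cvgrPdist_le => e e0; have [dl dl0 hdl] := lip (G x) (D * M + 1) 0 L0 Glip e e0.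
  rewrite /at_right /within /=; apply/nbhs_ballP; exists dl => // u.
  by rewrite /ball /= => ud u0; apply: hdl => //; exact: ltW.
- move=> s; rewrite in_itv /= andbT => s0; rewrite /derive1.
  by apply: cvg_lim => //; exact: G_derive.
Qed.

End FundamentalSolution.

End Walk.

Section GreenIntegral.
Context (R : realType) (V : choiceType) (E : rel V) (d : nat).
Hypotheses (Esym : symmetric E) (Eirr : irreflexive E).
Hypothesis Econn : forall x y : V, exists s : seq V, path E x s /\ last x s = y.
Hypothesis Eacyc : forall c : seq V, ucycle E c -> (size c <= 2)%N.
Variable nb : V -> seq V.
Hypotheses (nbP : forall x y, (y \in nb x) = E x y)
  (nb_uniq : forall x, uniq (nb x)) (nb_size : forall x, size (nb x) = d.+1).
Hypothesis d2 : (2 <= d)%N.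

Local Notation dep := (@depth V E Econn).

Lemma depth_sym x y : dep x y = dep y x.
Proof.
have [pg ug eg] := geodesicP Econn x y; set p := geodesic _ _ _ in pg ug eg.
have pr : path E y (rev (belast x p)).
  by rewrite -eg rev_path; apply: sub_path pg => a b; rewrite Esym.
have ur : uniq (y :: rev (belast x p)) by rewrite -{1}eg -rev_rcons -lastI rev_uniq.
have er : last y (rev (belast x p)) = x.
  by rewrite -eg; case: (p) => [//|z s]; rewrite /= rev_cons last_rcons.
rewrite [RHS]/depth (geodesic_eq Esym Econn Eacyc pr ur er).
by rewrite size_rev size_belast.
Qed.

Lemma green_sym x y : green R d Econn x y = green R d Econn y x.
Proof. by rewrite /green depth_sym. Qed.

Let D : R := d%:R.
Let D2 : 2 <= D. Proof. by rewrite ler_nat. Qed.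

Lemma lap_green y z : lap nb (green R d Econn y) z = - (z == y)%:R.
Proof.
have Dsq : 0 < D ^+ 2 - 1.
  by have h := D2; have := ler_pM (ler0n R 2) (ler0n R 2) h h; rewrite expr2; lra.
have D0 : D != 0 by rewrite gt_eqF //; have := D2; lra.
have := lap_radial Esym Eirr Econn Eacyc nbP nb_uniq nb_size y (fun k => green_cst R d / D ^+ k) z.
rewrite -/(green R d Econn y) => ->; rewrite -/D.
have [_|zy] := eqVneq z y.
  by rewrite expr0 expr1 mulr1n /green_cst -/D; field; rewrite D0 gt_eqF.
have : dep y z != 0%N by apply: contra zy => /eqP /(depth_eq0) ->.
case: (dep y z) => // k _; rewrite mulr0n oppr0 /= !exprS; field.
by rewrite expf_neq0.
Qed.

(* [z |-> (2 / (d + 1)) ^ depth z] is a strict supersolution dominating the Green function. *)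
Theorem integral_green (q : R -> V -> V -> R) x y : walk_transition E q ->
  \int[lebesgue_measure]_(s in `[0, +oo[) q s x y = green R d Econn x y.
Proof.
move=> hq; rewrite green_sym.
have D0 : 0 < D by have := D2; lra.
(* Every ratio strictly between [D^-1] and 1 gives a strict supersolution. Here [r] is their
   harmonic mean and [ga] the resulting exact decay rate away from [y]; at [y] the rate is [D - 1],
   which is larger. *)
pose r : R := 2 / (D + 1); pose ga := (D - 1) ^+ 2 / (2 * (D + 1)).
have r0 : 0 < r by rewrite divr_gt0 // addr_gt0.
have r1 : r <= 1 by rewrite ler_pdivrMr ?addr_gt0 // mul1r; have := D2; lra.
have Dr : D^-1 <= r.
  by rewrite ler_pdivlMr ?addr_gt0 // mulrC ler_pdivrMr //; have := D2; lra.
have D1 : 0 < D - 1 by have := D2; lra.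
have ga0 : 0 < ga by apply: divr_gt0; [exact: exprn_gt0|rewrite mulr_gt0 ?addr_gt0].
have C0 := green_cst_gt0 R d2; have C1 := green_cst_le1 R d2.
have gE z : green R d Econn y z = green_cst R d * D^-1 ^+ dep y z by rewrite /green exprVn.
have Dk k : 0 <= D^-1 ^+ k <= 1.
  by rewrite exprn_ge0 ?invr_ge0 ?(ltW D0) // exprn_ile1 ?invr_ge0 ?(ltW D0) // invf_le1 //; have := D2; lra.
apply: (@integral_transition R V E d Eirr nb nbP nb_uniq nb_size q hq y
  (green R d Econn y) 1 _ _ (fun z => r ^+ dep y z) ga) => [z|z|z|z||z].
- rewrite gE; have /andP[k0 k1] := Dk (dep y z).
  by rewrite mulr_ge0 ?(ltW C0) //= mulr_ile1 // ltW.
- exact: lap_green.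
- by rewrite exprn_ge0 ?(ltW r0) //= exprn_ile1 // ltW.
- rewrite gE; have /andP[k0 k1] := Dk (dep y z).
  apply: le_trans (_ : D^-1 ^+ dep y z <= _); first by rewrite ler_piMl.
  by rewrite lerXn2r ?nnegrE ?invr_ge0 // ltW.
- exact: ga0.
have := lap_radial Esym Eirr Econn Eacyc nbP nb_uniq nb_size y (fun k => r ^+ k) z.
move=> ->; rewrite -/D; have [->|zy] := eqVneq z y.
  rewrite (depth0 Esym Econn Eacyc) expr0 expr1 mulr1.
  have -> : (D + 1) * (r - 1) = - (D - 1) by rewrite /r; field; rewrite gt_eqF ?addr_gt0.
  rewrite lerN2 /ga ler_pdivrMr ?mulr_gt0 ?addr_gt0 // expr2 ler_wpM2l //; have := D2; lra.
have : dep y z != 0%N by apply: contra zy => /eqP /(depth_eq0) ->.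
case: (dep y z) => // k _; rewrite /= !exprS le_eqVlt; apply/orP; left; apply/eqP.
by rewrite /ga /r; field; rewrite gt_eqF ?addr_gt0.
Qed.

End GreenIntegral.

(** * Exponential moments of bounded random variables *)

(** Jensen's inequality, through the tangent line of the exponential at the mean. *)
Lemma expR_convex_sum (R : realType) (I : Type) (s : seq I) (w x : I -> R) :
  (forall i, 0 <= w i) -> \sum_(i <- s) w i = 1 ->
  expR (\sum_(i <- s) w i * x i) <= \sum_(i <- s) w i * expR (x i).
Proof.
move=> w0 w1; set m := \sum_(i <- s) _.
have -> : expR m = \sum_(i <- s) w i * (expR m * (1 + (x i - m))).
  transitivity (expR m * \sum_(i <- s) (w i + (w i * x i - w i * m))).
    by rewrite big_split /= sumrB -mulr_suml w1 mul1r -/m subrr addr0 mulr1.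
  by rewrite mulr_sumr; apply: eq_bigr => i _; ring.
apply: ler_sum => i _; apply: ler_wpM2l => //.
have -> : x i = m + (x i - m) by ring.
rewrite expRD ler_pM2l ?expR_gt0 //.
have -> : m + (x i - m) - m = x i - m by ring.
exact: expR_ge1Dx.
Qed.

Section BoundedExpectation.
Context (R : realType) (dsp : measure_display) (Omega : measurableType dsp).
Variable P : probability Omega R.
Implicit Types X Y : Omega -> R.

Definition bmeas X :=
  measurable_fun [set: Omega] X /\ exists M, forall w, `|X w| <= M.

Definition Ex X : R := \int[P]_w X w.

Lemma bmeas_cst c : bmeas (fun=> c).
Proof. by split; [exact: measurable_cst | exists `|c|]. Qed.

Lemma bmeas_add X Y : bmeas X -> bmeas Y -> bmeas (fun w => X w + Y w).
Proof.
move=> [mX [M bM]] [mY [N bN]]; split; first exact: measurable_funD.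
by exists (M + N) => w; apply: le_trans (ler_normD _ _) (lerD _ _).
Qed.

Lemma bmeas_mul X Y : bmeas X -> bmeas Y -> bmeas (fun w => X w * Y w).
Proof.
move=> [mX [M bM]] [mY [N bN]]; split; first exact: measurable_funM.
by exists (M * N) => w; rewrite normrM ler_pM.
Qed.

Lemma bmeas_scale c X : bmeas X -> bmeas (fun w => c * X w).
Proof. by move=> bX; apply: bmeas_mul => //; exact: bmeas_cst. Qed.

Lemma bmeas_opp X : bmeas X -> bmeas (fun w => - X w).
Proof.
by move=> /(bmeas_scale (-1)); under [X in bmeas X]eq_fun do rewrite mulN1r.
Qed.

Lemma bmeas_sub X Y : bmeas X -> bmeas Y -> bmeas (fun w => X w - Y w).
Proof. by move=> bX /bmeas_opp; exact: bmeas_add. Qed.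

Lemma bmeas_exp X : bmeas X -> bmeas (fun w => expR (X w)).
Proof.
move=> [mX [M bM]]; split; first exact: (measurableT_comp (@measurable_expR R) mX).
exists (expR M) => w; rewrite ger0_norm ?expR_ge0 // ler_expR.
exact: le_trans (ler_norm _) _.
Qed.

Lemma bmeas_sum (I : Type) (s : seq I) (X : I -> Omega -> R) :
  (forall i, bmeas (X i)) -> bmeas (fun w => \sum_(i <- s) X i w).
Proof.
move=> bX; elim: s => [|i s IH].
  by under [X in bmeas X]eq_fun do rewrite big_nil; exact: bmeas_cst.
by under [X in bmeas X]eq_fun do rewrite big_cons; exact: bmeas_add.
Qed.

Lemma bmeas_indic A : measurable A -> bmeas (\1_A).
Proof.
move=> mA; split; first exact: measurable_indic.
by exists 1 => w; rewrite indicE; case: (_ \in _); rewrite ?normr1 ?normr0.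
Qed.

Lemma bmeas_lim (X_ : nat -> Omega -> R) X M : (forall n, bmeas (X_ n)) ->
  (forall n w, `|X_ n w| <= M) -> (forall w, X_ n w @[n --> \oo] --> X w) ->
  bmeas X.
Proof.
move=> bX bM cX; split.
  by apply: (measurable_fun_cvg (h := X_)) => [n|w _]; [case: (bX n)|exact: cX].
exists M => w.
have cw : (`|X_ n w|) @[n --> \oo] --> `|X w| by apply: cvg_norm; exact: cX.
rewrite -(cvg_lim _ cw) //; apply: limr_le; first by apply: cvgP cw.
by near=> n; exact: bM.
Unshelve. all: by end_near.
Qed.

Lemma bmeas_integrable X : bmeas X -> P.-integrable [set: Omega] (EFin \o X).
Proof.
move=> [mX [M bM]]; apply: measurable_bounded_integrable => //.
  by rewrite ltey_eq fin_num_measure.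
exists M; split; first by rewrite num_real.
by move=> y My w _; exact: le_trans (bM w) (ltW My).
Qed.

Lemma Ex_cst c : Ex (fun=> c) = c.
Proof.
have /= PT := @probability_setT _ _ _ P.
by rewrite /Ex Rintegral_cst //= PT mulr1.
Qed.

Lemma Ex_add X Y : bmeas X -> bmeas Y -> Ex (fun w => X w + Y w) = Ex X + Ex Y.
Proof. by move=> bX bY; rewrite /Ex RintegralD //; exact: bmeas_integrable. Qed.

Lemma Ex_scale c X : bmeas X -> Ex (fun w => c * X w) = c * Ex X.
Proof. by move=> bX; rewrite /Ex RintegralZl //; exact: bmeas_integrable. Qed.

Lemma Ex_opp X : bmeas X -> Ex (fun w => - X w) = - Ex X.
Proof.
by move=> bX; rewrite -mulN1r -Ex_scale //; congr Ex; apply/funext => w; rewrite mulN1r.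
Qed.

Lemma Ex_sub X Y : bmeas X -> bmeas Y -> Ex (fun w => X w - Y w) = Ex X - Ex Y.
Proof.
by move=> bX bY; rewrite Ex_add ?Ex_opp //; exact: bmeas_opp.
Qed.

Lemma Ex_sum (I : Type) (s : seq I) (X : I -> Omega -> R) :
  (forall i, bmeas (X i)) ->
  Ex (fun w => \sum_(i <- s) X i w) = \sum_(i <- s) Ex (X i).
Proof.
move=> bX; elim: s => [|i s IH].
  by rewrite big_nil -[RHS](Ex_cst 0); congr Ex; apply/funext => w; rewrite big_nil.
rewrite big_cons -IH -Ex_add //; last exact: bmeas_sum.
by congr Ex; apply/funext => w; rewrite big_cons.
Qed.

Lemma Ex_le X Y : bmeas X -> bmeas Y -> (forall w, X w <= Y w) -> Ex X <= Ex Y.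
Proof. by move=> bX bY XY; apply: le_Rintegral => //; exact: bmeas_integrable. Qed.

Lemma Ex_ge0 X : (forall w, 0 <= X w) -> 0 <= Ex X.
Proof. by move=> X0; apply: Rintegral_ge0. Qed.

Lemma Ex_norm_le X M : bmeas X -> (forall w, `|X w| <= M) -> `|Ex X| <= M.
Proof.
move=> bX bM; rewrite ler_norml; apply/andP; split.
  rewrite -[leLHS]Ex_cst; apply: Ex_le => // [|w]; first exact: bmeas_cst.
  by move: (bM w); rewrite ler_norml => /andP[].
rewrite -[leRHS]Ex_cst; apply: Ex_le => // [|w]; first exact: bmeas_cst.
by move: (bM w); rewrite ler_norml => /andP[].
Qed.

Lemma Ex_close X Y e : bmeas X -> bmeas Y -> (forall w, `|X w - Y w| <= e) ->
  `|Ex X - Ex Y| <= e.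
Proof. by move=> bX bY he; rewrite -Ex_sub //; apply: Ex_norm_le => //; exact: bmeas_sub. Qed.

Lemma Ex_dct (X_ : nat -> Omega -> R) X M : (forall n, bmeas (X_ n)) ->
  (forall n w, `|X_ n w| <= M) -> (forall w, X_ n w @[n --> \oo] --> X w) ->
  Ex (X_ n) @[n --> \oo] --> Ex X.
Proof.
move=> bX bM cX.
have bXl := bmeas_lim bX bM cX.
have [|||||_ _] := @dominated_convergence _ _ _ P _ (@measurableT _ Omega)
  (fun n => EFin \o X_ n) (EFin \o X) (EFin \o cst M).
- by move=> n; apply/measurable_EFinP; case: (bX n).
- by apply/measurable_EFinP; case: bXl.
- by apply: aeW => w _; apply/cvg_EFin; [near=> n|exact: cX].
- exact: bmeas_integrable (bmeas_cst M).
- by apply: aeW => w n _; rewrite /= lee_fin.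
move=> h; apply: fine_cvg.
rewrite /Ex /Rintegral fineK //.
exact: integrable_fin_num (bmeas_integrable bXl).
Unshelve. all: by end_near.
Qed.

Lemma Ex_indic A : measurable A -> (Ex (\1_A))%:E = P A.
Proof.
move=> mA; rewrite /Ex /Rintegral integral_indic // setIT fineK //.
exact: fin_num_measure.
Qed.

Lemma Ex_on A X : measurable A -> Ex (fun w => \1_A w * X w) = \int[P]_(w in A) X w.
Proof.
move=> mA; rewrite /Ex Rintegral_mkcond [RHS]Rintegral_mkcond; congr Rintegral.
by apply/funext => w; rewrite !patchE in_setT indicE; case: (_ \in _); rewrite ?mul1r ?mul0r.
Qed.

Lemma Ex_exp_gt0 X : bmeas X -> 0 < Ex (fun w => expR (X w)).
Proof.
move=> bX; have [mX [M bM]] := bX.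
apply: (@lt_le_trans _ _ (expR (- M))); first exact: expR_gt0.
rewrite -{1}(Ex_cst (expR (- M))); apply: Ex_le; [exact: bmeas_cst|exact: bmeas_exp|].
by move=> w; rewrite ler_expR; move: (bM w); rewrite ler_norml => /andP[].
Qed.

(* [LM X B] : limsup over n of log E exp(X_n) is at most B. *)
Definition LM (X : nat -> Omega -> R) (B : R) :=
  (forall n, bmeas (X n)) /\
  forall e, 0 < e -> exists N, forall n, (N <= n)%N ->
    Ex (fun w => expR (X n w)) <= expR (B + e).

Lemma LM_ext (X Y : nat -> Omega -> R) B : (forall n w, X n w = Y n w) -> LM X B -> LM Y B.
Proof. by move=> e; rewrite (_ : X = Y) //; apply/funext => n; apply/funext. Qed.

Lemma LM_le (X : nat -> Omega -> R) B B' : B <= B' -> LM X B -> LM X B'.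
Proof.
move=> BB [bX h]; split => // e e0; have [N hN] := h e e0; exists N => n Nn.
by apply: le_trans (hN n Nn) _; rewrite ler_expR lerD2r.
Qed.

Lemma LM_mono (X Y : nat -> Omega -> R) B : (forall n, bmeas (X n)) ->
  (forall n w, X n w <= Y n w) -> LM Y B -> LM X B.
Proof.
move=> bX XY [bY h]; split => // e e0; have [N hN] := h e e0; exists N => n Nn.
apply: le_trans (hN n Nn); apply: Ex_le; [exact: bmeas_exp|exact: bmeas_exp|].
by move=> w; rewrite ler_expR.
Qed.

Lemma LM_cst c : LM (fun _ _ => c) c.
Proof.
split => [n|e e0]; first exact: bmeas_cst.
by exists 0%N => n _; rewrite Ex_cst ler_expR lerDl ltW.
Qed.

Lemma LM_const (X : Omega -> R) B : bmeas X -> Ex (fun w => expR (X w)) <= expR B ->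
  LM (fun=> X) B.
Proof.
move=> bX h; split => // e e0; exists 0%N => n _; apply: le_trans h _.
by rewrite ler_expR lerDl ltW.
Qed.

Lemma LM_addc (X : nat -> Omega -> R) B c : LM X B -> LM (fun n w => X n w + c) (B + c).
Proof.
move=> [bX h]; split => [n|e /h[N hN]]; first by apply: bmeas_add => //; exact: bmeas_cst.
exists N => n /hN H.
have -> : (fun w => expR (X n w + c)) = (fun w => expR c * expR (X n w)).
  by apply/funext => w; rewrite addrC expRD.
rewrite Ex_scale; last exact: bmeas_exp.
by rewrite addrAC [B + e + c]addrC expRD ler_pM2l ?expR_gt0.
Qed.

Lemma LM_seq_and (I : eqType) (s : seq I) (X : I -> nat -> Omega -> R) (B : I -> R) :
  (forall i, i \in s -> LM (X i) (B i)) -> forall e, 0 < e ->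
  exists N, forall i n, i \in s -> (N <= n)%N ->
    Ex (fun w => expR (X i n w)) <= expR (B i + e).
Proof.
elim: s => [|i s IH] h e e0; first by exists 0%N.
have [|N hN] := IH _ e e0; first by move=> j js; apply: h; rewrite inE js orbT.
have [|_ /(_ e e0)[M hM]] := h i; first by rewrite mem_head.
exists (maxn N M) => j n; rewrite inE geq_max => /orP[/eqP ->|js] /andP[Nn Mn].
  exact: hM.
exact: hN.
Qed.

(** Hoelder's inequality on the logarithmic scale. Once the bounds [B i] are subtracted, all
    exponential moments are at most [expR e], and plain convexity suffices. *)
Lemma LM_convex (I : eqType) (s : seq I) (w : I -> R)
    (X : I -> nat -> Omega -> R) (B : I -> R) :
  (forall i, 0 <= w i) -> \sum_(i <- s) w i = 1 ->
  (forall i n, bmeas (X i n)) -> (forall i, i \in s -> LM (X i) (B i)) ->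
  LM (fun n om => \sum_(i <- s) w i * X i n om) (\sum_(i <- s) w i * B i).
Proof.
move=> w0 w1 bX h; split => [n|e e0].
  by apply: bmeas_sum => i; apply: bmeas_scale.
have [N hN] := LM_seq_and h e0; exists N => n Nn.
set S := \sum_(i <- s) _.
have bY i : bmeas (fun om => w i * expR (X i n om - B i)).
  by apply: bmeas_scale; apply: bmeas_exp; apply: bmeas_sub => //; exact: bmeas_cst.
suff : Ex (fun om => expR (\sum_(i <- s) w i * X i n om - S)) <= expR e.
  move=> le1; rewrite expRD -ler_pdivrMl ?expR_gt0 // -expRN.
  rewrite -Ex_scale; last first.
    by apply: bmeas_exp; apply: bmeas_sum => i; apply: bmeas_scale.
  by under [X in Ex X]eq_fun do rewrite -expRD addrC.
apply: le_trans (_ : Ex (fun om => \sum_(i <- s) w i * expR (X i n om - B i)) <= _).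
  apply: Ex_le => //.
  - apply: bmeas_exp; apply: bmeas_sub; last exact: bmeas_cst.
    by apply: bmeas_sum => i; apply: bmeas_scale.
  - exact: bmeas_sum.
  - move=> om; rewrite -sumrB.
    under eq_bigr do rewrite -mulrBr.
    exact: expR_convex_sum.
rewrite Ex_sum // -[leRHS]mul1r -w1 mulr_suml big_seq [leRHS]big_seq.
apply: ler_sum => i si; rewrite Ex_scale; last first.
  by apply: bmeas_exp; apply: bmeas_sub => //; exact: bmeas_cst.
apply: ler_wpM2l => //.
under [X in Ex X]eq_fun do rewrite expRD mulrC.
rewrite Ex_scale; last exact: bmeas_exp.
by rewrite expRN ler_pdivrMl ?expR_gt0 // -expRD; exact: hN.
Qed.

Lemma LM_convex2 (k : R) (X Y : nat -> Omega -> R) B C : 0 <= k <= 1 -> LM X B -> LM Y C ->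
  LM (fun n w => (1 - k) * X n w + k * Y n w) ((1 - k) * B + k * C).
Proof.
move=> /andP[k0 k1] hX hY.
have [bX _] := hX; have [bY _] := hY.
have := @LM_convex bool [:: false; true] (fun b => if b then k else 1 - k)
  (fun b => if b then Y else X) (fun b => if b then C else B).
rewrite !big_cons !big_nil !addr0 => H.
have {H} := H _ _ _ _.
have e : (fun n om => \sum_(i <- [:: false; true]) (if i then k else 1 - k) *
    (if i then Y else X) n om) = (fun n w => (1 - k) * X n w + k * Y n w).
  by apply/funext => n; apply/funext => w; rewrite !big_cons big_nil addr0.
rewrite e; apply.
- by case; rewrite ?subr_ge0.
- by rewrite subrK.
- by case.
- by case.
Qed.

Lemma LM_avg3 (X Y Z : nat -> Omega -> R) B C D : LM X B -> LM Y C -> LM Z D ->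
  LM (fun n w => 3^-1 * (X n w + Y n w + Z n w)) (3^-1 * (B + C + D)).
Proof.
move=> hX hY hZ.
have h2 := @LM_convex2 2^-1 _ _ _ _ _ hX hY.
have h3 := @LM_convex2 3^-1 _ _ _ _ _ (h2 _) hZ.
have {h2 h3} := h3 _ _.
have e n w : (1 - 3^-1) * ((1 - 2^-1) * X n w + 2^-1 * Y n w) + 3^-1 * Z n w =
   3^-1 * (X n w + Y n w + Z n w) by field.
have -> : (1 - 3^-1) * ((1 - 2^-1) * B + 2^-1 * C) + 3^-1 * D =
   3^-1 * (B + C + D) by field.
move=> h; apply: (LM_ext e); apply: h.
- by apply/andP; split; lra.
- by apply/andP; split; lra.
Qed.

End BoundedExpectation.

(** * Functions of finitely many random bits *)

Section Bits.
Context (R : realType) (dsp : measure_display) (Omega : measurableType dsp).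
Variable P : probability Omega R.
Variables (I : finType) (X : I -> Omega -> bool).
Hypothesis mX : forall i, measurable_fun [set: Omega] (X i).

Definition bitset (b : {ffun I -> bool}) : set Omega :=
  [set w | [ffun i => X i w] = b].

Lemma measurable_bitset b : measurable (bitset b).
Proof.
have -> : bitset b = \big[setI/setT]_(i : I) (X i @^-1` [set b i]).
  apply/seteqP; split => [w <-|w].
    by elim/big_ind: _ => // i _ /=; rewrite ffunE.
  move=> h; apply/ffunP => i; rewrite ffunE.
  by move: h; rewrite (bigD1 i) //= => -[].
apply: bigsetI_measurable => i _.
by rewrite -[X in measurable X]setTI; apply: mX.
Qed.

Lemma bits_decomp (F : {ffun I -> bool} -> R) w :
  F [ffun i => X i w] = \sum_b F b * \1_(bitset b) w.
Proof.
rewrite (bigD1 [ffun i => X i w]) //= indicE mem_set // mulr1.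
rewrite big1 ?addr0 // => b nb; rewrite indicE memNset ?mulr0 // => eb.
by rewrite -eb eqxx in nb.
Qed.

Lemma bmeas_bits (F : {ffun I -> bool} -> R) :
  bmeas (fun w => F [ffun i => X i w]).
Proof.
under [X in bmeas X]eq_fun do rewrite bits_decomp.
by apply: bmeas_sum => b; apply: bmeas_scale; apply/bmeas_indic/measurable_bitset.
Qed.

Lemma Ex_bits (F : {ffun I -> bool} -> R) :
  Ex P (fun w => F [ffun i => X i w]) = \sum_b F b * fine (P (bitset b)).
Proof.
under [X in Ex _ X]eq_fun do rewrite bits_decomp.
rewrite Ex_sum; last first.
  by move=> b; apply: bmeas_scale; apply/bmeas_indic/measurable_bitset.
apply: eq_bigr => b _; rewrite Ex_scale; last exact/bmeas_indic/measurable_bitset.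
by rewrite -Ex_indic //; exact: measurable_bitset.
Qed.

End Bits.

(** * The semigroup *)

Section SemigroupExpansion.
Context (R : realType) (V : choiceType) (E : rel V) (d : nat).
Hypotheses (Esym : symmetric E) (Eirr : irreflexive E).
Variable nb : V -> seq V.
Hypotheses (nbP : forall x y, (y \in nb x) = E x y)
  (nb_uniq : forall x, uniq (nb x)) (nb_size : forall x, size (nb x) = d.+1).
Variable S : R -> (config V -> R) -> config V -> R.
Hypothesis fS : feller_semigroup S.
Hypothesis gS : forall f : config V -> R, cylinder_fun f ->
  semigroup_derivative S f (ssep_generator E f).
Implicit Types (f g : config V -> R) (A B : seq V).

Let L := @ssep_generator R V E.

Let continuous_cst (c : R) : continuous (fun _ : config V => c).
Proof. by move=> z; exact: cvg_cst. Qed.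

Lemma semigroup_linear t c f g : 0 <= t -> continuous f -> continuous g ->
  S t (fun z => f z + c * g z) = (fun z => S t f z + c * S t g z).
Proof.
move=> t0 cf cg; have := feller_linear fS c t0 cg cf.
under [X in S t X]eq_fun do rewrite addrC.
by move=> ->; apply/funext => z; rewrite addrC.
Qed.

Lemma semigroup_cst t c : 0 <= t -> S t (fun=> c) = (fun=> c).
Proof.
move=> t0.
have := semigroup_linear (c - 1) t0 (@continuous_cst 1) (@continuous_cst 1).
rewrite (feller_one fS t0).
have -> : (fun _ : config V => 1 + (c - 1) * 1) = (fun=> c).
  by apply/funext => z; rewrite mulr1 addrC subrK.
by [].
Qed.

Let continuous_aff (c k : R) f : continuous f -> continuous (fun z => c + k * f z).
Proof.
move=> cf y; apply: cvgD; first exact: cvg_cst.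
by apply: cvgMr; exact: cf.
Qed.

Let continuous_comb (k : R) f g : continuous f -> continuous g ->
  continuous (fun z => f z + k * g z).
Proof.
move=> cf cg y; apply: cvgD; first exact: cf.
by apply: cvgMr; exact: cg.
Qed.

Lemma semigroup_bound t f M : 0 <= t -> continuous f -> (forall z, `|f z| <= M) ->
  forall z, `|S t f z| <= M.
Proof.
move=> t0 cf fM z.
have fM' y : - M <= f y <= M by rewrite -ler_norml.
rewrite ler_norml; apply/andP; split.
  have := @feller_pos _ _ _ fS t (fun z => M + 1 * f z) t0 (@continuous_aff M 1 f cf).
  rewrite (semigroup_linear 1 t0 (@continuous_cst M) cf) (semigroup_cst M t0).
  move=> h; have : 0 <= M + 1 * S t f z by apply: h => y; have := fM' y; lra.
  lra.
have := @feller_pos _ _ _ fS t (fun z => M + (-1) * f z) t0 (@continuous_aff M (-1) f cf).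
rewrite (semigroup_linear (-1) t0 (@continuous_cst M) cf) (semigroup_cst M t0).
move=> h; have : 0 <= M + (-1) * S t f z by apply: h => y; have := fM' y; lra.
lra.
Qed.

Lemma semigroup_close t f g e : 0 <= t -> continuous f -> continuous g ->
  (forall z, `|f z - g z| <= e) -> forall z, `|S t f z - S t g z| <= e.
Proof.
move=> t0 cf cg h z.
have := @semigroup_bound t (fun z => f z + (-1) * g z) e t0
  (@continuous_comb (-1) f g cf cg) _ z.
rewrite (semigroup_linear (-1) t0 cf cg) mulN1r; apply => y; rewrite mulN1r; exact: h.
Qed.

Lemma generator_near f e : cylinder_fun f -> 0 < e -> exists2 dl, 0 < dl &
  forall h, 0 < h < dl -> forall z, `|S h f z - f z - h * L f z| <= e * h.
Proof.
move=> cf e0; have := gS cf; rewrite /semigroup_derivative => /(_ _ _)H.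
have /H : nbhs (L f : {uniform` setT -> R})
    [set g | forall z, `|L f z - g z| < e].
  apply/uniform_nbhs; exists [set xy | `|xy.1 - xy.2| < e]; split.
    rewrite -entourage_ballE; exists e => //= -[a b] /=.
  by move=> g h z; exact: h.
rewrite /nbhs /= => /nbhs_ballP[dl /= dl0 hdl].
exists dl => // h /andP[h0 hd] z.
have hb : ball (0 : R) dl h by rewrite /ball /= sub0r normrN gtr0_norm.
have /= /(_ z) hz := hdl h hb h0.
have -> : S h f z - f z - h * L f z = - (h * (L f z - h^-1 * (S h f z - f z))).
  by rewrite mulrBr opprB mulVKf ?gt_eqF.
by rewrite normrN normrM gtr0_norm // mulrC ler_wpM2r // ltW.
Qed.


Lemma semigroup_iter (tau : R) n f : 0 <= tau -> continuous f ->
  S (n.+1%:R * tau) f = S (n%:R * tau) (S tau f).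
Proof.
move=> t0 cf; rewrite -(feller_add fS) ?mulr_ge0 //.
by congr (S _ f); rewrite -natr1 mulrDl mul1r.
Qed.

Let S_cont t f : 0 <= t -> continuous f -> continuous (S t f).
Proof. exact: (feller_continuous fS). Qed.

Lemma semigroup_drift_iter (tau M : R) f n : 0 <= tau -> continuous f ->
  (forall z, `|S tau f z - f z| <= M) ->
  forall z, `|S (n%:R * tau) f z - f z| <= n%:R * M.
Proof.
move=> t0 cf h; elim: n => [|n IH] z.
  by rewrite !mul0r (feller_zero fS) // subrr normr0.
rewrite semigroup_iter //.
have -> : S (n%:R * tau) (S tau f) z - f z =
  (S (n%:R * tau) (S tau f) z - S (n%:R * tau) f z) + (S (n%:R * tau) f z - f z) by ring.
rewrite (le_trans (ler_normD _ _)) // -natr1 mulrDl mul1r addrC lerD //.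
by apply: (@semigroup_close (n%:R * tau)) => //; rewrite ?mulr_ge0 //; exact: S_cont.
Qed.

Lemma pick_step (h dl : R) : 0 < h -> 0 < dl ->
  exists n tau, [/\ 0 < tau, tau < dl & h = n%:R * tau].
Proof.
move=> h0 dl0; set n := (Num.bound (h / dl)).+1.
have n0 : 0 < n%:R :> R by rewrite ltr0n.
exists n, (h / n%:R); split; first exact: divr_gt0.
  rewrite ltr_pdivrMr // mulrC -ltr_pdivrMr //.
  rewrite (lt_trans (archi_boundP _)) ?ltr_nat //.
  by rewrite divr_ge0 // ltW.
by rewrite mulrCA divff ?mulr1 // gt_eqF.
Qed.

(** The derivative at time 0 controls a short step; [h] is cut into such steps and the contraction
    property adds them up. The extra [e / h] per unit of time is removed at the end. *)
Lemma semigroup_lipschitz f M h : cylinder_fun f -> (forall z, `|L f z| <= M) ->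
  0 <= h -> forall z, `|S h f z - f z| <= h * M.
Proof.
move=> cf fM; have cnf := cylinder_continuous cf.
rewrite le_eqVlt => /orP[/eqP <-|h0] z.
  by rewrite (feller_zero fS) // subrr normr0 mul0r.
apply/ler_addgt0Pr => e e0.
have e1 : 0 < e / h by rewrite divr_gt0.
have [dl dl0 hdl] := generator_near cf e1.
have [n [tau [t0 td hE]]] := pick_step h0 dl0.
have h1 y : `|S tau f y - f y| <= tau * (M + e / h).
  have -> : S tau f y - f y = (S tau f y - f y - tau * L f y) + tau * L f y by ring.
  rewrite (le_trans (ler_normD _ _)) // mulrDr addrC [tau * (e / h)]mulrC lerD //.
    by rewrite normrM gtr0_norm // ler_pM2l.
  by apply: hdl; rewrite t0.
have := semigroup_drift_iter n (ltW t0) cnf h1 z.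
rewrite -hE => /le_trans; apply.
by rewrite mulrA -hE mulrDr mulrCA divff ?mulr1 // gt_eqF.
Qed.

(** The same subdivision. The second-order term measures how far the semigroup moves [L f] within
    time [h], which is the previous bound applied to [L f]. *)
Lemma semigroup_taylor f M h : cylinder_fun f -> (forall z, `|L (L f) z| <= M) ->
  0 <= h -> forall z, `|S h f z - f z - h * L f z| <= h ^+ 2 * M.
Proof.
move=> cf fM; have cnf := cylinder_continuous cf.
have cLf : cylinder_fun (L f) := gen_cylinder Esym nbP nb_uniq cf.
have cnLf := cylinder_continuous cLf.
rewrite le_eqVlt => /orP[/eqP <-|h0] z.
  by rewrite (feller_zero fS) // expr2 !mul0r subrr subr0 normr0.
have M0 : 0 <= M by exact: le_trans (normr_ge0 _) (fM z).
apply/ler_addgt0Pr => e e0.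
have e1 : 0 < e / h by rewrite divr_gt0.
have [dl dl0 hdl] := generator_near cf e1.
have [n [tau [t0 td hE]]] := pick_step h0 dl0.
have step k : (k <= n)%N -> forall y,
    `|S (k%:R * tau) f y - f y - (k%:R * tau) * L f y| <=
    k%:R * (tau * (e / h) + tau * (h * M)).
  elim: k => [|k IH] kn y.
    by rewrite !mul0r (feller_zero fS) // subrr subr0 normr0.
  have kt0 : 0 <= k%:R * tau by rewrite mulr_ge0 // ltW.
  rewrite (semigroup_iter _ (ltW t0) cnf).
  have cg : continuous (fun y => f y + tau * L f y) by exact: continuous_comb.
  have cS : continuous (S tau f) by apply: S_cont; rewrite ?ltW.
  have a1 : `|S (k%:R * tau) (S tau f) y - S (k%:R * tau) (fun y => f y + tau * L f y) y|
      <= tau * (e / h).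
    apply: semigroup_close => // u; rewrite opprD addrA [leRHS]mulrC; apply: hdl.
    by rewrite t0.
  rewrite (semigroup_linear tau kt0 cnf cnLf) in a1.
  have a2 := IH (ltnW kn) y.
  have a3 : `|tau * (S (k%:R * tau) (L f) y - L f y)| <= tau * (h * M).
    rewrite normrM gtr0_norm // ler_pM2l //.
    apply: le_trans (semigroup_lipschitz cLf fM kt0 y) _.
    by rewrite ler_wpM2r // hE ler_pM2r // ler_nat ltnW.
  rewrite -natr1.
  set A := S _ (S tau f) y in a1 *; set B := S _ f y in a1 a2 *.
  set C := S _ (L f) y in a1 a3 *.
  have -> : A - f y - (k%:R + 1) * tau * L f y =
    (A - (B + tau * C)) + (B - f y - k%:R * tau * L f y) + tau * (C - L f y) by ring.
  rewrite (le_trans (ler_normD _ _)) // (le_trans (lerD (ler_normD _ _) (lexx _))) //.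
  lra.
have := step n (leqnn n) z; rewrite -hE => /le_trans; apply.
rewrite mulrDr !mulrA -hE le_eqVlt; apply/orP; left; apply/eqP; field.
by rewrite gt_eqF.
Qed.

(** * Growth of iterates of the generator, and Euler products *)

Section Combo.
Variables (k : nat) (F : {ffun 'I_k -> bool} -> R).

(** One fixed pattern [F] read at various [k]-tuples of sites. Exchanges only relocate the sites, so
    iterates of the generator stay of this form although their support spreads. *)
Definition combo_eval (s : seq (R * {ffun 'I_k -> V})) (zeta : config V) : R :=
  \sum_(c <- s) c.1 * F (local_config c.2 zeta).

Definition combo (N : R) g := exists2 s, g = combo_eval s & \sum_(c <- s) `|c.1| <= N.

Lemma combo_cylinder s : cylinder_fun (combo_eval s).
Proof.
apply: cylinder_sum => c; apply: (cylinder_op1 (fun r => c.1 * r)).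
exists (codom c.2) => z z' e; congr F; apply/ffunP => i; rewrite !ffunE.
by apply: e; exact: codom_f.
Qed.


Lemma combo_bound N g M : (forall b, `|F b| <= M) -> combo N g ->
  forall z, `|g z| <= N * M.
Proof.
move=> FM [s -> sN] z; have M0 := le_trans (normr_ge0 _) (FM [ffun=> false]).
apply: le_trans (ler_norm_sum _ _ _) _; apply: le_trans (ler_wpM2r M0 sN).
by rewrite mulr_suml; apply: ler_sum => c _; rewrite normrM ler_wpM2l.
Qed.

Lemma combo_le N N' g : N <= N' -> combo N g -> combo N' g.
Proof. by move=> NN [s -> sN]; exists s => //; exact: le_trans NN. Qed.

Lemma combo_add N N' g g' c : combo N g -> combo N' g' ->
  combo (N + `|c| * N') (fun z => g z + c * g' z).
Proof.
move=> [s -> sN] [s' -> sN']; exists (s ++ [seq (c * u.1, u.2) | u <- s']).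
  apply/funext => z; rewrite /combo_eval big_cat big_map mulr_sumr /=.
  by congr (_ + _); apply: eq_bigr => u _; rewrite mulrA.
rewrite big_cat big_map /= lerD //.
under eq_bigr do rewrite normrM; rewrite -mulr_sumr.
by rewrite ler_wpM2l.
Qed.

Let swap (x y u : V) : V := if u == x then y else if u == y then x else u.

Let local_config_exchange (a : {ffun 'I_k -> V}) x y zeta :
  local_config a (exchange x y zeta) = local_config [ffun i => swap x y (a i)] zeta.
Proof.
by apply/ffunP => i; rewrite !ffunE /exchange /swap; case: ifP => // _; case: ifP.
Qed.

Definition combo_rate : R := ((k * d.+2) * (k * d.+2))%:R.

(** Only arcs within the neighbourhood of the [k] sites act, at most [combo_rate] of them, and each
    contributes two terms of weight one half. Iterating thus costs a geometric factor, not a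
    factorial one. *)
Lemma combo_gen N g : combo N g -> combo (combo_rate * N) (L g).
Proof.
move=> [s -> sN]; apply: (@combo_le (combo_rate * \sum_(c <- s) `|c.1|)).
  by rewrite ler_wpM2l // ler0n.
elim: s {sN} => [|[c a] s IH].
  exists [::]; last by rewrite !big_nil mulr0.
  apply/funext => z; rewrite /combo_eval big_nil /L.
  rewrite (@genE R _ _ Esym _ nbP nb_uniq [::] [::] (combo_eval [::])) //.
    by rewrite /gen /arcs big_nil mulr0.
  by move=> u v _; rewrite /combo_eval !big_nil.
have e0 : combo_eval ((c, a) :: s) =
    (fun z => combo_eval s z + c * F (local_config a z)).
  by apply/funext => z; rewrite /combo_eval big_cons addrC.
have da : depends_on (codom a) (fun z => F (local_config a z)).
  move=> z z' e; congr F; apply/ffunP => i; rewrite !ffunE.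
  by apply: e; exact: codom_f.
have ca : cylinder_fun (fun z => F (local_config a z)) by exists (codom a).
rewrite e0 /L (genD Esym nbP nb_uniq) //; last exact: combo_cylinder.
apply: (@combo_le (combo_rate * \sum_(c <- s) `|c.1| + `|c| * combo_rate)).
  by rewrite big_cons /= mulrDr addrC [`|c| * _]mulrC.
apply: combo_add => //.
set B := nbhd nb (codom a).
rewrite (@genE R _ _ Esym _ nbP nb_uniq (codom a) B) ?nbhd_uniq //.
exists (flatten [seq [:: (2^-1, [ffun i => swap e.1 e.2 (a i)]); (- 2^-1, a)]
   | e <- arcs E B]).
  apply/funext => z; rewrite /gen /combo_eval big_flatten /= big_map mulr_sumr.
  apply: eq_bigr => e _; rewrite !big_cons big_nil /= local_config_exchange.
  by rewrite addr0 mulrBr mulNr.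
rewrite big_flatten /= big_map.
under eq_bigr do rewrite !big_cons big_nil /= normrN ger0_norm ?invr_ge0 ?ler0n //.
apply: le_trans (_ : \sum_(e <- arcs E B) 1 <= _).
  by apply: ler_sum => e _; lra.
rewrite big_const_seq count_predT iter_addr_0 ler_nat.
have sB : (size B <= k * d.+2)%N.
  by rewrite (leq_trans (nbhd_size nb_size _)) // size_codom card_ord.
exact: leq_trans (arcs_size _ _) (leq_mul sB sB).
Qed.

End Combo.

Definition euler (h : R) n f := iter n (fun g z => g z + h * L g z) f.

Lemma euler_cylinder h n f : cylinder_fun f -> cylinder_fun (euler h n f).
Proof.
move=> cf; elim: n => [//|n IH]; apply: (cylinder_op2 (fun a b => a + h * b)) => //.
exact: (gen_cylinder Esym nbP nb_uniq).
Qed.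

Lemma euler_gen h n f : cylinder_fun f -> euler h n (L f) = L (euler h n f).
Proof.
move=> cf; elim: n => [//|n IH] /=.
have ce := euler_cylinder h n cf.
rewrite -/(euler h n (L f)) -/(euler h n f) IH /L (genD Esym nbP nb_uniq) //.
exact: (gen_cylinder Esym nbP nb_uniq).
Qed.

(** Each of the [m] steps of length [h] errs by [h ^+ 2] times the size of the second iterate of the
    generator. By [combo_gen] this size is at most [K ^+ 2 * expR (t * K) * M] for all steps,
    leaving a total of order [m^-1]. *)
Lemma euler_cvg t f e : 0 <= t -> cylinder_fun f -> 0 < e ->
  exists N, forall n, (N <= n)%N -> forall z,
  `|S t f z - euler (t / n.+1%:R) n.+1 f z| <= e.
Proof.
move=> t0 cf e0; have [k [a [F [_ fE]]]] := cylinder_rep cf.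
pose M := \sum_b `|F b|; pose K := combo_rate k.
have M0 : 0 <= M by apply: sumr_ge0.
have K0 : 0 <= K by rewrite ler0n.
have FM b : `|F b| <= M by rewrite /M (bigD1 b) //= lerDl sumr_ge0.
pose C := t ^+ 2 * (K ^+ 2 * expR (t * K) * M).
have C0 : 0 <= C by rewrite !mulr_ge0 ?sqr_ge0 ?expR_ge0.
exists (Num.bound (C / e)) => n nN z.
set m := n.+1; set h := t / m%:R.
have hE : h = t / m%:R by [].
have m0 : 0 < m%:R :> R by rewrite ltr0n.
have h0 : 0 <= h by rewrite divr_ge0.
have hm : m%:R * h = t by rewrite mulrCA divff ?mulr1 // gt_eqF.
clearbody h.
have combo_e j : combo F ((1 + h * K) ^+ j) (euler h j f).
  elim: j => [|j IH] /=.
    rewrite expr0; exists [:: (1, a)]; last by rewrite big_cons big_nil normr1 addr0.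
    by rewrite fE; apply/funext => y; rewrite /combo_eval big_cons big_nil mul1r addr0.
  rewrite exprS mulrDl mul1r -mulrA; have := combo_add h IH (combo_gen IH).
  by rewrite ger0_norm.
have bnd j : (j <= m)%N -> forall y, `|L (L (euler h j f)) y| <= K ^+ 2 * expR (t * K) * M.
  move=> jm y; apply: le_trans (combo_bound FM (combo_gen (combo_gen (combo_e j))) y) _.
  rewrite ler_wpM2r // expr2 -!mulrA ler_wpM2l // ler_wpM2l //.
  have hK : 0 <= h * K by rewrite mulr_ge0.
  apply: le_trans (_ : expR (h * K) ^+ j <= _).
    have := expR_ge1Dx (h * K).
    by move=> ?; rewrite lerXn2r ?nnegrE ?expR_ge0 ?addr_ge0.
  by rewrite -expRM_natl ler_expR -hm -mulrA ler_wpM2r // ler_nat.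
have step j : (j <= m)%N -> forall y,
    `|S (j%:R * h) f y - euler h j f y| <= j%:R * (h ^+ 2 * (K ^+ 2 * expR (t * K) * M)).
  elim: j => [|j IH] jm y.
    by rewrite !mul0r (feller_zero fS) ?subrr ?normr0 //; exact: cylinder_continuous.
  have cf' := cylinder_continuous cf.
  have ce := euler_cylinder h j cf; have ce' := cylinder_continuous ce.
  have jh0 : 0 <= j%:R * h by rewrite mulr_ge0.
  have -> : S (j.+1%:R * h) f = S h (S (j%:R * h) f).
    by rewrite -(feller_add fS) //; congr (S _ f); rewrite -natr1 mulrDl mul1r addrC.
  have a1 := semigroup_close h0 (S_cont jh0 cf') ce' (IH (ltnW jm)) y.
  have a2 := semigroup_taylor ce (bnd j (ltnW jm)) h0 y.
  rewrite /= -/(euler h j f).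
  set A := S h (S _ f) y in a1 *; set B := S h (euler h j f) y in a1 a2 *.
  set D := euler h j f y in a2 *; set G := L _ y in a2 *.
  have -> : A - (D + h * G) = (A - B) + (B - D - h * G) by ring.
  by rewrite (le_trans (ler_normD _ _)) // -natr1 mulrDl mul1r lerD.
have := step m (leqnn m) z; rewrite hm => /le_trans; apply.
have -> : m%:R * (h ^+ 2 * (K ^+ 2 * expR (t * K) * M)) = C / m%:R.
  by rewrite /C hE; field; rewrite gt_eqF.
rewrite ler_pdivrMr // mulrC -ler_pdivrMr //.
rewrite ltW // (lt_le_trans (archi_boundP _)) ?divr_ge0 ?(ltW e0) //.
by rewrite ler_nat (leq_trans nN).
Qed.

Lemma semigroup_quasilocal t f : 0 <= t -> quasilocal f -> quasilocal (S t f).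
Proof.
move=> t0 qf; have cyl g : cylinder_fun g -> quasilocal (S t g).
  move=> cg e e0; have [N hN] := euler_cvg t0 cg e0.
  by exists (euler (t / N.+1%:R) N.+1 g); [exact: euler_cylinder|exact: hN].
apply: quasilocal_lim => e e0; have [g cg fg] := qf e e0.
exists (S t g); first exact: cyl.
by apply: semigroup_close => //; [exact: quasilocal_continuous|exact: cylinder_continuous].
Qed.

End SemigroupExpansion.

(** * The product law *)

Section UniformApprox.
Context (R : realType) (X : Type).
Implicit Types (f : X -> R).

Definition unif (f_ : nat -> X -> R) f := forall n z, `|f z - f_ n z| <= n.+1%:R^-1.

Lemma unif_cvg (f_ : nat -> X -> R) f z : unif f_ f -> f_ n z @[n --> \oo] --> f z.
Proof.
move=> h; apply/cvgrPdist_le => e e0.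
near=> n; apply: le_trans (h n z) _.
by apply: ltW; near: n; exact: near_infty_natSinv_lt (PosNum e0).
Unshelve. all: by end_near.
Qed.

Lemma unif_bound (f_ : nat -> X -> R) f M : unif f_ f -> (forall z, `|f z| <= M) ->
  forall n z, `|f_ n z| <= M + 1.
Proof.
move=> h fM n z; have -> : f_ n z = f z - (f z - f_ n z) by ring.
rewrite (le_trans (ler_normB _ _)) // lerD // (le_trans (h n z)) //.
by rewrite invf_le1 // ler1n.
Qed.

End UniformApprox.

Section StationaryLaw.
Context (R : realType) (dsp : measure_display) (Omega : measurableType dsp).
Variable P : probability Omega R.
Context (V : choiceType) (p : R).

Lemma quasilocal_seq (f : config V -> R) : quasilocal f ->
  exists f_ : nat -> config V -> R, (forall n, cylinder_fun (f_ n)) /\ unif f_ f.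
Proof.
move=> qf; have [f_ hf] : {f_ : nat -> config V -> R & forall n,
    cylinder_fun (f_ n) /\ forall z, `|f z - f_ n z| <= n.+1%:R^-1}.
  apply: (@choice _ _ (fun n g => cylinder_fun g /\
    forall z, `|f z - g z| <= n.+1%:R^-1)) => n.
  by have [|g cg fg] := qf n.+1%:R^-1; [rewrite invr_gt0 ltr0n|exists g].
by exists f_; split=> [n|n z]; case: (hf n).
Qed.

Lemma bmeas_quasilocal (zeta : Omega -> config V) (f : config V -> R) :
  (forall x, measurable_fun [set: Omega] (fun w => zeta w x)) ->
  quasilocal f -> bmeas (fun w => f (zeta w)).
Proof.
move=> mz qf.
have cyl g : cylinder_fun g -> bmeas (fun w => g (zeta w)).
  move=> /cylinder_rep[n [a [F [_ ->]]]].
  exact: (@bmeas_bits _ _ _ _ (fun i w => zeta w (a i))).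
have [M [_ fM]] := quasilocal_bounded qf.
have [f_ [cf uf]] := quasilocal_seq qf.
apply: (@bmeas_lim _ _ _ (fun n w => f_ n (zeta w)) _ (M + 1)) => [n|n w|w].
- exact: cyl.
- exact: unif_bound uf fM n _.
- exact: unif_cvg uf.
Qed.

Section Law.
Variable zeta : Omega -> config V.
Hypothesis mz : forall x, measurable_fun [set: Omega] (fun w => zeta w x).
Hypothesis law : has_law_nu P p zeta.

Lemma law_local n (a : {ffun 'I_n -> V}) (F : {ffun 'I_n -> bool} -> R) : injective a ->
  Ex P (fun w => F (local_config a (zeta w))) =
  \sum_(b : {ffun 'I_n -> bool}) F b * \prod_i (if b i then p else 1 - p).
Proof.
move=> ainj.
rewrite (@Ex_bits _ _ _ P _ (fun i w => zeta w (a i))) //.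
apply: eq_bigr => b _; congr (_ * _).
pose b' v := if [pick i | a i == v] is Some i then b i else false.
have b'a i : b' (a i) = b i.
  by rewrite /b'; case: pickP => [j /eqP/ainj -> //|/(_ i)]; rewrite eqxx.
have uc : uniq (codom a) by apply/injectiveP.
have -> : bitset (fun i w => zeta w (a i)) b =
    [set w | {in codom a, forall x, zeta w x = b' x}].
  apply/seteqP; split => w /=.
    by move=> hb x /codomP[i ->]; rewrite b'a -hb ffunE.
  by move=> h; apply/ffunP => i; rewrite ffunE h ?codom_f // b'a.
rewrite law //= codomE big_map enumT; apply: eq_bigr => i _.
by rewrite b'a.
Qed.

Lemma law_prod (A : seq V) (g : V -> bool -> R) : uniq A ->
  Ex P (fun w => \prod_(x <- A) g x (zeta w x)) =
  \prod_(x <- A) (p * g x true + (1 - p) * g x false).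
Proof.
move=> uA.
pose a := [ffun i => tnth (in_tuple A) i].
have ainj : injective a.
  have /tuple_uniqP tinj : uniq (in_tuple A) := uA.
  by move=> i j; rewrite !ffunE => /tinj.
have e (F : V -> R) : \prod_(x <- A) F x = \prod_i F (a i).
  by rewrite big_tnth; apply: eq_bigr => i _; rewrite ffunE.
pose F (b : {ffun 'I_(size A) -> bool}) := \prod_i g (a i) (b i).
transitivity (Ex P (fun w => F (local_config a (zeta w)))).
  congr Ex; apply/funext => w; rewrite e; apply: eq_bigr => i _.
  by rewrite [local_config _ _ _]ffunE.
rewrite (law_local F ainj) e /F.
transitivity (\sum_(b : {ffun 'I_(size A) -> bool})
    \prod_i (g (a i) (b i) * (if b i then p else 1 - p))).
  by apply: eq_bigr => b _; rewrite big_split.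
rewrite -(bigA_distr_bigA (fun i (b : bool) => g (a i) b * (if b then p else 1 - p))).
by apply: eq_bigr => i _; rewrite big_bool /= mulrC [X in _ + X]mulrC.
Qed.

End Law.

Lemma law_unique (z1 z2 : Omega -> config V) (f : config V -> R) :
  (forall x, measurable_fun [set: Omega] (fun w => z1 w x)) ->
  (forall x, measurable_fun [set: Omega] (fun w => z2 w x)) ->
  has_law_nu P p z1 -> has_law_nu P p z2 -> cylinder_fun f ->
  Ex P (fun w => f (z1 w)) = Ex P (fun w => f (z2 w)).
Proof.
move=> m1 m2 l1 l2 /cylinder_rep[n [a [F [ainj ->]]]].
by rewrite !(law_local _ _ F ainj).
Qed.

(** An exchange relabels the sites by a transposition, and the weights of the product law do not see
    labels. *)
Lemma law_exchange (zeta : Omega -> config V) x y : has_law_nu P p zeta ->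
  has_law_nu P p (fun w => exchange x y (zeta w)).
Proof.
move=> law A b uA.
pose s (u : V) := if u == x then y else if u == y then x else u.
have sK : involutive s.
  move=> u; rewrite /s; case: (eqVneq u x) => [->|ux].
    by case: (eqVneq y x) => [->//|_]; rewrite eqxx.
  by case: (eqVneq u y) => [->|uy]; rewrite ?eqxx // (negbTE ux) (negbTE uy).
have es z u : exchange x y z u = z (s u).
  by rewrite /exchange /s; case: ifP => // _; case: ifP.
have -> : [set w | {in A, forall u, exchange x y (zeta w) u = b u}] =
    [set w | {in map s A, forall u, zeta w u = b (s u)}].
  apply/seteqP; split => w /= h u.
    by move=> /mapP[v vA ->]; rewrite sK -es h.
  by move=> uA'; rewrite es h ?sK //; exact: map_f.
rewrite law; last by rewrite map_inj_uniq //; exact: inv_inj.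
by rewrite big_map; congr EFin; apply: eq_bigr => u _; rewrite sK.
Qed.

End StationaryLaw.

(** * Reversibility and the Dirichlet form *)

Section L2Theory.
Context (R : realType) (V : choiceType) (E : rel V) (d : nat).
Hypotheses (Esym : symmetric E).
Variable nb : V -> seq V.
Hypotheses (nbP : forall x y, (y \in nb x) = E x y)
  (nb_uniq : forall x, uniq (nb x)) (nb_size : forall x, size (nb x) = d.+1).
Variable S : R -> (config V -> R) -> config V -> R.
Hypothesis fS : feller_semigroup S.
Hypothesis gS : forall f : config V -> R, cylinder_fun f ->
  semigroup_derivative S f (ssep_generator E f).
Context (dsp : measure_display) (Omega : measurableType dsp).
Variables (P : probability Omega R) (p : R) (zeta : Omega -> config V).
Hypothesis mz : forall x, measurable_fun [set: Omega] (fun w => zeta w x).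
Hypothesis law : has_law_nu P p zeta.
Implicit Types (f g : config V -> R) (A B : seq V) (F : seq (V * V)).

Let L := @ssep_generator R V E.
Let cgen f : cylinder_fun f -> cylinder_fun (L f) := @gen_cylinder _ _ _ Esym _ nbP nb_uniq f.

Definition mean f : R := Ex P (fun w => f (zeta w)).
Local Notation nu := mean.

Let bq f : quasilocal f -> bmeas (fun w => f (zeta w)).
Proof. exact: bmeas_quasilocal. Qed.

Let qc f : cylinder_fun f -> quasilocal f.
Proof. exact: cylinder_quasilocal. Qed.

Let Scont t f : 0 <= t -> quasilocal f -> quasilocal (S t f).
Proof. exact: (semigroup_quasilocal Esym nbP nb_uniq nb_size fS gS). Qed.

Lemma nu_ext f g : (forall z, f z = g z) -> nu f = nu g.
Proof. by move=> fg; congr Ex; apply/funext => w; rewrite fg. Qed.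

Lemma nu_cst c : nu (fun=> c) = c.
Proof. exact: Ex_cst. Qed.

Lemma nu_add f g : quasilocal f -> quasilocal g ->
  nu (fun z => f z + g z) = nu f + nu g.
Proof. by move=> qf qg; rewrite /mean -Ex_add //; exact: bq. Qed.

Lemma nu_scale c f : quasilocal f -> nu (fun z => c * f z) = c * nu f.
Proof. by move=> qf; rewrite /mean -Ex_scale //; exact: bq. Qed.

Lemma nu_sub f g : quasilocal f -> quasilocal g ->
  nu (fun z => f z - g z) = nu f - nu g.
Proof. by move=> qf qg; rewrite /mean -Ex_sub //; exact: bq. Qed.

Lemma nu_sum (I : Type) (s : seq I) (f : I -> config V -> R) :
  (forall i, quasilocal (f i)) ->
  nu (fun z => \sum_(i <- s) f i z) = \sum_(i <- s) nu (f i).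
Proof. by move=> qf; rewrite /mean -Ex_sum // => i; exact: bq. Qed.

Lemma nu_le f g : quasilocal f -> quasilocal g -> (forall z, f z <= g z) ->
  nu f <= nu g.
Proof. by move=> qf qg fg; apply: Ex_le => //; exact: bq. Qed.

Lemma nu_ge0 f : (forall z, 0 <= f z) -> 0 <= nu f.
Proof. by move=> f0; exact: Ex_ge0. Qed.

Lemma nu_lim (f_ : nat -> config V -> R) f M : (forall n, quasilocal (f_ n)) ->
  (forall n z, `|f_ n z| <= M) -> (forall z, f_ n z @[n --> \oo] --> f z) ->
  nu (f_ n) @[n --> \oo] --> nu f.
Proof.
move=> qf fM fl; apply: (@Ex_dct _ _ _ P (fun n w => f_ n (zeta w)) _ M) => // n.
exact: bq.
Qed.

Lemma nu_exchange f x y : quasilocal f -> nu (fun z => f (exchange x y z)) = nu f.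
Proof.
have cyl g : cylinder_fun g -> nu (fun z => g (exchange x y z)) = nu g.
  move=> cg; rewrite /mean.
  apply: (@law_unique _ _ _ P _ p (fun w => exchange x y (zeta w))) => //.
    move=> u; rewrite /exchange; case: (u == x); first exact: mz.
    by case: (u == y); exact: mz.
  exact: law_exchange.
move=> qf; have [M [_ fM]] := quasilocal_bounded qf.
have [f_ [cf uf]] := quasilocal_seq qf.
have l1 : nu (f_ n) @[n --> \oo] --> nu f.
  apply: (@nu_lim _ _ (M + 1)) => [n|n z|z]; [exact: qc|exact: unif_bound fM _ _|exact: unif_cvg].
have l2 : nu (f_ n) @[n --> \oo] --> nu (fun z => f (exchange x y z)).
  under eq_fun do rewrite -cyl //.
  apply: (@nu_lim _ _ (M + 1)) => [n|n z|z].
  - exact/quasilocal_exchange/qc.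
  - exact: unif_bound fM _ _.
  - exact: unif_cvg.
exact: (cvg_unique _ l2 l1).
Qed.

Lemma nu_exchange_swap f g x y : quasilocal f -> quasilocal g ->
  nu (fun z => f z * g (exchange x y z)) = nu (fun z => f (exchange x y z) * g z).
Proof.
move=> qf qg; rewrite -(@nu_exchange _ x y); last first.
  by apply: quasilocal_mul => //; exact: quasilocal_exchange.
by apply: nu_ext => z; rewrite exchangeK.
Qed.

Let qcst (c : R) : quasilocal (fun _ : config V => c).
Proof. by apply: qc; exact: cylinder_cst. Qed.

Lemma nu_gen B f g : quasilocal f -> quasilocal g ->
  nu (fun z => f z * gen E B g z) =
  2^-1 * \sum_(e <- arcs E B)
    (nu (fun z => f z * g (exchange e.1 e.2 z)) - nu (fun z => f z * g z)).
Proof.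
move=> qf qg.
rewrite mulr_sumr -[RHS](_ : \sum_(e <- arcs E B) nu (fun z =>
    2^-1 * (f z * g (exchange e.1 e.2 z) - f z * g z)) = _); last first.
  apply: eq_bigr => e _; rewrite nu_scale ?nu_sub //.
  - by apply: quasilocal_mul => //; exact: quasilocal_exchange.
  - exact: quasilocal_mul.
  - rewrite -[X in quasilocal X](_ : (fun z => f z * g (exchange e.1 e.2 z) + (-1) * (f z * g z)) = _).
      apply: quasilocal_add.
        by apply: quasilocal_mul => //; exact: quasilocal_exchange.
      by apply: quasilocal_scale; exact: quasilocal_mul.
    by apply/funext => z; ring.
rewrite -nu_sum; last first.
  move=> e; apply: quasilocal_scale.
  rewrite -[X in quasilocal X](_ : (fun z => f z * g (exchange e.1 e.2 z) + (-1) * (f z * g z)) = _).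
    apply: quasilocal_add.
      by apply: quasilocal_mul => //; exact: quasilocal_exchange.
    by apply: quasilocal_scale; exact: quasilocal_mul.
  by apply/funext => z; ring.
apply: nu_ext => z; rewrite /gen mulrCA mulr_sumr mulr_sumr.
by apply: eq_bigr => e _; rewrite mulrBr.
Qed.

Lemma gen_sym f g : cylinder_fun f -> cylinder_fun g ->
  nu (fun z => f z * L g z) = nu (fun z => L f z * g z).
Proof.
move=> cf cg; have [A hA] := cf; have [B hB] := cg.
set C := nbhd nb (A ++ B).
have sA : {subset A <= A ++ B} by move=> x xA; rewrite mem_cat xA.
have sB : {subset B <= A ++ B} by move=> x xB; rewrite mem_cat xB orbT.
rewrite /L (@genE R _ _ Esym _ nbP nb_uniq A C f) ?nbhd_uniq //; last exact: nbhd_mono.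
rewrite (@genE R _ _ Esym _ nbP nb_uniq B C g) ?nbhd_uniq //; last exact: nbhd_mono.
rewrite nu_gen; [|exact: qc|exact: qc].
under [RHS]nu_ext do rewrite mulrC.
rewrite nu_gen; [|exact: qc|exact: qc].
congr (_ * _); apply: eq_bigr => e _; rewrite nu_exchange_swap; [|exact: qc|exact: qc].
by congr (_ - _); apply: nu_ext => z; rewrite mulrC.
Qed.

(** One factor one half is that of the generator with its ordered pairs; the other arises in writing
    [f * (f - f o sigma)] as half a square under an invariant exchange. Restriction to finitely many
    arcs gives a meaning to it for all quasilocal functions. *)
Definition dirichlet F f : R :=
  4^-1 * \sum_(e <- F) nu (fun z => (f (exchange e.1 e.2 z) - f z) ^+ 2).

Let qsq f e : quasilocal f ->
  quasilocal (fun z => (f (exchange e.1 e.2 z) - f z) ^+ 2 : R).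
Proof.
move=> qf; have qd : quasilocal (fun z => f (exchange e.1 e.2 z) + (-1) * f z).
  by apply: quasilocal_add; [exact: quasilocal_exchange|exact: quasilocal_scale].
rewrite -[X in quasilocal X](_ : (fun z => (f (exchange e.1 e.2 z) + (-1) * f z) *
   (f (exchange e.1 e.2 z) + (-1) * f z)) = _); first exact: quasilocal_mul.
by apply/funext => z; ring.
Qed.

Lemma dirichlet_le_gen F f : uniq F -> (forall e, e \in F -> E e.1 e.2) ->
  cylinder_fun f -> dirichlet F f <= - nu (fun z => f z * L f z).
Proof.
move=> uF FE cf; have [A hA] := cf; have qf := qc cf.
(* With the endpoints of [F] added to the window, [F] becomes part of its arcs; the other arcs have
   nonnegative terms and are dropped at the end. *)
set C := nbhd nb (A ++ map fst F ++ map snd F).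
have uC : uniq C := nbhd_uniq _ _.
have AC : {subset nbhd nb A <= C}.
  by apply: nbhd_mono => x xA; rewrite mem_cat xA.
rewrite /L (@genE R _ _ Esym _ nbP nb_uniq A C f) // nu_gen //.
have -> : - (2^-1 * \sum_(e <- arcs E C)
    (nu (fun z => f z * f (exchange e.1 e.2 z)) - nu (fun z => f z * f z))) =
    dirichlet (arcs E C) f.
  rewrite /dirichlet !mulr_sumr -sumrN; apply: eq_bigr => e _.
  have qff : quasilocal (fun z => f z * f z) by exact: quasilocal_mul.
  have qfe : quasilocal (fun z => f z * f (exchange e.1 e.2 z)).
    by apply: quasilocal_mul => //; exact: quasilocal_exchange.
  have qee : quasilocal (fun z => f (exchange e.1 e.2 z) * f (exchange e.1 e.2 z)).
    by apply: quasilocal_mul; exact: quasilocal_exchange.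
  have -> : nu (fun z => (f (exchange e.1 e.2 z) - f z) ^+ 2) =
     nu (fun z => (f (exchange e.1 e.2 z) * f (exchange e.1 e.2 z) + f z * f z)
        + (-2) * (f z * f (exchange e.1 e.2 z))).
    by apply: nu_ext => z; ring.
  rewrite nu_add; [|exact: quasilocal_add|exact: quasilocal_scale].
  rewrite nu_add // nu_scale //.
  have -> : nu (fun z => f (exchange e.1 e.2 z) * f (exchange e.1 e.2 z)) =
    nu (fun z => f z * f z) by rewrite -(@nu_exchange (fun z => f z * f z) e.1 e.2).
  by field.
rewrite /dirichlet ler_pM2l ?invr_gt0 ?ltr0n //.
have sF : {subset F <= arcs E C}.
  move=> e eF; rewrite mem_arcs FE //=; apply/andP; split; apply: nbhd_sub.
    by rewrite !mem_cat map_f ?orbT.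
  by rewrite !mem_cat (map_f snd) ?orbT.
rewrite [leRHS](bigID (mem F)) /= -[X in X + _]big_filter.
have -> : \sum_(i <- [seq i <- arcs E C | i \in F]) nu (fun z => (f (exchange i.1 i.2 z) - f z) ^+ 2)
   = \sum_(i <- F) nu (fun z => (f (exchange i.1 i.2 z) - f z) ^+ 2).
  apply: perm_big; apply: uniq_perm => //.
    by apply/filter_uniq/arcs_uniq.
  by move=> e; rewrite mem_filter andb_idr //; exact: sF.
by rewrite lerDl; apply: sumr_ge0 => e _; apply: nu_ge0 => z; exact: sqr_ge0.
Qed.

(** Euler products are polynomials in the symmetric generator. Their uniform convergence gives the
    claim for cylinder functions, and dominated convergence for quasilocal ones. *)
Lemma semigroup_sym t f g : 0 <= t -> quasilocal f -> quasilocal g ->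
  nu (fun z => f z * S t g z) = nu (fun z => S t f z * g z).
Proof.
move=> t0.
have eul n (h : R) f1 g1 : cylinder_fun f1 -> cylinder_fun g1 ->
    nu (fun z => f1 z * euler E h n g1 z) = nu (fun z => euler E h n f1 z * g1 z).
  move=> cf cg; elim: n f1 cf => [//|n IH] f1 cf.
  have ce := euler_cylinder Esym nbP nb_uniq h n cg.
  rewrite /= -/(euler E h n g1).
  transitivity (nu (fun z => (f1 z + h * L f1 z) * euler E h n g1 z)).
    have -> : nu (fun z => f1 z * (euler E h n g1 z + h * L (euler E h n g1) z)) =
      nu (fun z => f1 z * euler E h n g1 z + h * (f1 z * L (euler E h n g1) z)).
      by apply: nu_ext => z; ring.
    rewrite nu_add; last 2 first.
    - by apply: quasilocal_mul; exact: qc.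
    - by apply: quasilocal_scale; apply: quasilocal_mul; apply: qc => //; exact: cgen.
    rewrite nu_scale; last by apply: quasilocal_mul; apply: qc => //; exact: cgen.
    rewrite gen_sym // -nu_scale; last by apply: quasilocal_mul; apply: qc => //; exact: cgen.
    rewrite -nu_add; last 2 first.
    - by apply: quasilocal_mul; exact: qc.
    - by apply: quasilocal_scale; apply: quasilocal_mul; apply: qc => //; exact: cgen.
    by apply: nu_ext => z; ring.
  rewrite IH; last by apply: (cylinder_op2 (fun a b => a + h * b)) => //; exact: cgen.
  apply: nu_ext => z; congr (_ * _); rewrite /euler.
  exact: (esym (congr1 (fun k => k z)
    (iterSr n (fun (u : config V -> R) z => u z + h * L u z) f1))).
have cyl f1 g1 : cylinder_fun f1 -> cylinder_fun g1 ->
    nu (fun z => f1 z * S t g1 z) = nu (fun z => S t f1 z * g1 z).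
  move=> cf cg.
  have [Mf [Mf0 hMf]] := cylinder_bounded cf.
  have [Mg [Mg0 hMg]] := cylinder_bounded cg.
  apply/eqP; rewrite -subr_eq0 -normr_le0; apply/ler_addgt0Pr => e e0; rewrite add0r.
  set e1 := e / (Mf + Mg + 1).
  have e10 : 0 < e1 by rewrite divr_gt0 // ltr_wpDl // addr_ge0.
  have [Nf hNf] := euler_cvg Esym nbP nb_uniq nb_size fS gS t0 cf e10.
  have [Ng hNg] := euler_cvg Esym nbP nb_uniq nb_size fS gS t0 cg e10.
  set n := maxn Nf Ng; set h := t / n.+1%:R.
  have {}hNf := hNf n (leq_maxl _ _); have {}hNg := hNg n (leq_maxr _ _).
  have qSf := Scont t0 (qc cf); have qSg := Scont t0 (qc cg).
  have qef := qc (euler_cylinder Esym nbP nb_uniq h n.+1 cf).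
  have qeg := qc (euler_cylinder Esym nbP nb_uniq h n.+1 cg).
  have b1 : `|nu (fun z => f1 z * S t g1 z) - nu (fun z => f1 z * euler E h n.+1 g1 z)| <= Mf * e1.
    apply: Ex_close => [||w].
    - by apply: (@bq (fun z => f1 z * S t g1 z)); apply: quasilocal_mul => //; exact: qc.
    - by apply: (@bq (fun z => f1 z * euler E h n.+1 g1 z)); apply: quasilocal_mul => //; exact: qc.
    - by rewrite -mulrBr normrM; apply: ler_pM.
  have b2 : `|nu (fun z => S t f1 z * g1 z) - nu (fun z => euler E h n.+1 f1 z * g1 z)| <= e1 * Mg.
    apply: Ex_close => [||w].
    - by apply: (@bq (fun z => S t f1 z * g1 z)); apply: quasilocal_mul => //; exact: qc.
    - by apply: (@bq (fun z => euler E h n.+1 f1 z * g1 z)); apply: quasilocal_mul => //; exact: qc.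
    - by rewrite -mulrBl normrM; apply: ler_pM.
  rewrite (eul n.+1 h f1 g1 cf cg) in b1.
  have ee : (Mf + Mg + 1) * e1 = e.
    by rewrite /e1 mulrCA divff ?mulr1 // gt_eqF // ltr_wpDl // addr_ge0.
  set a := nu _ in b1 *; set b := nu _ in b2 *; set c := nu _ in b1 b2.
  have -> : a - b = (a - c) - (b - c) by ring.
  rewrite (le_trans (ler_normB _ _)) //.
  nra.
move=> qf qg.
have [Mf [_ fM]] := quasilocal_bounded qf.
have [Mg [_ gM]] := quasilocal_bounded qg.
have [f_ [cf uf]] := quasilocal_seq qf.
have [g_ [cg ug]] := quasilocal_seq qg.
have US k k_ : quasilocal k -> (forall n, cylinder_fun (k_ n)) -> unif k_ k ->
    unif (fun n => S t (k_ n)) (S t k).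
  move=> qk ck uk n z; apply: (semigroup_close fS) => //.
  - exact: quasilocal_continuous.
  - exact: cylinder_continuous.
have bS k M : quasilocal k -> (forall z, `|k z| <= M) -> forall z, `|S t k z| <= M.
  by move=> qk kM; apply: (semigroup_bound fS) => //; exact: quasilocal_continuous.
have l1 : nu (fun z => f_ n z * S t (g_ n) z) @[n --> \oo] --> nu (fun z => f z * S t g z).
  apply: (@nu_lim _ _ ((Mf + 1) * (Mg + 1))) => [n|n z|z].
  - by apply: quasilocal_mul; [exact: qc|exact/Scont/qc].
  - rewrite normrM ler_pM //; first exact: unif_bound fM _ _.
    exact: unif_bound (US _ _ qg cg ug) (bS _ _ qg gM) _ _.
  - apply: cvgM; first exact: unif_cvg.
    by apply: (@unif_cvg _ _ (fun n => S t (g_ n)) (S t g) z); exact: US.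
have l2 : nu (fun z => f_ n z * S t (g_ n) z) @[n --> \oo] --> nu (fun z => S t f z * g z).
  under eq_fun do rewrite cyl //.
  apply: (@nu_lim _ _ ((Mf + 1) * (Mg + 1))) => [n|n z|z].
  - by apply: quasilocal_mul; [exact/Scont/qc|exact: qc].
  - rewrite normrM ler_pM //; last exact: unif_bound gM _ _.
    exact: unif_bound (US _ _ qf cf uf) (bS _ _ qf fM) _ _.
  - apply: cvgM; last exact: unif_cvg.
    by apply: (@unif_cvg _ _ (fun n => S t (f_ n)) (S t f) z); exact: US.
exact: (cvg_unique _ l1 l2).
Qed.

Lemma nu_semigroup t f : 0 <= t -> quasilocal f -> nu (S t f) = nu f.
Proof.
move=> t0 qf; have := semigroup_sym t0 (qcst 1) qf.
rewrite (feller_one fS) //.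
under nu_ext do rewrite mul1r.
by under [RHS]nu_ext do rewrite mul1r.
Qed.

End L2Theory.

(** * Dissipation of the semigroup *)

(** The successive drops of a convex sequence decrease, so the drop after [N] is at most each of the
    [N] drops before. *)
Lemma convex_seq_drop (R : realType) (x : nat -> R) N :
  (forall k, x k.+1 - x k.+2 <= x k - x k.+1) ->
  N%:R * (x N - x N.+1) <= x 0%N - x N.
Proof.
move=> h; have mono j k : (j <= k)%N -> x k - x k.+1 <= x j - x j.+1.
  elim: k => [|k IH]; first by rewrite leqn0 => /eqP ->.
  rewrite leq_eqVlt => /orP[/eqP ->//|jk].
  exact: le_trans (h k) (IH jk).
suff H M : (M <= N)%N -> M%:R * (x N - x N.+1) <= x 0%N - x M by exact: H.
elim: M => [|M IH] MN; first by rewrite mul0r subrr.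
have := IH (ltnW MN); have := mono M N (ltnW MN); rewrite -natr1; lra.
Qed.

Lemma cvg_sum_seq (R : realType) (I : Type) (s : seq I) (u : I -> nat -> R) (l : I -> R) :
  (forall i, u i n @[n --> \oo] --> l i) ->
  (\sum_(i <- s) u i n) @[n --> \oo] --> \sum_(i <- s) l i.
Proof.
move=> h; elim: s => [|i s IH].
  by rewrite big_nil; under eq_fun do rewrite big_nil; exact: cvg_cst.
by rewrite big_cons; under eq_fun do rewrite big_cons; exact: cvgD.
Qed.

Section Energy.
Context (R : realType) (V : choiceType) (E : rel V) (d : nat).
Hypotheses (Esym : symmetric E).
Variable nb : V -> seq V.
Hypotheses (nbP : forall x y, (y \in nb x) = E x y)
  (nb_uniq : forall x, uniq (nb x)) (nb_size : forall x, size (nb x) = d.+1).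
Variable S : R -> (config V -> R) -> config V -> R.
Hypothesis fS : feller_semigroup S.
Hypothesis gS : forall f : config V -> R, cylinder_fun f ->
  semigroup_derivative S f (ssep_generator E f).
Context (dsp : measure_display) (Omega : measurableType dsp).
Variables (P : probability Omega R) (p : R) (zeta : Omega -> config V).
Hypothesis mz : forall x, measurable_fun [set: Omega] (fun w => zeta w x).
Hypothesis law : has_law_nu P p zeta.
Implicit Types (f g : config V -> R) (A B : seq V) (F : seq (V * V)).

Let L := @ssep_generator R V E.
Let cgen f : cylinder_fun f -> cylinder_fun (L f) := @gen_cylinder _ _ _ Esym _ nbP nb_uniq f.
Local Notation nu := (mean P zeta).
Local Notation dirichlet := (dirichlet P zeta).

Let qc f : cylinder_fun f -> quasilocal f.
Proof. exact: cylinder_quasilocal. Qed.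

Let qS t f : 0 <= t -> quasilocal f -> quasilocal (S t f).
Proof. exact: (semigroup_quasilocal Esym nbP nb_uniq nb_size fS gS). Qed.

Let qsub f g : quasilocal f -> quasilocal g -> quasilocal (fun z => f z - g z).
Proof.
move=> qf qg; rewrite (_ : (fun z => f z - g z) = (fun z => f z + (-1) * g z)).
  by apply: quasilocal_add => //; exact: quasilocal_scale.
by apply/funext => z; ring.
Qed.

Let qsq f : quasilocal f -> quasilocal (fun z => f z ^+ 2 : R).
Proof.
by move=> qf; under [X in quasilocal X]eq_fun do rewrite expr2; exact: quasilocal_mul.
Qed.

Let sym t f g : 0 <= t -> quasilocal f -> quasilocal g ->
  nu (fun z => f z * S t g z) = nu (fun z => S t f z * g z).
Proof. exact: (semigroup_sym Esym nbP nb_uniq nb_size fS gS mz law). Qed.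

Let half t f : 0 <= t -> quasilocal f ->
  nu (fun z => S t f z ^+ 2) = nu (fun z => f z * S (t + t) f z).
Proof.
move=> t0 qf; rewrite (feller_add fS) //; last exact: quasilocal_continuous.
by rewrite sym //; exact: qS.
Qed.

Let Ssub t f g : 0 <= t -> quasilocal f -> quasilocal g ->
  S t (fun z => f z - g z) = (fun z => S t f z - S t g z).
Proof.
move=> t0 qf qg.
have := semigroup_linear fS (-1) t0 (quasilocal_continuous qf) (quasilocal_continuous qg).
under [X in S t X]eq_fun do rewrite mulN1r.
by move=> ->; apply/funext => z; rewrite mulN1r.
Qed.

Definition autocorrelation f (h : R) n := nu (fun z => f z * S (n%:R * h) f z).

(** The second difference is the correlation of [f - S h f] with itself at lag [k%:R * h]. By
    symmetry this is the squared norm of its image at half the lag, hence nonnegative; this stands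
    in for the spectral theorem. *)
Lemma autocorrelation_convex f (h : R) k : 0 <= h -> quasilocal f ->
  autocorrelation f h k.+1 - autocorrelation f h k.+2 <=
  autocorrelation f h k - autocorrelation f h k.+1.
Proof.
move=> h0 qf.
have kh0 n : 0 <= n%:R * h by rewrite mulr_ge0.
have cf := quasilocal_continuous qf.
have qSh := qS h0 qf; have cSh := quasilocal_continuous qSh.
have addS n : S (n.+1%:R * h) f = S (n%:R * h) (S h f).
  by apply: (semigroup_iter fS).
have addS' n : S (n.+1%:R * h) f = S h (S (n%:R * h) f).
  by rewrite -(feller_add fS) //; congr (S _ f); rewrite -natr1 mulrDl mul1r addrC.
have := @half (k%:R * h / 2) (fun z => f z - S h f z) _ (qsub qf qSh).
rewrite -splitr => H.
have {}H := H (divr_ge0 (kh0 k) (ler0n _ 2)).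
have : 0 <= nu (fun z => (f z - S h f z) * S (k%:R * h) (fun z => f z - S h f z) z).
  by rewrite -H; apply: nu_ge0 => z; exact: sqr_ge0.
rewrite Ssub //.
have -> : nu (fun z => (f z - S h f z) * (S (k%:R * h) f z - S (k%:R * h) (S h f) z)) =
  nu (fun z => (f z * S (k%:R * h) f z - f z * S (k%:R * h) (S h f) z) -
   (S h f z * S (k%:R * h) f z - S h f z * S (k%:R * h) (S h f) z)).
  by apply: nu_ext => z; ring.
have q1 : quasilocal (fun z => f z * S (k%:R * h) f z).
  by apply: quasilocal_mul => //; exact: qS.
have q2 : quasilocal (fun z => f z * S (k%:R * h) (S h f) z).
  by apply: quasilocal_mul => //; exact: qS.
have q3 : quasilocal (fun z => S h f z * S (k%:R * h) f z).
  by apply: quasilocal_mul => //; exact: qS.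
have q4 : quasilocal (fun z => S h f z * S (k%:R * h) (S h f) z).
  by apply: quasilocal_mul => //; exact: qS.
rewrite (nu_sub P mz); [|exact: qsub|exact: qsub].
rewrite (nu_sub P mz q1 q2) (nu_sub P mz q3 q4).
have <- : autocorrelation f h k.+1 = nu (fun z => f z * S (k%:R * h) (S h f) z).
  by rewrite /autocorrelation addS.
have <- : autocorrelation f h k.+1 = nu (fun z => S h f z * S (k%:R * h) f z).
  rewrite /autocorrelation addS'; exact: sym (qS _ _).
have <- : autocorrelation f h k.+2 = nu (fun z => S h f z * S (k%:R * h) (S h f) z).
  rewrite /autocorrelation addS' addS; exact: sym (qS _ (qS _ _)).
rewrite -/(autocorrelation f h k); lra.
Qed.

(** The correlation of [f] with [S t f] is convex in [t], so its total drop up to time [2 * dl] is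
    at least [2 * dl] times its slope at the end, and symmetry splits that final time equally
    between the two factors. A mesh [h] replaces the derivative. *)
Lemma energy_decay f (dl : R) : 0 < dl -> cylinder_fun f ->
  - (2 * dl) * nu (fun z => S dl f z * S dl (L f) z) <=
  nu (fun z => f z ^+ 2) - nu (fun z => S dl f z ^+ 2).
Proof.
move=> d0 cf; have qf := qc cf; have qL := qc (cgen cf).
have [M [M0 fM]] := cylinder_bounded cf.
have t0 : 0 < 2 * dl by rewrite mulr_gt0.
have d0' := ltW d0.
have cnf := cylinder_continuous cf.
set G := S (dl + dl) f.
have GE : S dl (S dl f) = G by rewrite /G (feller_add fS).
have qG : quasilocal G by apply: qS => //; rewrite addr_ge0.
have GM z : `|G z| <= M by apply: (semigroup_bound fS) => //; rewrite addr_ge0.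
rewrite (sym d0' (qS d0' qf) qL) GE (half d0' qf).
apply/ler_addgt0Pr => e e0.
set e1 := e / (2 * dl * (M + 1)).
have M10 : 0 < M + 1 by rewrite ltr_wpDl.
have e10 : 0 < e1 by rewrite divr_gt0 // mulr_gt0.
have e1E : e1 * (2 * dl * (M + 1)) = e.
  by rewrite /e1 mulrVK // unitfE gt_eqF // mulr_gt0.
clearbody e1.
have [r r0 hr] := generator_near gS cf e10.
have [N [h [h0 hr' hN]]] := pick_step t0 r0.
pose c := autocorrelation f h.
have := @convex_seq_drop _ c N (fun k => autocorrelation_convex k (ltW h0) qf).
have Nh0 : 0 <= N%:R * h by rewrite mulr_ge0 // ltW.
have qSh := qS (ltW h0) qf.
have -> : c 0%N = nu (fun z => f z ^+ 2).
  by apply: nu_ext => z; rewrite mul0r (feller_zero fS) // expr2.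
have NhE : N%:R * h = dl + dl by rewrite -hN mulr_natl mulr2n.
have -> : c N = nu (fun z => f z * S (dl + dl) f z) by rewrite /c /autocorrelation NhE.
have qGL : quasilocal (fun z => G z * L f z) by exact: quasilocal_mul.
have -> : c N.+1 = nu (fun z => G z * S h f z).
  rewrite /c /autocorrelation (semigroup_iter fS _ (ltW h0) cnf) sym // NhE //.
have drop : - (h * nu (fun z => G z * L f z)) - e1 * h * M <=
    nu (fun z => f z * S (dl + dl) f z) - nu (fun z => G z * S h f z).
  have -> : nu (fun z => f z * S (dl + dl) f z) = nu (fun z => G z * f z).
    by apply: nu_ext => z; rewrite mulrC.
  rewrite -(nu_sub P mz); [|exact: quasilocal_mul|exact: quasilocal_mul].
  rewrite -(nu_scale P mz) // -[X in - _ - X](nu_cst P zeta).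
  rewrite -mulN1r -(nu_scale P mz); last exact: quasilocal_scale.
  rewrite -(nu_sub P mz); last 2 first.
  - by apply: quasilocal_scale; exact: quasilocal_scale.
  - by apply: qc; exact: cylinder_cst.
  apply: (nu_le P mz).
  - apply: qsub; last by apply: qc; exact: cylinder_cst.
    by apply: quasilocal_scale; exact: quasilocal_scale.
  - by apply: qsub; exact: quasilocal_mul.
  move=> z; have hz : `|S h f z - f z - h * L f z| <= e1 * h by apply: hr; rewrite h0.
  have : `|G z * (S h f z - f z - h * L f z)| <= e1 * h * M.
    by rewrite normrM mulrC ler_pM.
  rewrite ler_norml => /andP[_]; lra.
move=> cs; have {drop} : N%:R * (- (h * nu (fun z => G z * L f z)) - e1 * h * M) <=
    N%:R * (nu (fun z => f z * S (dl + dl) f z) - nu (fun z => G z * S h f z)).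
  by rewrite ler_wpM2l.
move=> /le_trans/(_ cs).
have -> : N%:R * (- (h * nu (fun z => G z * L f z)) - e1 * h * M) =
  - (2 * dl) * nu (fun z => G z * L f z) - e1 * (2 * dl) * M by rewrite hN; ring.
have : e1 * (2 * dl) * M <= e.
  rewrite -e1E [leRHS]mulrA; apply: ler_wpM2l; last by rewrite lerDl.
  by rewrite mulr_ge0 // ltW.
lra.
Qed.

(** [S dl f] need not be cylinder. Euler products commute with the generator, so they approximate
    [S dl f] while their images under the generator approximate [S dl (L f)]. *)
Lemma dirichlet_semigroup F f (dl : R) : uniq F -> (forall e, e \in F -> E e.1 e.2) ->
  0 <= dl -> cylinder_fun f ->
  dirichlet F (S dl f) <= - nu (fun z => S dl f z * S dl (L f) z).
Proof.
move=> uF FE d0 cf.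
have qf := qc cf; have cL := cgen cf; have qL := qc cL.
have [u_ hu] : {u_ : nat -> config V -> R & forall n, [/\ cylinder_fun (u_ n),
    forall z, `|S dl f z - u_ n z| <= n.+1%:R^-1 &
    forall z, `|S dl (L f) z - L (u_ n) z| <= n.+1%:R^-1]}.
  apply: (@choice _ _ (fun n u => [/\ cylinder_fun u,
    forall z, `|S dl f z - u z| <= n.+1%:R^-1 &
    forall z, `|S dl (L f) z - L u z| <= n.+1%:R^-1])) => n.
  have n0 : 0 < n.+1%:R^-1 :> R by rewrite invr_gt0 ltr0n.
  have [N1 h1] := euler_cvg Esym nbP nb_uniq nb_size fS gS d0 cf n0.
  have [N2 h2] := euler_cvg Esym nbP nb_uniq nb_size fS gS d0 cL n0.
  pose N := maxn N1 N2; exists (euler E (dl / N.+1%:R) N.+1 f); split.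
  - exact: euler_cylinder.
  - exact: (h1 _ (leq_maxl _ _)).
  - move=> z; rewrite /L -(euler_gen Esym nbP nb_uniq) //.
    exact: (h2 _ (leq_maxr _ _)).
have [M [_ fM]] := quasilocal_bounded (qS d0 qf).
have [M' [_ LM']] := quasilocal_bounded (qS d0 qL).
have cu n : cylinder_fun (u_ n) by case: (hu n).
have uu : unif u_ (S dl f) by move=> n; case: (hu n).
have uL : unif (fun n => L (u_ n)) (S dl (L f)) by move=> n; case: (hu n).
have l1 : (- nu (fun z => u_ n z * L (u_ n) z)) @[n --> \oo] -->
    - nu (fun z => S dl f z * S dl (L f) z).
  apply: cvgN; apply: (@nu_lim _ _ _ _ P zeta mz _ _ ((M + 1) * (M' + 1))) => [n|n z|z].
  - by apply: quasilocal_mul; apply: qc => //; exact: cgen.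
  - by rewrite normrM ler_pM //; [exact: unif_bound fM _ _|exact: (unif_bound uL LM')].
  - by apply: cvgM; [exact: unif_cvg|exact: (@unif_cvg _ _ (fun n => L (u_ n)) (S dl (L f)) z uL)].
have l2 : dirichlet F (u_ n) @[n --> \oo] --> dirichlet F (S dl f).
  apply: cvgMr; apply: cvg_sum_seq => e.
  apply: (@nu_lim _ _ _ _ P zeta mz _ _ ((M + 1 + (M + 1)) ^+ 2)) => [n|n z|z].
  - by apply: qsq; apply: qsub; last exact: qc; apply: quasilocal_exchange; exact: qc.
  - rewrite normrX lerXn2r ?nnegrE //.
      have := fM z; have := normr_ge0 (S dl f z); lra.
    rewrite (le_trans (ler_normB _ _)) // lerD //; exact: unif_bound fM _ _.
  - have cd : (u_ n (exchange e.1 e.2 z) - u_ n z) @[n --> \oo] -->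
       (S dl f (exchange e.1 e.2 z) - S dl f z) by apply: cvgB; exact: unif_cvg.
    by rewrite expr2; under eq_fun do rewrite expr2; exact: cvgM.
rewrite -(cvg_lim _ l1) // -(cvg_lim _ l2) //; apply: ler_lim.
- by apply: cvgP l2.
- by apply: cvgP l1.
near=> n; exact: (dirichlet_le_gen Esym nbP nb_uniq mz law).
Unshelve. all: by end_near.
Qed.

(** To first order the weight adds [2 * dl] times the integral of [W] against the square; the form
    hypothesis trades it for the Dirichlet form, which is exactly what the evolution over time [dl]
    has dissipated. The size [M] enters only at second order. *)
Lemma half_step_bound F (W : config V -> R) (M Lm dl : R) f :
  uniq F -> (forall e, e \in F -> E e.1 e.2) ->
  cylinder_fun W -> (forall z, `|W z| <= M) -> 0 <= Lm ->
  (forall g, quasilocal g ->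
    nu (fun z => W z * g z ^+ 2) <= dirichlet F g + Lm * nu (fun z => g z ^+ 2)) ->
  0 < dl -> 2 * dl * M <= 4^-1 -> quasilocal f ->
  nu (fun z => expR (2 * dl * W z) * S dl f z ^+ 2) <=
  (1 + 2 * dl * Lm + (2 * dl * M) ^+ 2) * nu (fun z => f z ^+ 2).
Proof.
move=> uF FE cW WM Lm0 form d0 dM.
have d20 : 0 < 2 * dl by rewrite mulr_gt0.
have cexp : cylinder_fun (fun z => expR (2 * dl * W z)).
  exact: (cylinder_op1 (fun r => expR (2 * dl * r))).
have M0 : 0 <= M := le_trans (normr_ge0 _) (WM (fun=> false)).
have absW z : `|2 * dl * W z| <= 2 * dl * M.
  by rewrite normrM gtr0_norm // ler_pM2l.
have cyl g : cylinder_fun g -> nu (fun z => expR (2 * dl * W z) * S dl g z ^+ 2) <=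
    (1 + 2 * dl * Lm + (2 * dl * M) ^+ 2) * nu (fun z => g z ^+ 2).
  move=> cg; have qg := qc cg; have qSg := qS (ltW d0) qg; have qS2 := qsq qSg.
  have := energy_decay d0 cg; have := dirichlet_semigroup uF FE (ltW d0) cg.
  have := form _ qSg.
  set D := dirichlet _ _; set X := nu (fun z => S dl g z * _).
  set Y := nu (fun z => g z ^+ 2); set Z := nu (fun z => S dl g z ^+ 2).
  set U := nu (fun z => W z * _) => h1 h2 h3.
  have Z0 : 0 <= Z by apply: nu_ge0 => z; exact: sqr_ge0.
  have D0 : 0 <= D.
    by apply: mulr_ge0 => //; apply: sumr_ge0 => e _; apply: nu_ge0 => z; exact: sqr_ge0.
  have up : nu (fun z => expR (2 * dl * W z) * S dl g z ^+ 2) <=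
      Z + 2 * dl * U + (2 * dl * M) ^+ 2 * Z.
    have qWS : quasilocal (fun z => W z * S dl g z ^+ 2).
      by apply: quasilocal_mul => //; exact: qc.
    have qW2 : quasilocal (fun z => 2 * dl * (W z * S dl g z ^+ 2)) by exact: quasilocal_scale.
    have qM2 : quasilocal (fun z => (2 * dl * M) ^+ 2 * S dl g z ^+ 2) by exact: quasilocal_scale.
    have <- : nu (fun z => S dl g z ^+ 2 + 2 * dl * (W z * S dl g z ^+ 2) +
       (2 * dl * M) ^+ 2 * S dl g z ^+ 2) = Z + 2 * dl * U + (2 * dl * M) ^+ 2 * Z.
      rewrite (nu_add P mz) //; last exact: quasilocal_add.
      by rewrite (nu_add P mz) // !(nu_scale P mz).
    apply: (nu_le P mz).
    - by apply: quasilocal_mul => //; exact: qc.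
    - by apply: quasilocal_add => //; exact: quasilocal_add.
    move=> z; have := expR_le_quadratic (le_trans (absW z) dM).
    have w2 : (2 * dl * W z) ^+ 2 <= (2 * dl * M) ^+ 2.
      by rewrite -real_normK ?num_real // lerXn2r ?nnegrE // (le_trans _ (absW z)).
    move=> he; have s0 := sqr_ge0 (S dl g z).
    apply: le_trans (_ : (1 + 2 * dl * W z + (2 * dl * M) ^+ 2) * S dl g z ^+ 2 <= _).
      by apply: ler_wpM2r => //; lra.
    by rewrite le_eqVlt; apply/orP; left; apply/eqP; ring.
  apply: le_trans up _.
  have h4 : 2 * dl * U <= 2 * dl * (D + Lm * Z) by rewrite ler_pM2l.
  have h5 : 2 * dl * D <= 2 * dl * - X by rewrite ler_pM2l.
  have ZY : Z <= Y by have : 0 <= 2 * dl * D; [rewrite mulr_ge0 // ltW|lra].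
  have h6 : 2 * dl * Lm * Z <= 2 * dl * Lm * Y.
    by rewrite ler_wpM2l // mulr_ge0 // ltW.
  have h7 : (2 * dl * M) ^+ 2 * Z <= (2 * dl * M) ^+ 2 * Y.
    by rewrite ler_wpM2l // sqr_ge0.
  lra.
move=> qf.
have [B [_ fB]] := quasilocal_bounded qf.
have [C [_ eC]] := cylinder_bounded cexp.
have [f_ [cf uf]] := quasilocal_seq qf.
have US : unif (fun n => S dl (f_ n)) (S dl f).
  move=> n z; apply: (semigroup_close fS) => //; first exact: ltW.
  - exact: quasilocal_continuous.
  - exact: cylinder_continuous.
have SB z : `|S dl f z| <= B.
  by apply: (semigroup_bound fS) => //; [exact: ltW|exact: quasilocal_continuous].
have l1 : nu (fun z => expR (2 * dl * W z) * S dl (f_ n) z ^+ 2) @[n --> \oo] -->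
    nu (fun z => expR (2 * dl * W z) * S dl f z ^+ 2).
  apply: (@nu_lim _ _ _ _ P zeta mz _ _ (C * (B + 1) ^+ 2)) => [n|n z|z].
  - apply: quasilocal_mul; first exact: qc.
    by apply: qsq; apply: qS; [exact: ltW|exact: qc].
  - rewrite normrM ler_pM // normrX lerXn2r ?nnegrE //.
      by have := fB z; have := normr_ge0 (f z); lra.
    exact: (unif_bound US SB).
  - apply: cvgMr; rewrite expr2; under eq_fun do rewrite expr2.
    by apply: cvgM; exact: (@unif_cvg _ _ (fun n => S dl (f_ n)) (S dl f) z US).
have l2 : ((1 + 2 * dl * Lm + (2 * dl * M) ^+ 2) * nu (fun z => f_ n z ^+ 2)) @[n --> \oo] -->
    (1 + 2 * dl * Lm + (2 * dl * M) ^+ 2) * nu (fun z => f z ^+ 2).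
  apply: cvgMr; apply: (@nu_lim _ _ _ _ P zeta mz _ _ ((B + 1) ^+ 2)) => [n|n z|z].
  - by apply: qsq; exact: qc.
  - rewrite normrX lerXn2r ?nnegrE //.
      by have := fB z; have := normr_ge0 (f z); lra.
    exact: unif_bound fB _ _.
  - rewrite expr2; under eq_fun do rewrite expr2.
    by apply: cvgM; exact: unif_cvg.
rewrite -(cvg_lim _ l1) // -(cvg_lim _ l2) //; apply: ler_lim.
- by apply: cvgP l1.
- by apply: cvgP l2.
near=> n; exact: cyl.
Unshelve. all: by end_near.
Qed.

End Energy.

(** * Discretised paths: Feynman-Kac bound and exponential martingale *)

Lemma archi_step (R : realType) (c e : R) : 0 <= c -> 0 < e ->
  exists N, forall n, (N <= n)%N -> c / n.+1%:R <= e.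
Proof.
move=> c0 e0; exists (Num.bound (c / e)) => n Nn.
have n0 : 0 < n.+1%:R :> R by rewrite ltr0n.
rewrite ler_pdivrMr // mulrC -ler_pdivrMr //.
rewrite ltW // (lt_le_trans (archi_boundP _)) ?divr_ge0 ?(ltW e0) //.
by rewrite ler_nat (leq_trans Nn).
Qed.

Lemma bernoulli_le (R : realType) (x : R) n : 0 <= x <= 1 ->
  1 - n%:R * x <= (1 - x) ^+ n.
Proof.
move=> /andP[x0 x1]; elim: n => [|n IH]; first by rewrite mul0r subr0 expr0.
have a : (1 - n%:R * x) * (1 - x) <= (1 - x) ^+ n.+1.
  by rewrite exprSr ler_wpM2r // subr_ge0.
apply: le_trans a; rewrite -natr1.
have : 0 <= n%:R * x * x by rewrite !mulr_ge0.
lra.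
Qed.

Lemma exprn_1D_le_expR (R : realType) (x : R) n : 0 <= x ->
  (1 + x) ^+ n <= expR (n%:R * x).
Proof.
move=> x0; rewrite expRM_natl lerXn2r ?nnegrE ?expR_ge0 ?addr_ge0 //.
exact: expR_ge1Dx.
Qed.

Section Path.
Context (R : realType) (V : choiceType) (E : rel V) (d : nat).
Hypotheses (Esym : symmetric E).
Variable nb : V -> seq V.
Hypotheses (nbP : forall x y, (y \in nb x) = E x y)
  (nb_uniq : forall x, uniq (nb x)) (nb_size : forall x, size (nb x) = d.+1).
Variable S : R -> (config V -> R) -> config V -> R.
Hypothesis fS : feller_semigroup S.
Hypothesis gS : forall f : config V -> R, cylinder_fun f ->
  semigroup_derivative S f (ssep_generator E f).
Context (dsp : measure_display) (Omega : measurableType dsp).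
Variables (P : probability Omega R) (p : R) (eta : R -> Omega -> config V).
Hypothesis meta : forall (t : R) x, 0 <= t -> measurable_fun [set: Omega] (fun w => eta t w x).
Hypothesis law : has_law_nu P p (eta 0).
Hypothesis markov : markov_with_semigroup P eta S.
Implicit Types (f g : config V -> R) (A B : seq V) (F : seq (V * V)).

Let L := @ssep_generator R V E.
Let cgen f : cylinder_fun f -> cylinder_fun (L f) := @gen_cylinder _ _ _ Esym _ nbP nb_uniq f.
Local Notation nu := (mean P (eta 0)).

Let qc f : cylinder_fun f -> quasilocal f.
Proof. exact: cylinder_quasilocal. Qed.

Let qS t f : 0 <= t -> quasilocal f -> quasilocal (S t f).
Proof. exact: (semigroup_quasilocal Esym nbP nb_uniq nb_size fS gS). Qed.

Let mz x : measurable_fun [set: Omega] (fun w => eta 0 w x).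
Proof. exact: meta. Qed.

Lemma bmeas_eta t f : 0 <= t -> quasilocal f -> bmeas (fun w => f (eta t w)).
Proof. by move=> t0; apply: bmeas_quasilocal => x; exact: meta. Qed.

(** Finitely many bits observed up to time [s]: such variables are finite combinations of indicators
    of events in the history, to which the Markov property applies one by one. *)
Definition adapted (s : R) (X : Omega -> R) : Prop :=
  exists (I : finType) (u : I -> R * V) (F : {ffun I -> bool} -> R),
    (forall i, 0 <= (u i).1 <= s) /\
    X = (fun w => F [ffun i => eta (u i).1 w (u i).2]).

Lemma adapted_mono s s' X : s <= s' -> adapted s X -> adapted s' X.
Proof.
move=> ss [I [u [F [h ->]]]]; exists I, u, F; split => // i.
by have /andP[-> /le_trans -> //] := h i.
Qed.

Lemma adapted_op (op : R -> R -> R) s X Y : adapted s X -> adapted s Y ->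
  adapted s (fun w => op (X w) (Y w)).
Proof.
move=> [I [u [F [hu ->]]]] [J [v [G [hv ->]]]].
exists (I + J)%type, (fun k => match k with inl i => u i | inr j => v j end),
  (fun b => op (F [ffun i => b (inl i)]) (G [ffun j => b (inr j)])); split.
  by case=> [i|j]; [exact: hu|exact: hv].
by apply/funext => w; congr op; [congr F|congr G]; apply/ffunP => i; rewrite !ffunE.
Qed.

Lemma adapted_cylinder s r f : 0 <= r <= s -> cylinder_fun f ->
  adapted s (fun w => f (eta r w)).
Proof.
move=> rs /cylinder_rep[n [a [F [_ ->]]]].
by exists 'I_n, (fun i => (r, a i)), F.
Qed.

Lemma adapted_bmeas s X : adapted s X -> bmeas X.
Proof.
move=> [I [u [F [hu ->]]]].
apply: (@bmeas_bits _ _ _ _ (fun i w => eta (u i).1 w (u i).2)) => i.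
by apply: meta; case/andP: (hu i).
Qed.

Lemma history_bitset s (I : finType) (u : I -> R * V) b :
  (forall i, 0 <= (u i).1 <= s) ->
  history eta s (bitset (fun i w => eta (u i).1 w (u i).2) b).
Proof.
move=> hu; rewrite /history; set G := [set A | _].
suff : @measurable _ (g_sigma_algebraType G)
   (bitset (fun i w => eta (u i).1 w (u i).2) b) by [].
have -> : bitset (fun i w => eta (u i).1 w (u i).2) b =
    \big[setI/setT]_(i : I) [set w | eta (u i).1 w (u i).2 = b i].
  apply/seteqP; split => [w hb|w].
    by elim/big_ind: _ => // i _ /=; rewrite -hb ffunE.
  move=> h; apply/ffunP => i; rewrite ffunE.
  by move: h; rewrite (bigD1 i) //= => -[].
apply: bigsetI_measurable => i _.
have mi : @measurable _ (g_sigma_algebraType G) [set w | eta (u i).1 w (u i).2].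
  by apply: sub_sigma_algebra; exists (u i).1, (u i).2.
case: (b i).
  by rewrite (_ : [set w | _ = true] = [set w | eta (u i).1 w (u i).2]) //.
rewrite (_ : [set w | _ = false] = ~` [set w | eta (u i).1 w (u i).2]).
  exact: measurableC.
by apply/seteqP; split => w /=; [move=> ->|move/negP/negbTE].
Qed.

Lemma markov_step s t X f : 0 <= s -> 0 <= t -> adapted s X -> quasilocal f ->
  Ex P (fun w => X w * f (eta (s + t) w)) = Ex P (fun w => X w * S t f (eta s w)).
Proof.
move=> s0 t0 [I [u [F [hu XE]]]] qf.
have mu i : measurable_fun [set: Omega] (fun w => eta (u i).1 w (u i).2).
  by apply: meta; case/andP: (hu i).
have mb b := measurable_bitset mu b.
have st0 : 0 <= s + t by rewrite addr_ge0.
have dec Y : bmeas Y -> Ex P (fun w => X w * Y w) =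
    \sum_b F b * \int[P]_(w in bitset (fun i w => eta (u i).1 w (u i).2) b) Y w.
  move=> bY; transitivity (Ex P (fun w => \sum_b F b *
      (\1_(bitset (fun i w => eta (u i).1 w (u i).2) b) w * Y w))).
    congr Ex; apply/funext => w; rewrite XE.
    rewrite (@bits_decomp _ _ Omega _ (fun i w => eta (u i).1 w (u i).2)) mulr_suml.
    by apply: eq_bigr => b _; rewrite mulrA.
  rewrite Ex_sum; last first.
    by move=> b; apply: bmeas_scale; apply: bmeas_mul => //; exact: bmeas_indic.
  apply: eq_bigr => b _; rewrite Ex_scale ?Ex_on //.
  by apply: bmeas_mul => //; exact: bmeas_indic.
rewrite (dec (fun w => f (eta (s + t) w))); last exact: bmeas_eta.
rewrite (dec (fun w => S t f (eta s w))); last by apply: bmeas_eta => //; exact: qS.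
apply: eq_bigr => b _; congr (_ * _); apply: markov => //.
  exact: quasilocal_continuous.
exact: history_bitset.
Qed.

Lemma stationary t f : 0 <= t -> quasilocal f -> Ex P (fun w => f (eta t w)) = nu f.
Proof.
move=> t0 qf.
have a1 : adapted 0 (fun=> 1).
  by apply: (@adapted_cylinder 0 0 (fun=> 1)); [rewrite lexx|exact: cylinder_cst].
have := markov_step (lexx 0) t0 a1 qf; rewrite add0r.
under eq_fun do rewrite mul1r; under [in RHS]eq_fun do rewrite mul1r.
by move=> ->; exact: (nu_semigroup Esym nbP nb_uniq nb_size fS gS mz law).
Qed.

(** The weight is read at the end of the time step, in accordance with the right endpoints in
    [path_sum]. *)
Definition tilt_step (W : config V -> R) (ep : R) g : config V -> R :=
  S ep (fun z => expR (ep * W z) * g z).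

Definition path_sum (W : config V -> R) (ep : R) n (w : Omega) : R :=
  ep * \sum_(k < n) W (eta (k.+1%:R * ep) w).

Let q_tilt W ep f : cylinder_fun W -> quasilocal f ->
  quasilocal (fun z => expR (ep * W z) * f z).
Proof.
move=> cW qf; apply: quasilocal_mul => //; apply: qc.
exact: (cylinder_op1 (fun r => expR (ep * r))).
Qed.

Lemma path_sum_adapted W ep n : 0 <= ep -> cylinder_fun W ->
  adapted (n%:R * ep) (path_sum W ep n).
Proof.
move=> e0 cW; rewrite /path_sum.
elim: n => [|n IH].
  rewrite (_ : (fun _ => _) = (fun w => (fun _ : config V => 0) (eta 0 w))).
    apply: (@adapted_cylinder _ 0 (fun=> 0)); last exact: cylinder_cst.
    by rewrite mul0r lexx.
  by apply/funext => w; rewrite big_ord0 mulr0.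
rewrite (_ : (fun _ => _) = (fun w => ep * (\sum_(k < n) W (eta (k.+1%:R * ep) w))
    + ep * W (eta (n.+1%:R * ep) w))); last first.
  by apply/funext => w; rewrite big_ord_recr /= mulrDr.
apply: (@adapted_op +%R (n.+1%:R * ep) (fun w => ep * (\sum_(k < n) W (eta (k.+1%:R * ep) w))) (fun w => ep * W (eta (n.+1%:R * ep) w))).
  by apply: adapted_mono IH; rewrite ler_wpM2r // ler_nat.
apply: (@adapted_cylinder _ _ (fun z => ep * W z)).
  by rewrite lexx andbT mulr_ge0.
exact: (cylinder_op1 (fun r => ep * r)).
Qed.

Lemma markov_iter W ep n X f : 0 <= ep -> cylinder_fun W -> adapted 0 X ->
  quasilocal f ->
  Ex P (fun w => X w * expR (path_sum W ep n w) * f (eta (n%:R * ep) w)) =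
  Ex P (fun w => X w * iter n (tilt_step W ep) f (eta 0 w)).
Proof.
move=> e0 cW aX; elim: n f => [|n IH] f qf.
  congr Ex; apply/funext => w; rewrite /path_sum big_ord0 mulr0 expR0 mulr1.
  by rewrite mul0r.
rewrite iterSr -IH; last by apply: qS => //; exact: q_tilt.
rewrite -markov_step //; last 3 first.
- by rewrite mulr_ge0.
- have aY := path_sum_adapted n e0 cW.
  apply: (adapted_op (fun a b => a * expR b) _ aY).
  by apply: adapted_mono aX; rewrite mulr_ge0.
- exact: q_tilt.
have -> : n%:R * ep + ep = n.+1%:R * ep by rewrite -natr1 mulrDl mul1r.
congr Ex; apply/funext => w; rewrite /path_sum big_ord_recr /= mulrDr expRD.
ring.
Qed.

(** * Feynman-Kac bound on the discrete path *)

Section FeynmanKac.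
Variables (F : seq (V * V)) (W : config V -> R) (M Lm : R).
Hypotheses (uF : uniq F) (FE : forall e, e \in F -> E e.1 e.2).
Hypotheses (cW : cylinder_fun W) (WM : forall z, `|W z| <= M) (Lm0 : 0 <= Lm).
Hypothesis form : forall g, quasilocal g ->
  nu (fun z => W z * g z ^+ 2) <= dirichlet P (eta 0) F g + Lm * nu (fun z => g z ^+ 2).

(** Symmetric splitting of a step of length [2 * dl]: this operator is self-adjoint for the
    stationary law, and the half-step estimate bounds its norm. *)
Let Pop (dl : R) g : config V -> R :=
  S dl (fun z => expR (2 * dl * W z) * S dl g z).

Let q_Pop (dl : R) g : 0 <= dl -> quasilocal g -> quasilocal (Pop dl g).
Proof. by move=> d0 qg; apply: qS => //; apply: q_tilt => //; exact: qS. Qed.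

Let qsq f : quasilocal f -> quasilocal (fun z => f z ^+ 2 : R).
Proof.
by move=> qf; under [X in quasilocal X]eq_fun do rewrite expr2; exact: quasilocal_mul.
Qed.

(** The squared norm of [k = Pop dl f] is the weighted product of [S dl f] and [S dl k]. Expanding
    the weighted square of [b * S dl f - S dl k] and using the half-step bound for both functions
    plays the part of Cauchy-Schwarz. *)
Let Pop_norm (dl : R) f : 0 < dl -> 2 * dl * M <= 4^-1 -> quasilocal f ->
  nu (fun z => Pop dl f z ^+ 2) <=
  (1 + 2 * dl * Lm + (2 * dl * M) ^+ 2) ^+ 2 * nu (fun z => f z ^+ 2).
Proof.
move=> d0 dM qf; set b := 1 + _ + _.
have dl0 := ltW d0.
have b0 : 0 < b.
  have : 0 <= 2 * dl * Lm by rewrite !mulr_ge0.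
  by have := sqr_ge0 (2 * dl * M); rewrite /b; lra.
set k := Pop dl f; have qk : quasilocal k by exact: q_Pop.
have bnd g := half_step_bound Esym nbP nb_uniq nb_size fS gS mz law
  uF FE cW WM Lm0 form d0 dM (f := g).
set ew := fun z => expR (2 * dl * W z).
have qe : quasilocal ew.
  by apply: qc; exact: (cylinder_op1 (fun r => expR (2 * dl * r))).
have qu : quasilocal (S dl f) by exact: qS.
have qv : quasilocal (S dl k) by exact: qS.
have kk : nu (fun z => k z ^+ 2) = nu (fun z => ew z * S dl f z * S dl k z).
  transitivity (nu (fun z => k z * Pop dl f z)).
    by apply: nu_ext => z; rewrite expr2.
  rewrite (semigroup_sym Esym nbP nb_uniq nb_size fS gS mz law dl0 qk); last first.
    by apply: q_tilt => //; exact: qS.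
  by apply: nu_ext => z; rewrite mulrC.
have qa : quasilocal (fun z => ew z * S dl f z ^+ 2).
  by apply: quasilocal_mul => //; exact: qsq.
have qb : quasilocal (fun z => ew z * S dl f z * S dl k z).
  by apply: quasilocal_mul => //; exact: quasilocal_mul.
have qd : quasilocal (fun z => ew z * S dl k z ^+ 2).
  by apply: quasilocal_mul => //; exact: qsq.
have : 0 <= nu (fun z => ew z * (b * S dl f z - S dl k z) ^+ 2).
  by apply: nu_ge0 => z; rewrite mulr_ge0 ?expR_ge0 ?sqr_ge0.
have -> : nu (fun z => ew z * (b * S dl f z - S dl k z) ^+ 2) =
    b ^+ 2 * nu (fun z => ew z * S dl f z ^+ 2) +
    (- (2 * b)) * nu (fun z => ew z * S dl f z * S dl k z) +
    nu (fun z => ew z * S dl k z ^+ 2).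
  rewrite -!(nu_scale P mz) // -!(nu_add P mz) //.
  - by apply: nu_ext => z; ring.
  - by apply: quasilocal_add; exact: quasilocal_scale.
  - exact: quasilocal_scale.
  - exact: quasilocal_scale.
rewrite -kk.
have := bnd _ qf; have := bnd _ qk; rewrite -/ew -/b.
set a1 := nu (fun z => ew z * S dl k z ^+ 2).
set a2 := nu (fun z => ew z * S dl f z ^+ 2).
set a3 := nu (fun z => k z ^+ 2); set a4 := nu (fun z => f z ^+ 2).
move=> h1 h2 h3.
have h4 : b * a3 <= b * (b * a2) by rewrite expr2 in h3; lra.
rewrite ler_pM2l // in h4.
by apply: le_trans h4 _; rewrite expr2 -mulrA ler_pM2l.
Qed.

Lemma feynman_kac_step ep n : 0 < ep -> ep * M <= 4^-1 ->
  Ex P (fun w => expR (path_sum W ep n w)) <= (1 + ep * Lm + (ep * M) ^+ 2) ^+ n.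
Proof.
move=> e0 eM; pose dl := ep / 2; have d0 : 0 < dl by rewrite divr_gt0.
have epE : ep = 2 * dl by rewrite /dl mulrCA divff ?mulr1.
have a1 : adapted 0 (fun=> 1).
  by apply: (@adapted_cylinder 0 0 (fun=> 1)); [rewrite lexx|exact: cylinder_cst].
have q1 : quasilocal (fun _ : config V => 1 : R) by apply: qc; exact: cylinder_cst.
have := markov_iter n (ltW e0) cW a1 q1.
under eq_fun do rewrite mul1r mulr1; under [in RHS]eq_fun do rewrite mul1r.
move=> ->; rewrite -/(nu (iter n (tilt_step W ep) (fun=> 1))).
have qP j : quasilocal (iter j (Pop dl) (fun=> 1)).
  by elim: j => [|j IH] //=; apply: q_Pop => //; exact: ltW.
(* Every full step is cut in two halves and the halves are regrouped around the weights; the half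
   step left over at the end of the path acts on the constant 1. *)
have -> : iter n (tilt_step W ep) (fun=> 1) = S dl (iter n (Pop dl) (fun=> 1)).
  elim: n => [|n IH] /=; first by rewrite (feller_one fS) // ltW.
  have qt : quasilocal (fun z => expR (ep * W z) * S dl (iter n (Pop dl) (fun=> 1)) z).
    by apply: q_tilt => //; apply: qS => //; exact: ltW.
  rewrite IH /tilt_step {1}epE mulr_natl mulr2n (feller_add fS) ?ltW //; last first.
    exact: quasilocal_continuous.
  by rewrite epE.
rewrite (nu_semigroup Esym nbP nb_uniq nb_size fS gS mz law (ltW d0) (qP n)).
set b := 1 + _ + _.
have b0 : 0 < b.
  have : 0 <= ep * Lm by rewrite mulr_ge0 // ltW.
  by have := sqr_ge0 (ep * M); rewrite /b; lra.
have norm j : nu (fun z => iter j (Pop dl) (fun=> 1) z ^+ 2) <= (b ^+ 2) ^+ j.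
  elim: j => [|j IH].
    by rewrite expr0 /=; under nu_ext do rewrite expr1n; rewrite nu_cst.
  rewrite /= exprS; apply: le_trans (Pop_norm d0 _ (qP j)) _; rewrite -epE //.
  by rewrite -/b ler_wpM2l // sqr_ge0.
have c0 : 0 < b ^+ n by rewrite exprn_gt0.
set x := iter n _ _.
(* The mean is bounded by the second moment through AM-GM, with [b ^+ n] as the expected size of
   [x]. *)
apply: le_trans (_ : nu (fun z => (2 * b ^+ n)^-1 * x z ^+ 2 + b ^+ n / 2) <= _).
  apply: (nu_le P mz); first exact: qP.
    apply: quasilocal_add; last by apply: qc; exact: cylinder_cst.
    by apply: quasilocal_scale; apply: qsq; exact: qP.
  move=> z; have := sqr_ge0 (x z - b ^+ n).
  have -> : (2 * b ^+ n)^-1 * x z ^+ 2 + b ^+ n / 2 =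
     x z + (2 * b ^+ n)^-1 * (x z - b ^+ n) ^+ 2.
    by field; rewrite gt_eqF.
  by move=> h; rewrite lerDl mulr_ge0 // invr_ge0 mulr_ge0 // ltW.
rewrite (nu_add P mz); last 2 first.
- by apply: quasilocal_scale; apply: qsq; exact: qP.
- by apply: qc; exact: cylinder_cst.
rewrite (nu_scale P mz); last by apply: qsq; exact: qP.
rewrite nu_cst.
have bE : b ^+ n = (2 * b ^+ n)^-1 * (b ^+ 2) ^+ n + b ^+ n / 2.
  by rewrite -exprM mulnC exprM; field; rewrite gt_eqF.
rewrite [leRHS]bE lerD2r; apply: ler_wpM2l; last exact: norm.
by rewrite invr_ge0 mulr_ge0 // ltW.
Qed.

(** The second-order terms add up to [(t * M) ^+ 2 / n.+1%:R], so as the mesh is refined only the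
    form constant [Lm] survives, however large [W] is. *)
Lemma feynman_kac_LM t : 0 < t ->
  LM P (fun n => path_sum W (t / n.+1%:R) n.+1) (t * Lm).
Proof.
move=> t0; have M0 : 0 <= M := le_trans (normr_ge0 _) (WM (fun=> false)).
split => [n|e e0].
  apply: (adapted_bmeas (path_sum_adapted n.+1 _ cW)).
  by rewrite divr_ge0 // ltW.
have q0 : 0 < 4^-1 :> R by rewrite invr_gt0.
have [N1 h1] := archi_step (mulr_ge0 (ltW t0) M0) q0.
have [N2 h2] := archi_step (sqr_ge0 (t * M)) e0.
exists (maxn N1 N2) => n; rewrite geq_max => /andP[n1 n2].
have n0 : 0 < n.+1%:R :> R by rewrite ltr0n.
set ep := t / n.+1%:R.
have e10 : 0 < ep by rewrite divr_gt0.
have epn : n.+1%:R * ep = t by rewrite mulrCA divff ?mulr1 // gt_eqF.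
have eM : ep * M <= 4^-1.
  by have := h1 n n1; rewrite /ep mulrAC.
apply: le_trans (feynman_kac_step n.+1 e10 eM) _.
rewrite -addrA; apply: le_trans (exprn_1D_le_expR _ _) _.
  by rewrite addr_ge0 ?sqr_ge0 // mulr_ge0 // ltW.
rewrite ler_expR mulrDr mulrA epn lerD2l.
apply: le_trans (h2 n n2); rewrite le_eqVlt; apply/orP; left; apply/eqP.
by rewrite /ep; field; rewrite gt_eqF.
Qed.

End FeynmanKac.

(** * Exponential martingale of a cylinder function *)

Section ExponentialMartingale.
Variable Psi : config V -> R.
Hypothesis cPsi : cylinder_fun Psi.

Let u z := expR (Psi z).
(** The potential whose product with [u = expR Psi] is [- L u], so that [u] is killed by the
    generator plus this potential. *)
Definition log_drift z := - (expR (- Psi z) * L (fun z => expR (Psi z)) z).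
Let U := log_drift.

Let cu : cylinder_fun u. Proof. exact: (cylinder_op1 (fun r => expR r)). Qed.
Let cLu : cylinder_fun (L u). Proof. exact: cgen. Qed.

Lemma log_drift_cylinder : cylinder_fun log_drift.
Proof.
exact: (cylinder_op2 (fun a b => - (expR (- a) * b)) cPsi cLu).
Qed.

Let S_mono t f g : 0 <= t -> quasilocal f -> quasilocal g ->
  (forall z, f z <= g z) -> forall z, S t f z <= S t g z.
Proof.
move=> t0 qf qg fg z.
have cf := quasilocal_continuous qf; have cg := quasilocal_continuous qg.
have q : quasilocal (fun z => g z + (-1) * f z).
  by apply: quasilocal_add => //; exact: quasilocal_scale.
have := feller_pos fS t0 (quasilocal_continuous q).
rewrite (semigroup_linear fS (-1) t0 cg cf) => h.
have : 0 <= S t g z + (-1) * S t f z.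
  by apply: h => y; rewrite mulN1r subr_ge0.
by rewrite mulN1r subr_ge0.
Qed.

Let S_scale t c f : 0 <= t -> quasilocal f ->
  S t (fun z => c * f z) = (fun z => c * S t f z).
Proof.
move=> t0 qf; have cf := quasilocal_continuous qf.
have c0 : continuous (fun _ : config V => 0 : R) by move=> z; exact: cvg_cst.
have := semigroup_linear fS c t0 c0 cf.
rewrite (semigroup_cst fS 0 t0).
under [X in S t X]eq_fun do rewrite add0r.
by move=> ->; apply/funext => z; rewrite add0r.
Qed.

(** Three errors of order [ep ^+ 2]: linearising the weight, expanding [S ep u], and replacing
    [S ep (L u)] by [L u]. As [u] is bounded below, the error can be written as a multiple of [u],
    and such a bound can be iterated. *)
Let one_step : exists K e0, [/\ 0 <= K, 0 < e0 & forall ep, 0 < ep < e0 ->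
  forall z, `|tilt_step U ep u z - u z| <= K * ep ^+ 2 * u z].
Proof.
have [B [B0 PB]] := cylinder_bounded cPsi.
have [Mu [Mu0 hMu]] := cylinder_bounded cu.
have [MU [MU0 hMU]] := cylinder_bounded log_drift_cylinder.
have [M2 [M20 hM2]] := cylinder_bounded (cgen cLu).
exists ((MU ^+ 2 * Mu + M2 + M2) * expR B), (4^-1 / (MU + 1)); split.
- by rewrite mulr_ge0 ?expR_ge0 // !addr_ge0 // mulr_ge0 // sqr_ge0.
- by rewrite divr_gt0 // ltr_wpDl.
move=> ep /andP[ep0 epU] z.
have ep0' := ltW ep0.
have epM : ep * MU <= 4^-1.
  move: epU; rewrite ltr_pdivlMr ?ltr_wpDl // => h.
  by apply: le_trans (ltW h); rewrite ler_pM2l // lerDl.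
have clin : cylinder_fun (fun z => u z + (- ep) * L u z).
  exact: (cylinder_op2 (fun a b => a + (- ep) * b)).
have qt : quasilocal (fun z => expR (ep * U z) * u z).
  by apply: q_tilt; [exact: log_drift_cylinder|exact: qc].
have a1 : `|tilt_step U ep u z - S ep (fun z => u z + (- ep) * L u z) z|
    <= ep ^+ 2 * (MU ^+ 2 * Mu).
  apply: (semigroup_close fS) => //; try exact: quasilocal_continuous.
    exact: cylinder_continuous.
  move=> y.
  have Uu : U y * u y = - L u y.
    by rewrite /U /log_drift mulNr mulrAC -expRD addNr expR0 mul1r.
  have -> : expR (ep * U y) * u y - (u y + - ep * L u y) =
      (expR (ep * U y) - 1 - ep * U y) * u y.
    by rewrite -[L u y]opprK -Uu; ring.
  have small : `|ep * U y| <= 4^-1.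
    by rewrite normrM gtr0_norm // (le_trans _ epM) // ler_pM2l.
  rewrite normrM mulrA; apply: ler_pM => //.
  have := expR_ge1Dx (ep * U y); have := expR_le_quadratic small => h1 h2.
  have h3 : (ep * U y) ^+ 2 <= ep ^+ 2 * MU ^+ 2.
    rewrite exprMn ler_wpM2l ?sqr_ge0 // -[U y ^+ 2]real_normK ?num_real //.
    by rewrite lerXn2r ?nnegrE.
  rewrite ger0_norm; lra.
rewrite (semigroup_linear fS (- ep) ep0' (cylinder_continuous cu) (cylinder_continuous cLu)) in a1.
have a2 := semigroup_taylor Esym nbP nb_uniq fS gS cu hM2 ep0' z.
have a3 := semigroup_lipschitz fS gS cLu hM2 ep0' z.
have a4 : `|ep * (S ep (L u) z - L u z)| <= ep ^+ 2 * M2.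
  by rewrite normrM gtr0_norm // expr2 -mulrA ler_pM2l.
have uB : 1 <= expR B * u z.
  rewrite /u -expRD -expR0 ler_expR; have := PB z; rewrite ler_norml => /andP[]; lra.
apply: le_trans (_ : ep ^+ 2 * (MU ^+ 2 * Mu + M2 + M2) <= _); last first.
  have -> : (MU ^+ 2 * Mu + M2 + M2) * expR B * ep ^+ 2 * u z =
    ep ^+ 2 * (MU ^+ 2 * Mu + M2 + M2) * (expR B * u z) by ring.
  by rewrite ler_peMr // mulr_ge0 ?sqr_ge0 // !addr_ge0 // mulr_ge0 // sqr_ge0.
set X := tilt_step _ _ _ _ in a1 *; set Y := S ep u z in a1 a2.
set Z := S ep (L u) z in a1 a3 a4.
have -> : X - u z = (X - (Y + - ep * Z)) + (Y - u z - ep * L u z) -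
   ep * (Z - L u z) by ring.
rewrite (le_trans (ler_normB _ _)) // (le_trans (lerD (ler_normD _ _) (lexx _))) //.
lra.
Qed.

Let X n t w := - Psi (eta 0 w) + path_sum U (t / n.+1%:R) n.+1 w + Psi (eta t w).

Let tilt_iter t : 0 < t -> exists K N, 0 <= K /\ forall n, (N <= n)%N ->
  (1 - K / n.+1%:R ^+ 2) ^+ n.+1 <= Ex P (fun w => expR (X n t w)) <=
  (1 + K / n.+1%:R ^+ 2) ^+ n.+1 /\ K / n.+1%:R ^+ 2 <= 1.
Proof.
move=> t0; have [K [e0 [K0 e00 hK]]] := one_step.
have e2 : 0 < e0 / 2 by rewrite divr_gt0.
have [N1 h1] := @archi_step R t (e0 / 2) (ltW t0) e2.
have [N2 h2] := @archi_step R (K * t ^+ 2) 1 (mulr_ge0 K0 (sqr_ge0 _)) ltr01.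
exists (K * t ^+ 2), (maxn N1 N2); split; first by rewrite mulr_ge0 // sqr_ge0.
move=> n; rewrite geq_max => /andP[n1 n2].
have n0 : 0 < n.+1%:R :> R by rewrite ltr0n.
have small : K * t ^+ 2 / n.+1%:R ^+ 2 <= 1.
  apply: le_trans (h2 n n2); apply: ler_wpM2l.
    by rewrite mulr_ge0 // sqr_ge0.
  by rewrite lef_pV2 ?posrE ?exprn_gt0 // ler_eXnr // ler1n.
split => //.
set ep := t / n.+1%:R; have ep0 : 0 < ep by rewrite divr_gt0.
have epn : n.+1%:R * ep = t by rewrite mulrCA divff ?mulr1 // gt_eqF.
have epe : ep < e0.
  by apply: le_lt_trans (h1 n n1) _; rewrite ltr_pdivrMr // ltr_pMr // ltr1n.
have -> : K * t ^+ 2 / n.+1%:R ^+ 2 = K * ep ^+ 2.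
  by rewrite /ep; field; rewrite gt_eqF.
have c0 : 0 <= K * ep ^+ 2 by rewrite mulr_ge0 // sqr_ge0.
have c1 : 0 <= 1 - K * ep ^+ 2.
  rewrite subr_ge0; apply: le_trans small.
  by rewrite le_eqVlt; apply/orP; left; apply/eqP; rewrite /ep; field; rewrite gt_eqF.
have {}hK := hK ep; rewrite ep0 epe in hK; have {hK}hK := hK isT.
have qu := qc cu.
have qT j : quasilocal (iter j (tilt_step U ep) u).
  elim: j => [//|j IH]; apply: qS; first exact: ltW.
  by apply: q_tilt => //; exact: log_drift_cylinder.
have qcu c : quasilocal (fun z => c * u z) by exact: quasilocal_scale.
have Tcu c : tilt_step U ep (fun z => c * u z) = (fun z => c * tilt_step U ep u z).
  rewrite /tilt_step -S_scale ?(ltW ep0) //; last first.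
    by apply: q_tilt => //; exact: log_drift_cylinder.
  by congr (S _ _); apply/funext => z; rewrite mulrCA.
have Tmono f g : quasilocal f -> quasilocal g -> (forall z, f z <= g z) ->
    forall z, tilt_step U ep f z <= tilt_step U ep g z.
  move=> qf qg fg; apply: S_mono; first exact: ltW.
  - by apply: q_tilt => //; exact: log_drift_cylinder.
  - by apply: q_tilt => //; exact: log_drift_cylinder.
  - by move=> z; rewrite ler_pM2l ?expR_gt0.
have Tb j z : (1 - K * ep ^+ 2) ^+ j * u z <= iter j (tilt_step U ep) u z <=
    (1 + K * ep ^+ 2) ^+ j * u z.
  elim: j z => [|j IH] z; first by rewrite !expr0 !mul1r lexx.
  have := hK z; rewrite ler_norml => /andP[k1 k2].
  apply/andP; split => /=.
    have lo : forall z, (1 - K * ep ^+ 2) ^+ j * u z <= iter j (tilt_step U ep) u z.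
      by move=> y; case/andP: (IH y).
    apply: le_trans (Tmono _ _ (qcu _) (qT j) lo z); rewrite Tcu [_ ^+ j.+1]exprSr -[leLHS]mulrA.
    by rewrite ler_wpM2l ?exprn_ge0 //; lra.
  have hi : forall z, iter j (tilt_step U ep) u z <= (1 + K * ep ^+ 2) ^+ j * u z.
    by move=> y; case/andP: (IH y).
  apply: le_trans (Tmono _ _ (qT j) (qcu _) hi z) _; rewrite Tcu [_ ^+ j.+1]exprSr -[leRHS]mulrA.
  by rewrite ler_wpM2l ?exprn_ge0 ?addr_ge0 //; lra.
have aX : adapted 0 (fun w => expR (- Psi (eta 0 w))).
  apply: (@adapted_cylinder 0 0 (fun z => expR (- Psi z))); first by rewrite lexx.
  exact: (cylinder_op1 (fun r => expR (- r))).
have := markov_iter n.+1 (ltW ep0) log_drift_cylinder aX qu.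
rewrite epn.
have -> : Ex P (fun w => expR (X n t w)) = Ex P (fun w => expR (- Psi (eta 0 w)) *
    expR (path_sum log_drift ep n.+1 w) * u (eta t w)).
  by congr Ex; apply/funext => w; rewrite /X !expRD.
move=> ->.
have bY : bmeas (fun w => expR (- Psi (eta 0 w)) * iter n.+1 (tilt_step U ep) u (eta 0 w)).
  apply: bmeas_mul; first exact: adapted_bmeas aX.
  exact: bmeas_eta.
apply/andP; split.
  rewrite -[leLHS](Ex_cst P); apply: Ex_le => // [|w]; first exact: bmeas_cst.
  have /andP[lo _] := Tb n.+1 (eta 0 w).
  by rewrite expRN ler_pdivlMl ?expR_gt0 // mulrC.
rewrite -[leRHS](Ex_cst P); apply: Ex_le => // [|w]; first exact: bmeas_cst.
have /andP[_ hi] := Tb n.+1 (eta 0 w).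
by rewrite expRN ler_pdivrMl ?expR_gt0 // mulrC.
Qed.

Let bX n t : 0 < t -> bmeas (X n t).
Proof.
move=> t0; have qP := qc cPsi.
apply: bmeas_add; last by apply: bmeas_eta => //; exact: ltW.
apply: bmeas_add; first by apply: bmeas_opp; exact: bmeas_eta.
apply: (adapted_bmeas (path_sum_adapted n.+1 _ log_drift_cylinder)).
by rewrite divr_ge0 // ltW.
Qed.

Lemma exp_martingale_LM t : 0 < t -> LM P (fun n w =>
  - Psi (eta 0 w) + path_sum log_drift (t / n.+1%:R) n.+1 w + Psi (eta t w)) 0.
Proof.
move=> t0; split => [n|e e0]; first exact: bX.
have [K [N [K0 h]]] := tilt_iter t0; have [N' h'] := archi_step K0 e0.
exists (maxn N N') => n; rewrite geq_max => /andP[n1 n2].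
have [/andP[_ hi] _] := h n n1; apply: le_trans hi _.
have n0 : 0 < n.+1%:R :> R by rewrite ltr0n.
apply: le_trans (exprn_1D_le_expR _ _) _; first by rewrite divr_ge0 ?sqr_ge0.
rewrite ler_expR add0r; apply: le_trans (h' n n2).
by rewrite le_eqVlt; apply/orP; left; apply/eqP; field; rewrite gt_eqF.
Qed.

(** The lower half of the mean-one property; the lower bound on the moment generating function rests
    on it. *)
Lemma exp_martingale_ge t e : 0 < t -> 0 < e -> exists N, forall n, (N <= n)%N ->
  expR (- e) <= Ex P (fun w => expR (- Psi (eta 0 w) +
    path_sum log_drift (t / n.+1%:R) n.+1 w + Psi (eta t w))).
Proof.
move=> t0 e0; have e1 : 0 < 1 - expR (- e).
  by rewrite subr_gt0 expRN invf_lt1 ?expR_gt0 // -expR0 ltr_expR.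
have [K [N [K0 h]]] := tilt_iter t0; have [N' h'] := archi_step K0 e1.
exists (maxn N N') => n; rewrite geq_max => /andP[n1 n2].
have [/andP[lo _] small] := h n n1; apply: le_trans lo.
have n0 : 0 < n.+1%:R :> R by rewrite ltr0n.
apply: le_trans (bernoulli_le _ _); last by rewrite small divr_ge0 ?sqr_ge0.
have -> : n.+1%:R * (K / n.+1%:R ^+ 2) = K / n.+1%:R by field; rewrite gt_eqF.
by have := h' n n2; move: (K / n.+1%:R) => q; lra.
Qed.

End ExponentialMartingale.

End Path.

(** * Superexponential replacement *)

Section Flow.
Context (R : realType) (V : choiceType) (E : rel V) (d : nat).
Hypotheses (Esym : symmetric E) (Eirr : irreflexive E).
Hypothesis Econn : forall x y : V, exists s : seq V, path E x s /\ last x s = y.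
Hypothesis Eacyc : forall c : seq V, ucycle E c -> (size c <= 2)%N.
Variable nb : V -> seq V.
Hypotheses (nbP : forall x y, (y \in nb x) = E x y)
  (nb_uniq : forall x, uniq (nb x)) (nb_size : forall x, size (nb x) = d.+1).
Hypothesis d2 : (2 <= d)%N.
Variable S : R -> (config V -> R) -> config V -> R.
Hypothesis fS : feller_semigroup S.
Hypothesis gS : forall f : config V -> R, cylinder_fun f ->
  semigroup_derivative S f (ssep_generator E f).
Context (dsp : measure_display) (Omega : measurableType dsp).
Variables (P : probability Omega R) (p : R) (eta : R -> Omega -> config V).
Hypotheses (p0 : 0 < p) (p1 : p < 1).
Hypothesis meta : forall (t : R) x, 0 <= t -> measurable_fun [set: Omega] (fun w => eta t w x).
Hypothesis law : has_law_nu P p (eta 0).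
Hypothesis markov : markov_with_semigroup P eta S.
Implicit Types (f : config V -> R) (A B : seq V) (F : seq (V * V)) (z : config V).

Local Notation nu := (mean P (eta 0)).
Local Notation dirichlet := (dirichlet P (eta 0)).

Let qc f : cylinder_fun f -> quasilocal f.
Proof. exact: cylinder_quasilocal. Qed.

Let mz x : measurable_fun [set: Omega] (fun w => eta 0 w x).
Proof. exact: meta. Qed.

Definition occ z x : R := (z x)%:R.

Let occ01 z x : 0 <= occ z x <= 1.
Proof. by rewrite /occ; case: (z x); rewrite ?lexx ?ler01. Qed.

Lemma occ_cylinder x : cylinder_fun (fun z => occ z x).
Proof. exact: (cylinder_coord (fun b : bool => b%:R : R)). Qed.

Let qsq f : quasilocal f -> quasilocal (fun z => f z ^+ 2 : R).
Proof.
by move=> qf; under [X in quasilocal X]eq_fun do rewrite expr2; exact: quasilocal_mul.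
Qed.

Let qsub f g : quasilocal f -> quasilocal g -> quasilocal (fun z => f z - g z : R).
Proof.
move=> qf qg; rewrite (_ : (fun z => f z - g z) = (fun z => f z + (-1) * g z)).
  by apply: quasilocal_add => //; exact: quasilocal_scale.
by apply/funext => z; ring.
Qed.

(* [(f o sigma)^2 - f^2] factors, and AM-GM trades the factor [f o sigma - f]
   against the Dirichlet form. *)
Lemma gradient_form (c : R) (g : config V -> R) x y f :
  cylinder_fun g -> (forall z, `|g z| <= 1) ->
  (forall z, g (exchange x y z) = g z) -> quasilocal f ->
  nu (fun z => c * (occ z x - occ z y) * g z * f z ^+ 2) <=
  4^-1 * nu (fun z => (f (exchange x y z) - f z) ^+ 2) +
  4 * c ^+ 2 * nu (fun z => f z ^+ 2).
Proof.
move=> cg g1 gx qf; set fs := fun z => f (exchange x y z).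
have qfs : quasilocal fs by exact: quasilocal_exchange.
have qcg : quasilocal (fun z => c * occ z x * g z).
  apply: quasilocal_mul; last exact: qc.
  by apply: quasilocal_scale; apply: qc; exact: occ_cylinder.
have qcg' : quasilocal (fun z => c * occ z y * g z).
  apply: quasilocal_mul; last exact: qc.
  by apply: quasilocal_scale; apply: qc; exact: occ_cylinder.
have e1 : nu (fun z => c * occ z y * g z * f z ^+ 2) =
    nu (fun z => c * occ z x * g z * fs z ^+ 2).
  rewrite -(nu_exchange mz law x y); last by apply: quasilocal_mul => //; exact: qsq.
  apply: nu_ext => z; rewrite gx /fs; congr (_ * _ * _ * _).
  by rewrite /occ /exchange eqxx; case: eqP => [->|].
have -> : nu (fun z => c * (occ z x - occ z y) * g z * f z ^+ 2) =
    nu (fun z => c * occ z x * g z * f z ^+ 2 - c * occ z x * g z * fs z ^+ 2).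
  rewrite (nu_sub P mz); last 2 first.
  - by apply: quasilocal_mul => //; exact: qsq.
  - by apply: quasilocal_mul => //; exact: qsq.
  rewrite -e1 -(nu_sub P mz); last 2 first.
  - by apply: quasilocal_mul => //; exact: qsq.
  - by apply: quasilocal_mul => //; exact: qsq.
  by apply: nu_ext => z; ring.
have e2 : nu (fun z => fs z ^+ 2) = nu (fun z => f z ^+ 2).
  by rewrite -(nu_exchange mz law x y (qsq qf)).
have -> : 4^-1 * nu (fun z => (fs z - f z) ^+ 2) + 4 * c ^+ 2 * nu (fun z => f z ^+ 2) =
    nu (fun z => 4^-1 * (fs z - f z) ^+ 2 +
      (2 * c ^+ 2 * f z ^+ 2 + 2 * c ^+ 2 * fs z ^+ 2)).
  have q1 := quasilocal_scale (4^-1) (qsq (qsub qfs qf)).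
  have q2 := quasilocal_scale (2 * c ^+ 2) (qsq qf).
  have q3 := quasilocal_scale (2 * c ^+ 2) (qsq qfs).
  rewrite (nu_add P mz q1 (quasilocal_add q2 q3)) (nu_add P mz q2 q3).
  rewrite !(nu_scale P mz) ?e2; [ring|exact: qsq|exact: qsq|].
  exact: (qsq (qsub qfs qf)).
apply: (nu_le P mz).
- by apply: qsub; apply: quasilocal_mul => //; exact: qsq.
- apply: quasilocal_add; first exact: quasilocal_scale (qsq (qsub qfs qf)).
  by apply: quasilocal_add; apply: quasilocal_scale; exact: qsq.
move=> z; have /andP[oc0 oc1] := occ01 z x.
have gg : g z ^+ 2 <= 1 by rewrite -real_normK ?num_real // expr_le1.
have oo : occ z x ^+ 2 <= 1 by rewrite expr_le1.
have k1 : (occ z x * g z) ^+ 2 <= 1.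
  by rewrite exprMn mulr_ile1 ?sqr_ge0.
set k := occ z x * g z in k1.
(* Completing the square bounds [c * k * (f ^+ 2 - fs ^+ 2)] by a quarter of the squared difference
   plus [(c * k * (f + fs)) ^+ 2]; [h3] then bounds the square of the sum by twice the sum of the
   squares. *)
have h1 := sqr_ge0 (2^-1 * (fs z - f z) + c * k * (f z + fs z)).
have h2 : c ^+ 2 * k ^+ 2 * (f z + fs z) ^+ 2 <= c ^+ 2 * (f z + fs z) ^+ 2.
  by rewrite -mulrA ler_wpM2l ?sqr_ge0 // ler_piMl ?sqr_ge0.
have h3 : 0 <= c ^+ 2 * (f z - fs z) ^+ 2 by rewrite mulr_ge0 ?sqr_ge0.
have -> : c * occ z x * g z = c * k by rewrite mulrA.
clearbody k fs; lra.
Qed.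

Definition flow (F : seq (V * V)) (wt : V * V -> R) (th : R) (g : config V -> R) z : R :=
  \sum_(e <- F) th * wt e * (occ z e.1 - occ z e.2) * g z.

Lemma flow_cylinder F wt th g : cylinder_fun g -> cylinder_fun (flow F wt th g).
Proof.
move=> cg; apply: cylinder_sum => e.
apply: (cylinder_op2 (fun a b => a * b)) cg.
apply: (cylinder_op1 (fun a => th * wt e * a)).
by apply: (cylinder_op2 (fun a b => a - b)); exact: occ_cylinder.
Qed.

(** Each gradient is paid by the Dirichlet term of its own edge at the price [4 * (th * wt e) ^+ 2],
    so the form constant is the energy of the weights. The factor [g] must be blind to exchanges
    along the edges used. *)
Lemma flow_LM F wt th g t :
  uniq F -> (forall e, e \in F -> E e.1 e.2) ->
  cylinder_fun g -> (forall z, `|g z| <= 1) ->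
  (forall e z, e \in F -> g (exchange e.1 e.2 z) = g z) -> 0 < t ->
  LM P (fun n => path_sum eta (flow F wt th g) (t / n.+1%:R) n.+1)
    (t * (4 * th ^+ 2 * \sum_(e <- F) wt e ^+ 2)).
Proof.
move=> uF FE cg g1 gF t0.
have cW := flow_cylinder F wt th cg.
have [M [_ WM]] := cylinder_bounded cW.
apply: (feynman_kac_LM Esym nbP nb_uniq nb_size fS gS meta law markov uF FE cW WM) => //.
  apply: mulr_ge0; first by rewrite mulr_ge0 ?sqr_ge0.
  by apply: sumr_ge0 => e _; exact: sqr_ge0.
move=> f qf.
have -> : nu (fun z => flow F wt th g z * f z ^+ 2) =
   \sum_(e <- F) nu (fun z => th * wt e * (occ z e.1 - occ z e.2) * g z * f z ^+ 2).
  rewrite -(nu_sum P mz); last first.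
    move=> e; apply: quasilocal_mul; last exact: qsq.
    apply: quasilocal_mul; last exact: qc.
    by apply: quasilocal_scale; apply: qsub; apply: qc; exact: occ_cylinder.
  by apply: nu_ext => z; rewrite /flow mulr_suml.
rewrite mulr_sumr mulr_suml /dirichlet mulr_sumr -big_split /=.
rewrite big_seq [leRHS]big_seq; apply: ler_sum => e eF.
apply: le_trans (gradient_form _ cg g1 (fun z => gF e z eF) qf) _.
by rewrite lerD2l; rewrite exprMn !mulrA.
Qed.

(** Centring cancels the first-order term, and the variance [p * (1 - p)] is at most 1. *)
Lemma bernoulli_exp_le (a : R) : `|a| <= 4^-1 ->
  p * expR (a * (1 - p)) + (1 - p) * expR (a * (0 - p)) <= expR (a ^+ 2).
Proof.
move=> a4.
have s1 : `|a * (1 - p)| <= 4^-1.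
  rewrite normrM (le_trans _ a4) // ler_piMr // ger0_norm ?subr_ge0 ?(ltW p1) //.
  by rewrite lerBlDr lerDl ltW.
have s2 : `|a * (0 - p)| <= 4^-1.
  by rewrite normrM (le_trans _ a4) // ler_piMr // sub0r normrN gtr0_norm // ltW.
have h1 := expR_le_quadratic s1; have h2 := expR_le_quadratic s2.
apply: le_trans (expR_ge1Dx _).
have k1 : p * expR (a * (1 - p)) <= p * (1 + a * (1 - p) + (a * (1 - p)) ^+ 2).
  by rewrite ler_pM2l.
have k2 : (1 - p) * expR (a * (0 - p)) <=
    (1 - p) * (1 + a * (0 - p) + (a * (0 - p)) ^+ 2).
  by rewrite ler_pM2l // subr_gt0.
apply: le_trans (lerD k1 k2) _.
have -> : p * (1 + a * (1 - p) + (a * (1 - p)) ^+ 2) +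
    (1 - p) * (1 + a * (0 - p) + (a * (0 - p)) ^+ 2) = 1 + a ^+ 2 * (p * (1 - p)).
  by ring.
rewrite lerD2l ler_piMr ?sqr_ge0 //.
have := mulr_ge0 (ltW p0) (ltW p0); have := ltW p1; lra.
Qed.

Definition linear_stat (A : seq V) (h : V -> R) z : R :=
  \sum_(x <- A) h x * (occ z x - p).

Lemma linear_stat_cylinder A h : cylinder_fun (linear_stat A h).
Proof.
apply: cylinder_sum => x; apply: (cylinder_op1 (fun a => h x * (a - p))).
exact: occ_cylinder.
Qed.

Let E_stat s f : 0 <= s -> quasilocal f -> Ex P (fun w => f (eta s w)) = nu f.
Proof. exact: (stationary Esym nbP nb_uniq nb_size fS gS meta law markov). Qed.

Lemma linear_stat_exp s A h : 0 <= s -> uniq A -> (forall x, x \in A -> `|h x| <= 4^-1) ->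
  Ex P (fun w => expR (linear_stat A h (eta s w))) <= expR (\sum_(x <- A) h x ^+ 2).
Proof.
move=> s0 uA h4.
have ce : cylinder_fun (fun z => expR (linear_stat A h z)).
  exact: (cylinder_op1 (fun a => expR a)) (linear_stat_cylinder A h).
rewrite (@E_stat s (fun z => expR (linear_stat A h z)) s0 (qc ce)) /mean.
have -> : (fun w => expR (linear_stat A h (eta 0 w))) =
    (fun w => \prod_(x <- A) expR (h x * ((eta 0 w x)%:R - p))).
  by apply/funext => w; rewrite /linear_stat expR_sum.
rewrite (law_prod mz law (fun x (b : bool) => expR (h x * (b%:R - p)))) // expR_sum.
rewrite big_seq [leRHS]big_seq; apply: ler_prod => x xA.
rewrite bernoulli_exp_le ?h4 // andbT.
by rewrite addr_ge0 // mulr_ge0 ?expR_ge0 ?subr_ge0 // ltW.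
Qed.

(** Convexity moves the time average outside the exponential, and stationarity makes all its terms
    equal. This ignores cancellation in time, so it is used only for observables that are already
    tiny. *)
Lemma path_sum_static (W : config V -> R) (t B : R) n : 0 < t -> cylinder_fun W ->
  nu (fun z => expR (t * W z)) <= expR B ->
  Ex P (fun w => expR (path_sum eta W (t / n.+1%:R) n.+1 w)) <= expR B.
Proof.
move=> t0 cW hB; have n0 : 0 < n.+1%:R :> R by rewrite ltr0n.
set ep := t / n.+1%:R; have ep0 : 0 <= ep by rewrite divr_ge0 // ltW.
have ce : cylinder_fun (fun z => expR (t * W z)).
  exact: (cylinder_op1 (fun a => expR (t * a))).
have be k : bmeas (fun w => expR (t * W (eta (k.+1%:R * ep) w))).
  apply: (bmeas_eta meta (f := fun z => expR (t * W z))); last exact: qc.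
  by rewrite mulr_ge0.
apply: le_trans (_ : Ex P (fun w => \sum_(k < n.+1)
    n.+1%:R^-1 * expR (t * W (eta (k.+1%:R * ep) w))) <= _).
  apply: Ex_le.
  - by apply: bmeas_exp; apply: (adapted_bmeas meta (path_sum_adapted eta n.+1 ep0 cW)).
  - by apply: bmeas_sum => k; apply: bmeas_scale.
  move=> w; rewrite /path_sum.
  have -> : ep * \sum_(k < n.+1) W (eta (k.+1%:R * ep) w) =
      \sum_(k < n.+1) n.+1%:R^-1 * (t * W (eta (k.+1%:R * ep) w)).
    by rewrite mulr_sumr; apply: eq_bigr => k _; rewrite /ep; ring.
  apply: (@expR_convex_sum R _ _ (fun=> n.+1%:R^-1)) => [_|]; first by rewrite invr_ge0.
  by rewrite sumr_const card_ord -[LHS]mulr_natr mulVf // gt_eqF.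
rewrite Ex_sum; last by move=> k; apply: bmeas_scale.
apply: le_trans (_ : \sum_(k < n.+1) n.+1%:R^-1 * expR B <= _).
  apply: ler_sum => k _; rewrite Ex_scale //; apply: ler_wpM2l; first by rewrite invr_ge0.
  rewrite (@E_stat _ (fun z => expR (t * W z))) //; last exact: qc.
  by rewrite mulr_ge0.
by rewrite sumr_const card_ord -[leLHS]mulr_natl mulrA mulfV ?mul1r // gt_eqF.
Qed.

Lemma path_static_LM (W : config V -> R) (t B : R) : 0 < t -> cylinder_fun W ->
  nu (fun z => expR (t * W z)) <= expR B ->
  LM P (fun n => path_sum eta W (t / n.+1%:R) n.+1) B.
Proof.
move=> t0 cW hB; split => [n|e e0].
  apply: (adapted_bmeas meta (path_sum_adapted eta n.+1 _ cW)).
  by rewrite divr_ge0 // ltW.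
exists 0%N => n _; apply: le_trans (path_sum_static n t0 cW hB) _.
by rewrite ler_expR lerDl ltW.
Qed.

Lemma path_sum_lin (W1 W2 : config V -> R) (a b ep : R) n w :
  path_sum eta (fun z => a * W1 z + b * W2 z) ep n w =
  a * path_sum eta W1 ep n w + b * path_sum eta W2 ep n w.
Proof.
by rewrite /path_sum big_split /= -!mulr_sumr; ring.
Qed.

Lemma path_sum_sum (I : Type) (s : seq I) (c : I -> R) (W : I -> config V -> R) ep n w :
  path_sum eta (fun z => \sum_(i <- s) c i * W i z) ep n w =
  \sum_(i <- s) c i * path_sum eta (W i) ep n w.
Proof.
rewrite /path_sum exchange_big /= mulr_sumr; apply: eq_bigr => i _.
by rewrite -mulr_sumr mulrCA.
Qed.

(** * Unit flow from an edge to infinity *)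

Section Branch.
Variables (o v : V).
Hypothesis Eov : E o v.

Let I := [:: (o, v)].
Let lev j := level nb I j.
Let D : R := d%:R.
Let dep := @depth V E Econn o.

Let I_root e : e \in I -> e.1 = o /\ E o e.2.
Proof. by rewrite inE => /eqP ->. Qed.

Let levP j e : e \in lev j ->
  [/\ E e.1 e.2, dep e.2 = j.+1 & @parent V E Econn o e.2 = e.1].
Proof. exact: (level_spec Esym Eirr Econn Eacyc nbP I_root). Qed.

Let D0 : 0 < D. Proof. by rewrite ltr0n (leq_trans _ d2). Qed.

Let lev_size j : (size (lev j))%:R = D ^+ j :> R.
Proof.
by rewrite (level_size Esym Eirr Econn Eacyc nbP nb_uniq nb_size I_root) mul1n natrX.
Qed.

Let branch_step (h : V -> R) j :
  \sum_(e <- lev j.+1) h e.1 = D * \sum_(e <- lev j) h e.2.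
Proof.
rewrite /lev /= big_flatten /= big_map mulr_sumr big_seq [RHS]big_seq.
apply: eq_bigr => e /levP[Ee _ _].
transitivity (\sum_(c <- children nb e) h e.2); first by rewrite /children !big_map.
rewrite big_const_seq count_predT iter_addr_0.
by rewrite (size_children Esym nbP nb_uniq nb_size Ee) -mulr_natl.
Qed.

Let iota1S N : iota 1 N.+1 = iota 1 N ++ [:: N.+1].
Proof. by have := iotaD 1 N 1; rewrite addn1 add1n. Qed.

(** A unit flow entering at [v] and splitting evenly puts [D ^- j] on each of the [D ^+ j] edges of
    level [j]. It expresses [h v] by gradients of [h] and the average of [h] over the far end. *)
Let branch_telescope (h : V -> R) N :
  h v = \sum_(j <- iota 1 N) \sum_(e <- lev j) (D ^+ j)^-1 * (h e.1 - h e.2) +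
    \sum_(e <- lev N) (D ^+ N)^-1 * h e.2.
Proof.
elim: N => [|N IH].
  by rewrite big_nil add0r /lev /= big_seq1 expr0 invr1 mul1r.
rewrite {}IH iota1S big_cat big_seq1 -addrA; congr (_ + _).
under [X in _ = X + _]eq_bigr do rewrite mulrBr.
rewrite sumrB subrK -mulr_sumr -mulr_sumr branch_step mulrA; congr (_ * _).
by rewrite exprS; field; rewrite expf_neq0 // gt_eqF.
Qed.

(** Level 0, the edge from [o] to [v] itself, is left out: no edge of the flow touches [o], so
    functions of the occupation of [o] are invariant under all the exchanges. *)
Definition branch N : seq (V * V) := flatten [seq level nb [:: (o, v)] j | j <- iota 1 N].

(** The head of an edge of level [j] has depth [j.+1], whence the predecessor. *)
Let wt (e : V * V) : R := (D ^+ (dep e.2).-1)^-1.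

Let branch_uniq N : uniq (branch N).
Proof.
have : uniq (flatten [seq level nb [:: (o, v)] j | j <- iota 0 N.+1]).
  by apply: (levels_uniq Esym Eirr Econn Eacyc nbP nb_uniq I_root).
by move=> /= /andP[].
Qed.

Let branchP N e : e \in branch N -> [/\ E e.1 e.2, e.1 != o & e.2 != o].
Proof.
move=> /flattenP[s /mapP[j]]; rewrite mem_iota => /andP[j0 _] -> ej.
have [Ee de pe] := levP ej.
have do0 : dep o = 0%N by exact: (depth0 Esym Econn Eacyc).
have e2o : e.2 != o by apply/eqP => eo; rewrite eo do0 in de.
split => //.
have [_] := parent_adj Esym Econn Eacyc e2o.
rewrite -/dep de pe => -[ej1]; apply/eqP => eo.
by move: j0; rewrite ej1 eo -/(dep o) do0.
Qed.

Let branch_sum (N : nat) (f : nat -> V * V -> R) :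
  \sum_(e <- branch N) f (dep e.2).-1 e = \sum_(j <- iota 1 N) \sum_(e <- lev j) f j e.
Proof.
rewrite /branch big_flatten /= big_map; apply: eq_bigr => j _.
by rewrite big_seq [RHS]big_seq; apply: eq_bigr => e /levP[_ -> _].
Qed.

(** Level [j] contributes [D ^+ j] edges of squared weight [D ^- (2 * j)]; a flow of finite energy
    is what transience provides. *)
Let branch_energy N : \sum_(e <- branch N) wt e ^+ 2 <= 1.
Proof.
rewrite (branch_sum N (fun j _ => (D ^+ j)^-1 ^+ 2)).
have -> : \sum_(j <- iota 1 N) \sum_(e <- lev j) (D ^+ j)^-1 ^+ 2 =
   \sum_(j <- iota 1 N) (D ^+ j)^-1.
  apply: eq_bigr => j _; rewrite big_const_seq count_predT iter_addr_0 -mulr_natl lev_size.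
  by field; rewrite expf_neq0 // gt_eqF.
suff : \sum_(j <- iota 1 N) (D ^+ j)^-1 <= 1 - (2 ^+ N)^-1.
  by move=> h; apply: le_trans h _; rewrite lerBlDr lerDl invr_ge0 exprn_ge0.
elim: N => [|N IH]; first by rewrite big_nil expr0 invr1 subrr.
rewrite iota1S big_cat big_seq1 /=.
have h1 : (D ^+ N.+1)^-1 <= (2 ^+ N.+1)^-1.
  by rewrite lef_pV2 ?posrE ?exprn_gt0 // lerXn2r ?nnegrE ?(ltW D0) // ler_nat.
have h2 : (2 ^+ N)^-1 = 2 * (2 ^+ N.+1)^-1 :> R.
  by rewrite exprS invfM mulrA divff ?mul1r.
lra.
Qed.

(** Half of the convex weight goes to the flow, whose energy is at most 1, and half to the average
    at the far end, which has a static moment bound. Doubling the strength accordingly gives the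
    constants 8 and 1. *)
Lemma occ_superexp (g : bool -> R) (th t : R) : (forall b, `|g b| <= 1) -> 0 < t ->
  LM P (fun n => path_sum eta (fun z => th * (occ z v - p) * g (z o)) (t / n.+1%:R) n.+1)
    (8 * th ^+ 2 * t + 1).
Proof.
move=> g1 t0.
have cg : cylinder_fun (fun z : config V => g (z o)) by exact: cylinder_coord.
pose c := 2 * th * t.
(* The length of the branch depends on [th] and [t]: the first condition makes every coefficient
   admissible in [linear_stat_exp], the second bounds the sum of the [D ^+ N] squared
   coefficients. *)
have [N hN4 hN1] : exists2 N, `|c| / D ^+ N <= 4^-1 & c ^+ 2 / D ^+ N <= 1.
  have q0 : 0 < 4^-1 :> R by rewrite invr_gt0.
  have [N1 h1] := archi_step (normr_ge0 c) q0.
  have [N2 h2] := archi_step (sqr_ge0 c) ltr01.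
  pose N := maxn N1 N2; have DN : N.+1%:R <= D ^+ N.+1.
    apply: le_trans (_ : 2 ^+ N.+1 <= _); first by rewrite -natrX ler_nat ltnW // ltn_expl.
    by rewrite lerXn2r ?nnegrE ?(ltW D0) // ler_nat.
  have N0 : 0 < N.+1%:R :> R by rewrite ltr0n.
  exists N.+1.
    apply: le_trans (h1 N (leq_maxl _ _)); rewrite ler_wpM2l // lef_pV2 ?posrE //.
    exact: exprn_gt0.
  apply: le_trans (h2 N (leq_maxr _ _)); rewrite ler_wpM2l ?sqr_ge0 // lef_pV2 ?posrE //.
  exact: exprn_gt0.
pose A := map snd (lev N).
pose bd z := 2 * th * linear_stat A (fun=> (D ^+ N)^-1) z * g (z o).
have split_form z : th * (occ z v - p) * g (z o) =
    (1 - 2^-1) * flow (branch N) wt (2 * th) (fun z => g (z o)) z + 2^-1 * bd z.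
  rewrite (branch_telescope (fun x => occ z x - p) N) /bd /linear_stat big_map.
  rewrite /flow (branch_sum N (fun j e => 2 * th * (D ^+ j)^-1 * (occ z e.1 - occ z e.2) * g (z o))).
  have -> : \sum_(j <- iota 1 N) \sum_(e <- lev j)
      2 * th * (D ^+ j)^-1 * (occ z e.1 - occ z e.2) * g (z o) =
    2 * th * (\sum_(j <- iota 1 N) \sum_(e <- lev j)
      (D ^+ j)^-1 * (occ z e.1 - p - (occ z e.2 - p))) * g (z o).
    rewrite mulr_sumr mulr_suml; apply: eq_bigr => j _.
    rewrite mulr_sumr mulr_suml; apply: eq_bigr => e _; ring.
  by field.
have cbd : cylinder_fun bd.
  apply: (cylinder_op2 (fun a b => 2 * th * a * b)) => //.
  exact: linear_stat_cylinder.
have bd_LM : LM P (fun n => path_sum eta bd (t / n.+1%:R) n.+1) 2.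
  apply: path_static_LM => //.
  have uA : uniq A by apply: (level_uniq2 Esym Eirr Econn Eacyc nbP nb_uniq I_root).
  pose h s (x : V) : R := s * (c / D ^+ N).
  have h4 (s : R) : `|s| = 1 -> forall x, `|h s x| <= 4^-1.
    by move=> s1 x; rewrite /h normrM s1 mul1r normrM [`|_^-1|]ger0_norm // invr_ge0 exprn_ge0 // ltW.
  have hs (s : R) : `|s| = 1 -> \sum_(x <- A) h s x ^+ 2 <= 1.
    move=> s1; rewrite /h big_const_seq count_predT iter_addr_0 -mulr_natl size_map lev_size.
    apply: le_trans hN1; rewrite le_eqVlt; apply/orP; left; apply/eqP.
    rewrite exprMn -[s ^+ 2]real_normK ?num_real // s1 expr1n mul1r.
    by field; rewrite expf_neq0 // gt_eqF.
  have st (s : R) : `|s| = 1 -> nu (fun z => expR (linear_stat A (h s) z)) <= expR 1.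
    move=> s1; have := @linear_stat_exp 0 A (h s) (lexx _) uA (fun x _ => h4 s s1 x).
    by move=> H; apply: le_trans H _; rewrite ler_expR; exact: hs.
  have n1 : `|1 : R| = 1 by rewrite normr1.
  have n2 : `|-1 : R| = 1 by rewrite normrN1.
  have ce s : quasilocal (fun z => expR (linear_stat A (h s) z)).
    by apply: qc; exact: (cylinder_op1 (fun a => expR a)) (linear_stat_cylinder A (h s)).
  (* Since [g] has values between -1 and 1, the exponential is at most the sum of those with factors
     1 and -1, which removes [g]. Each has mean at most [expR 1], and [2 * expR 1] is at most
     [expR 2]. *)
  apply: le_trans (_ : nu (fun z => expR (linear_stat A (h 1) z) +
      expR (linear_stat A (h (-1)) z)) <= _).
    apply: (nu_le P mz).
    - by apply: qc; exact: (cylinder_op1 (fun a => expR (t * a))).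
    - by apply: quasilocal_add; exact: ce.
    move=> z.
    have lE s : linear_stat A (h s) z = s * (t * (2 * th * linear_stat A (fun=> (D ^+ N)^-1) z)).
      rewrite /linear_stat !mulr_sumr; apply: eq_bigr => x _; rewrite /h /c; ring.
    rewrite !lE mul1r mulN1r /bd mulrA.
    set y := t * _; have := g1 (z o); rewrite ler_norml => /andP[ga gb].
    have [y0|y0] := leP 0 y.
      apply: le_trans (_ : expR y <= _); last by rewrite lerDl expR_ge0.
      by rewrite ler_expR ler_piMr.
    apply: le_trans (_ : expR (- y) <= _); last by rewrite lerDr expR_ge0.
    rewrite ler_expR -[leRHS]mulrN1 ler_wnM2l ?(ltW y0) //.
  rewrite (nu_add P mz) //.
  have e2 : 2 <= expR 1 :> R by apply: le_trans (expR_ge1Dx 1).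
  have -> : expR 2 = expR 1 * expR 1 :> R by rewrite -expRD.
  have := st _ n1; have := st _ n2; have := expR_gt0 (1 : R).
  have : 2 * expR 1 <= expR 1 * expR 1 :> R by rewrite ler_pM2r ?expR_gt0.
  lra.
have fl_LM : LM P (fun n => path_sum eta (flow (branch N) wt (2 * th) (fun z => g (z o)))
    (t / n.+1%:R) n.+1) (t * (4 * (2 * th) ^+ 2 * \sum_(e <- branch N) wt e ^+ 2)).
  apply: flow_LM => //.
  - by move=> e /branchP[].
  - move=> e z /branchP[_ e1 e2]; congr g.
    by rewrite /exchange eq_sym (negbTE e1) eq_sym (negbTE e2).
have half01 : 0 <= (2^-1 : R) <= 1 by apply/andP; split; lra.
have := LM_convex2 half01 fl_LM bd_LM.
move=> /LM_le H; apply: LM_ext (H _ _) => [n w|].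
  by rewrite -path_sum_lin; congr path_sum; apply/funext => z; rewrite split_form.
have := branch_energy N; set s := \sum_(e <- _) _ => s1.
have : t * th ^+ 2 * s <= t * th ^+ 2 by rewrite ler_piMr // mulr_ge0 ?sqr_ge0 // ltW.
lra.
Qed.

End Branch.

Definition disagreement x y z : R := (occ z x - occ z y) ^+ 2 - 2 * (p * (1 - p)).

Lemma disagreement_cylinder x y : cylinder_fun (disagreement x y).
Proof.
apply: (cylinder_op2 (fun a b => (a - b) ^+ 2 - 2 * (p * (1 - p)))); exact: occ_cylinder.
Qed.

(** With X, Y the occupations of [x] and [y], the centred square is (X - p)(1 - 2Y) + (Y - p)(1 -
    2p). The first term uses the branch behind [x], which avoids [y], and the second the branch
    behind [y]. *)
Lemma disagreement_superexp x y (th t : R) : E x y -> 0 < t ->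
  LM P (fun n => path_sum eta (fun z => th * disagreement x y z) (t / n.+1%:R) n.+1)
    (32 * th ^+ 2 * t + 1).
Proof.
move=> Exy t0; have Eyx : E y x by rewrite Esym.
pose g1 (b : bool) : R := 1 - 2 * b%:R.
pose g2 (_ : bool) : R := 1 - 2 * p.
have hg1 b : `|g1 b| <= 1.
  by rewrite ler_norml /g1; case: b => /=; apply/andP; split; lra.
have hg2 b : `|g2 b| <= 1.
  by rewrite ler_norml /g2; have := p0; have := p1 => ? ?; apply/andP; split; lra.
have h1 := occ_superexp Eyx (2 * th) hg1 t0.
have h2 := occ_superexp Exy (2 * th) hg2 t0.
have half01 : 0 <= (2^-1 : R) <= 1 by apply/andP; split; lra.
have := LM_convex2 half01 h1 h2.
move=> /LM_le H; apply: LM_ext (H _ _) => [n w|]; last lra.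
rewrite -path_sum_lin; congr path_sum; apply/funext => z.
rewrite /g1 /g2 /disagreement /occ.
by case: (z x); case: (z y) => /=; field.
Qed.

(** Convex combination with weights [wt e / s], each edge run at strength [th * s]: the cost depends
    on the total weight and not on the number of edges. *)
Lemma weighted_disagreement_superexp (F : seq (V * V)) (wt : V * V -> R) (th t K : R) :
  (forall e, e \in F -> E e.1 e.2) -> (forall e, 0 <= wt e) ->
  \sum_(e <- F) wt e <= K -> 0 < t ->
  LM P (fun n => path_sum eta (fun z => th * \sum_(e <- F) wt e * disagreement e.1 e.2 z)
     (t / n.+1%:R) n.+1) (32 * (th * K) ^+ 2 * t + 1).
Proof.
move=> FE w0 wK t0; set s := \sum_(e <- F) wt e in wK.
have s0 : 0 <= s by apply: sumr_ge0.
have B0 : 0 <= 32 * (th * K) ^+ 2 * t + 1.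
  have : 0 <= (th * K) ^+ 2 * t by rewrite mulr_ge0 ?sqr_ge0 // ltW.
  lra.
have [sz|snz] := eqVneq s 0.
  have z0 e : e \in F -> wt e = 0.
    move=> eF; apply/eqP; rewrite -[_ == 0](_ : (wt e <= 0) = _); last first.
      by rewrite eq_le w0 andbT.
    by rewrite -sz /s (big_rem e) //= lerDl sumr_ge0.
  apply: LM_ext (LM_le B0 (LM_cst P 0)) => n w.
  rewrite /path_sum big1 ?mulr0 // => k _.
  by rewrite big_seq big1 ?mulr0 // => e eF; rewrite z0 // mul0r.
have s1 : 0 < s by rewrite lt_neqAle eq_sym snz.
have Hc := @LM_convex R _ _ P _ F (fun e => wt e / s)
  (fun e n => path_sum eta (fun z => th * s * disagreement e.1 e.2 z) (t / n.+1%:R) n.+1)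
  (fun=> 32 * (th * s) ^+ 2 * t + 1).
have {Hc} : LM P (fun n om => \sum_(e <- F) wt e / s *
   path_sum eta (fun z => th * s * disagreement e.1 e.2 z) (t / n.+1%:R) n.+1 om)
   (\sum_(e <- F) wt e / s * (32 * (th * s) ^+ 2 * t + 1)).
  apply: Hc => [e||e n|e eF].
  - by rewrite divr_ge0.
  - by rewrite -mulr_suml divff.
  - apply: (adapted_bmeas meta (path_sum_adapted eta n.+1 _ _)).
      by rewrite divr_ge0 // ltW.
    exact: (cylinder_op1 (fun a => th * s * a)) (disagreement_cylinder e.1 e.2).
  - by apply: disagreement_superexp => //; exact: FE.
rewrite -mulr_suml -mulr_suml divff // mul1r => /LM_le H.
apply: LM_ext (H _ _) => [n w|].
  rewrite -path_sum_sum; congr path_sum; apply/funext => z.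
  by rewrite mulr_sumr; apply: eq_bigr => e _; field.
have ss : s ^+ 2 <= K ^+ 2 by rewrite lerXn2r ?nnegrE // (le_trans s0 wK).
have : th ^+ 2 * t * s ^+ 2 <= th ^+ 2 * t * K ^+ 2.
  by rewrite ler_wpM2l // mulr_ge0 ?sqr_ge0 // ltW.
rewrite !exprMn; lra.
Qed.

End Flow.

Section LimitLM.
Context (R : realType) (dsp : measure_display) (Omega : measurableType dsp).
Variable P : probability Omega R.
Implicit Types (X : nat -> Omega -> R) (B r : R).

Lemma LM_lim_le X B r : LM P X B ->
  Ex P (fun w => expR (X n w)) @[n --> \oo] --> r -> r <= expR B.
Proof.
move=> [_ hX] Xr; rewrite leNgt; apply/negP => rB.
have r0 : 0 < r := lt_trans (expR_gt0 _) rB.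
have Br : B < ln r by rewrite -ltr_expR lnK ?posrE.
have e0 : 0 < (ln r - B) / 2 by rewrite divr_gt0 // subr_gt0.
have [N hN] := hX _ e0.
have : r <= expR (B + (ln r - B) / 2).
  by apply: (cvgr_to_le Xr); exists N => // n /= Nn; exact: hN.
by rewrite -{1}[r]lnK ?posrE // ler_expR => h; lra.
Qed.

Lemma LM_cvg X r : (forall n, bmeas (X n)) -> 0 < r ->
  Ex P (fun w => expR (X n w)) @[n --> \oo] --> r -> LM P X (ln r).
Proof.
move=> bX r0 Xr; split => // e e0.
have rr : r < expR (ln r + e) by rewrite -{1}[r]lnK ?posrE // ltr_expR ltrDl.
have [N _ hN] := cvgr_lt _ Xr _ rr.
by exists N => n Nn; apply: ltW; exact: hN.
Qed.

End LimitLM.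

(** * Right Riemann sums of right-continuous functions *)

Section RightRiemann.
Context (R : realType).
Variables (g : R -> R) (M t : R).
Hypothesis t0 : 0 < t.
Hypothesis rc : forall s, 0 <= s -> g u @[u --> s^'+] --> g s.
Hypothesis gM : forall s, `|g s| <= M.

Let ep n : R := t / n.+1%:R.
(** Open on the left and closed on the right, so the step function takes at [s] the value at the
    next grid point from [s] on; right-continuity is then enough for pointwise convergence. *)
Let cell n (k : nat) : set R := `]k%:R * ep n, k.+1%:R * ep n]%classic.
Let g_ n (s : R) : R := \sum_(k < n.+1) g (k.+1%:R * ep n) * \1_(cell n k) s.

Let ep0 n : 0 < ep n. Proof. by rewrite divr_gt0. Qed.

Let cell_disj n (j k : nat) s : cell n j s -> cell n k s -> j = k.
Proof.
rewrite /cell /= !in_itv /= => /andP[j1 j2] /andP[k1 k2].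
have a1 : (k < j.+1)%N.
  by rewrite -(ltr_nat R) -(ltr_pM2r (ep0 n)) (lt_le_trans k1).
have a2 : (j < k.+1)%N.
  by rewrite -(ltr_nat R) -(ltr_pM2r (ep0 n)) (lt_le_trans j1).
by apply/eqP; rewrite eqn_leq -ltnS a2 -ltnS a1.
Qed.

Let cell_ex n s : 0 < s <= t -> exists k : 'I_n.+1, cell n k s.
Proof.
move=> /andP[s0 st].
have nt : n.+1%:R * ep n = t by rewrite mulrCA divff ?mulr1 // gt_eqF.
have : exists k, s <= k.+1%:R * ep n by exists n; rewrite nt.
move/ex_minnP => [k hk kmin].
have kn : (k < n.+1)%N by rewrite ltnS; apply: kmin; rewrite nt.
exists (Ordinal kn); rewrite /cell /= in_itv /= hk andbT.
case: k hk kmin kn => [|k] hk kmin kn; first by rewrite mul0r.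
by rewrite ltNge; apply/negP => /kmin; rewrite ltnn.
Qed.

Let g_E n (k : 'I_n.+1) s : cell n k s -> g_ n s = g (k.+1%:R * ep n).
Proof.
move=> ks; rewrite /g_ (bigD1 k) //= indicE mem_set // mulr1 big1 ?addr0 //.
move=> j jk; rewrite indicE memNset ?mulr0 // => js.
by move: jk; rewrite -val_eqE /= (cell_disj js ks) eqxx.
Qed.

Let mcell n k : measurable (cell n k). Proof. exact: measurable_itv. Qed.

Let mg_ n : measurable_fun [set: R] (g_ n).
Proof.
rewrite /g_; elim: (index_enum _) => [|k r IH].
  by under [X in measurable_fun _ X]eq_fun do rewrite big_nil; exact: measurable_cst.
under [X in measurable_fun _ X]eq_fun do rewrite big_cons.
apply: measurable_funD => //; apply: measurable_funM; first exact: measurable_cst.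
(apply: measurable_indic; exact: mcell).
Qed.

Let g_cvg s : 0 < s <= t -> g_ n s @[n --> \oo] --> g s.
Proof.
move=> /andP[s0 st]; apply/cvgrPdist_le => e e0.
have /cvgrPdist_le/(_ e e0) := rc (ltW s0).
rewrite /at_right /within /= => /nbhs_ballP[dl /= dl0 hdl].
have near_g u : s <= u -> u < s + dl -> `|g s - g u| <= e.
  rewrite le_eqVlt => /orP[/eqP <- _|su ud].
    by rewrite subrr normr0 ltW.
  apply: hdl => //; rewrite /ball /= distrC ger0_norm; last by rewrite subr_ge0 ltW.
  by rewrite ltrBlDl.
near=> n.
have s0t : 0 < s <= t by rewrite s0.
have [k ks] := cell_ex n s0t.
rewrite (g_E ks); move: ks; rewrite /cell /= in_itv /= => /andP[k1 k2].
apply: near_g => //; rewrite -natr1 mulrDl mul1r ltrD //.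
near: n; exists (Num.bound (t / dl)) => // n /= Nn.
rewrite /ep ltr_pdivrMr // mulrC -ltr_pdivrMr //.
apply: lt_le_trans (archi_boundP _) _; first by rewrite divr_ge0 // ltW.
by rewrite ler_nat (leq_trans Nn).
Unshelve. all: by end_near.
Qed.

Let g_bound n s : `|g_ n s| <= M.
Proof.
have M0 : 0 <= M := le_trans (normr_ge0 _) (gM 0).
have [[k ks]|nk] := pselect (exists k : 'I_n.+1, cell n k s).
  by rewrite (g_E ks).
rewrite /g_ big1 ?normr0 // => k _; rewrite indicE memNset ?mulr0 // => ks.
by apply: nk; exists k.
Qed.

Local Notation mu := (@lebesgue_measure R).
Let D : set R := `]0, t]%classic.

Let mD : measurable D. Proof. exact: measurable_itv. Qed.

Let muD : (mu D < +oo)%E.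
Proof. by rewrite /D lebesgue_measure_itv /= lte_fin t0 -EFinB ltry. Qed.

Let bint (f : R -> R) : measurable_fun D f -> (forall s, `|f s| <= M) ->
  mu.-integrable D (EFin \o f).
Proof.
move=> mf fM; apply: measurable_bounded_integrable => //.
by exists M; split; [rewrite num_real|move=> y My s _; exact: le_trans (fM s) (ltW My)].
Qed.

Let int_cell n k : (k < n.+1)%N -> \int[mu]_(s in D) (\1_(cell n k) s) = ep n.
Proof.
move=> kn; rewrite /Rintegral integral_indic //; last exact: mcell.
have nt : n.+1%:R * ep n = t by rewrite mulrCA divff ?mulr1 // gt_eqF.
have -> : cell n k `&` D = cell n k.
  apply/setIidPl => s; rewrite /cell /D /= !in_itv /= => /andP[k1 k2]; apply/andP; split.
    by apply: le_lt_trans k1; rewrite mulr_ge0 // ltW.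
  by apply: le_trans k2 _; rewrite -nt ler_pM2r // ler_nat.
suff muE : mu (cell n k) = (ep n)%:E by exact: (congr1 fine muE).
rewrite /cell lebesgue_measure_itv /= lte_fin ltr_pM2r // ltr_nat ltnSn.
by rewrite -EFinB -natr1 mulrDl mul1r addrC addKr.
Qed.

Let int_g_ n : \int[mu]_(s in D) g_ n s = ep n * \sum_(k < n.+1) g (k.+1%:R * ep n).
Proof.
have icell (k : 'I_n.+1) : mu.-integrable D (EFin \o (\1_(cell n k) : R -> R)).
  apply: measurable_bounded_integrable => //; first (apply: measurable_indic; exact: mcell).
  exists 1; split; [by rewrite num_real|move=> y My s _].
  by rewrite /= indicE; case: (_ \in _); rewrite ?normr1 ?normr0 ltW // (lt_trans ltr01).
have H (r : seq 'I_n.+1) :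
    mu.-integrable D (EFin \o (fun s => \sum_(k <- r) g (k.+1%:R * ep n) * \1_(cell n k) s)) /\
    \int[mu]_(s in D) (\sum_(k <- r) g (k.+1%:R * ep n) * \1_(cell n k) s) =
    ep n * \sum_(k <- r) g (k.+1%:R * ep n).
  elim: r => [|k r [IH1 IH2]].
    rewrite big_nil mulr0; under eq_fun do rewrite big_nil; split.
      exact: integrable0.
    by rewrite Rintegral_cst // mul0r.
  have ik : mu.-integrable D (EFin \o (fun s => g (k.+1%:R * ep n) * \1_(cell n k) s)).
    apply: bint => [|s].
      apply: measurable_funM; first exact: measurable_cst.
      by apply: measurable_indic; exact: mcell.
    rewrite normrM indicE; case: (_ \in _); rewrite ?normr1 ?normr0 ?mulr1 ?mulr0 //.
    exact: le_trans (normr_ge0 _) (gM 0).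
  rewrite (_ : (fun s => \sum_(k <- k :: r) _) = (fun s => g (k.+1%:R * ep n) * \1_(cell n k) s +
    \sum_(k <- r) g (k.+1%:R * ep n) * \1_(cell n k) s)); last first.
    by apply/funext => s; rewrite big_cons.
  split.
    have ID := @integrableD _ _ _ mu D mD _ _ ik IH1.
    suff add (a b : R -> R) : (EFin \o (fun s => a s + b s)) = ((EFin \o a) \+ (EFin \o b))%E.
      by rewrite add.
    by apply/funext => s.
  rewrite RintegralD // IH2 big_cons mulrDr; congr (_ + _).
  by rewrite RintegralZl // int_cell // mulrC.
by have [_] := H (index_enum _).
Qed.

(** Dominated convergence of the step functions on the half-open interval; the missing point 0 does
    not change the integral. *)
Lemma right_riemann_cvg :
  (t / n.+1%:R * \sum_(k < n.+1) g (k.+1%:R * (t / n.+1%:R))) @[n --> \oo] -->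
  \int[mu]_(s in `[0, t]) g s.
Proof.
have mg : measurable_fun D g.
  apply: (measurable_fun_cvg (h := g_)) => [n|s].
    exact: measurable_funTS.
  by rewrite /D /= in_itv /= => st; exact: g_cvg.
have ig := bint mg gM.
have [|||||_ _ H] := @dominated_convergence _ _ _ mu D mD
  (fun n => EFin \o g_ n) (EFin \o g) (EFin \o cst M).
- by move=> n; apply/measurable_EFinP; exact: (measurable_funTS (mg_ n)).
- exact/measurable_EFinP.
- apply: aeW => s; rewrite /D /= in_itv /= => st.
  by apply: cvg_EFin; [near=> n|exact: g_cvg].
- apply: bint; first exact: measurable_cst.
  by move=> s; rewrite ger0_norm // (le_trans (normr_ge0 _) (gM 0)).
- by apply: aeW => s n _; rewrite /= lee_fin.
rewrite -Rintegral_itv_obnd_cbnd; last exact: ig.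
under eq_fun do rewrite -/(ep _) -int_g_.
apply: fine_cvg; rewrite /Rintegral fineK //.
exact: integrable_fin_num.
Unshelve. all: by end_near.
Qed.

End RightRiemann.

(** * Logarithmic moment generating function of occupation times *)

Section Mgf.
Context (R : realType) (V : choiceType) (E : rel V) (d : nat).
Hypotheses (Esym : symmetric E) (Eirr : irreflexive E).
Hypothesis Econn : forall x y : V, exists s : seq V, path E x s /\ last x s = y.
Hypothesis Eacyc : forall c : seq V, ucycle E c -> (size c <= 2)%N.
Variable nb : V -> seq V.
Hypotheses (nbP : forall x y, (y \in nb x) = E x y)
  (nb_uniq : forall x, uniq (nb x)) (nb_size : forall x, size (nb x) = d.+1).
Hypothesis d2 : (2 <= d)%N.
Variable S : R -> (config V -> R) -> config V -> R.
Hypothesis fS : feller_semigroup S.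
Hypothesis gS : forall f : config V -> R, cylinder_fun f ->
  semigroup_derivative S f (ssep_generator E f).
Context (dsp : measure_display) (Omega : measurableType dsp).
Variables (P : probability Omega R) (p : R) (eta : R -> Omega -> config V).
Hypotheses (p0 : 0 < p) (p1 : p < 1).
Hypothesis meta : forall (t : R) x, 0 <= t -> measurable_fun [set: Omega] (fun w => eta t w x).
Hypothesis law : has_law_nu P p (eta 0).
Hypothesis markov : markov_with_semigroup P eta S.
Implicit Types (f : config V -> R) (z : config V).

Local Notation nu := (mean P (eta 0)).

Variables (m : nat) (x : 'I_m -> V) (c : 'I_m -> R).

Definition source z : R := \sum_i c i * (occ R z (x i) - p).
Definition green_form : R := \sum_j \sum_i c i * c j * green R d Econn (x i) (x j).

Lemma source_cylinder : cylinder_fun source.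
Proof.
apply: cylinder_sum => i; apply: (cylinder_op1 (fun a => c i * (a - p))).
exact: occ_cylinder.
Qed.

Hypothesis cad : forall w, cadlag (fun t => eta t w).

Definition source_integral (t : R) (w : Omega) : R :=
  \sum_i c i * occupation p eta t (x i) w.

Lemma path_sum_source_cvg t w : 0 < t ->
  path_sum eta source (t / n.+1%:R) n.+1 w @[n --> \oo] --> source_integral t w.
Proof.
move=> t0.
have -> : (fun n => path_sum eta source (t / n.+1%:R) n.+1 w) = (fun n => \sum_i c i *
    (t / n.+1%:R * \sum_(k < n.+1) ((eta (k.+1%:R * (t / n.+1%:R)) w (x i))%:R - p))).
  apply/funext => n; rewrite /path_sum /source exchange_big mulr_sumr /=.
  by apply: eq_bigr => i _; rewrite -mulr_sumr mulrCA.
apply: cvg_big => [|i _]; first exact: add_continuous.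
apply: cvgMl_tmp; rewrite /occupation.
pose f z : R := (z (x i))%:R - p.
apply: (@right_riemann_cvg R (fun s => f (eta s w)) 1 t t0) => s.
  move=> s0; have [rc _] := cad w.
  have cf : cylinder_fun f := cylinder_coord (fun b => b%:R - p) (x i).
  apply: (@cvg_comp _ _ _ (fun u => eta u w) f _ _ _ (rc s s0)).
  exact: (cylinder_continuous cf).
rewrite /f ler_norml; have := p0; have := p1.
by case: (eta s w (x i)); rewrite ?mulr1n ?mulr0n => ? ?; apply/andP; split; lra.
Qed.

Let source_bound : exists M, 0 <= M /\ forall z, `|source z| <= M.
Proof. exact: cylinder_bounded source_cylinder. Qed.

Let path_sum_source_bound M t n w : (forall z, `|source z| <= M) -> 0 < t ->
  `|path_sum eta source (t / n.+1%:R) n.+1 w| <= t * M.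
Proof.
move=> hM t0; rewrite /path_sum normrM.
have n0 : 0 < n.+1%:R :> R by rewrite ltr0n.
rewrite ger0_norm; last by rewrite divr_ge0 // ltW.
have -> : t * M = t / n.+1%:R * (n.+1%:R * M) by field; rewrite gt_eqF.
rewrite ler_wpM2l ?divr_ge0 ?(ltW t0) //; apply: le_trans (ler_norm_sum _ _ _) _.
apply: le_trans (_ : \sum_(i < n.+1) M <= _); first by apply: ler_sum.
by rewrite sumr_const card_ord -[leLHS]mulr_natl.
Qed.

Let bmeas_path (F : config V -> R) t n : 0 < t -> cylinder_fun F ->
  bmeas (path_sum eta F (t / n.+1%:R) n.+1).
Proof.
move=> t0 cF; apply: (adapted_bmeas meta (path_sum_adapted eta n.+1 _ cF)).
by rewrite divr_ge0 // ltW.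
Qed.

Lemma bmeas_source_integral t : 0 < t -> bmeas (source_integral t).
Proof.
move=> t0; have [M [M0 hM]] := source_bound.
apply: (@bmeas_lim _ _ _ (fun n => path_sum eta source (t / n.+1%:R) n.+1) _ (t * M)).
- by move=> n; apply: bmeas_path => //; exact: source_cylinder.
- by move=> n w; exact: path_sum_source_bound.
- by move=> w; exact: path_sum_source_cvg.
Qed.

Let Ex_exp_source_cvg lam t : 0 < t ->
  Ex P (fun w => expR (lam * path_sum eta source (t / n.+1%:R) n.+1 w)) @[n --> \oo] -->
  Ex P (fun w => expR (lam * source_integral t w)).
Proof.
move=> t0; have [M [M0 hM]] := source_bound.
apply: (@Ex_dct _ _ _ P (fun n w => expR (lam * path_sum eta source (t / n.+1%:R) n.+1 w))
  _ (expR (`|lam| * (t * M)))) => [n|n w|w].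
- by apply: bmeas_exp; apply: bmeas_scale; apply: bmeas_path => //; exact: source_cylinder.
- rewrite ger0_norm ?expR_ge0 // ler_expR; apply: le_trans (ler_norm _) _.
  by rewrite normrM ler_wpM2l // path_sum_source_bound.
- apply: continuous_cvg; first exact: continuous_expR.
  by apply: cvgMl_tmp; exact: path_sum_source_cvg.
Qed.

(** * Exponential tilt by a truncated potential *)

Section Tilted.
Variables (K dl : R) (A : seq V) (h : V -> R).
Hypothesis (K0 : 0 <= K).
Hypothesis pot : approx_potential d Econn nb x c K dl A h.

Let B := nbhd nb A.
Let uA : uniq A. Proof. by case: pot => [[]]. Qed.
Let uB : uniq B. Proof. exact: nbhd_uniq. Qed.
Let AB : {subset A <= B}. Proof. exact: nbhd_sub. Qed.
Let hA u : h u != 0 -> u \in A. Proof. by case: pot => _ H _ _ _; exact: H. Qed.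
Let hK u : `|h u| <= K. Proof. by case: pot => _ _ [H _] _ _. Qed.
Let xA i : x i \in A. Proof. by case: pot => [[_ H]] _ _ _ _. Qed.

Let res (u : V) : R := lap nb h u + \sum_i c i * (u == x i)%:R.
Let grad (e : V * V) : R := h e.2 - h e.1.
(** Arcs are ordered pairs, so half of this is the Dirichlet energy of [h], close to
    [green_form]. *)
Definition tilt_energy : R := \sum_(e <- arcs E (nbhd nb A)) (h e.2 - h e.1) ^+ 2.

Let lap_arcs (g : V -> R) : (forall u, g u != 0 -> u \in A) ->
  forall u, u \in B -> lap nb g u = \sum_(y <- B | E u y) (g y - g u).
Proof.
move=> gA u uB'; rewrite /lap.
rewrite (bigID (mem B)) /= [X in _ + X]big1_seq ?addr0; last first.
  move=> y /andP[yB ynb].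
  have gy : g y = 0 by apply/eqP; apply: contraNT yB => /gA /AB.
  have gu : g u = 0.
    apply/eqP; apply: contraNT yB => /gA uA'; apply: (nbhd_adj nbP uA').
    by rewrite -nbP.
  by rewrite gy gu subrr.
rewrite -big_filter -[RHS]big_filter; apply: perm_big.
by apply: uniq_perm; rewrite ?filter_uniq // => y; rewrite !mem_filter nbP andbC.
Qed.

Let arcs_by_parts (k : V -> R) :
  2^-1 * \sum_(e <- arcs E B) grad e * (k e.1 - k e.2) = \sum_(u <- B) k u * lap nb h u.
Proof.
have e1 : \sum_(e <- arcs E B) grad e * k e.1 = \sum_(u <- B) k u * lap nb h u.
  rewrite (big_arcs E B (fun u y => (h y - h u) * k u)).
  rewrite big_seq [RHS]big_seq; apply: eq_bigr => u uB'.
  rewrite (lap_arcs hA uB') mulr_sumr; apply: eq_bigr => y _; rewrite mulrC //.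
have e2 : \sum_(e <- arcs E B) grad e * k e.2 = - \sum_(u <- B) k u * lap nb h u.
  rewrite -e1 -sumrN (big_arcs_sym Esym B (fun u y => (h y - h u) * k y)).
  by apply: eq_bigr => e _; rewrite /grad -mulNr opprB.
under eq_bigr do rewrite mulrBr.
by rewrite sumrB e1 e2; lra.
Qed.

Let source_lap z : \sum_(u <- B) (occ R z u - p) * lap nb h u =
  linear_stat p B res z - source z.
Proof.
rewrite /linear_stat /source.
have -> : \sum_i c i * (occ R z (x i) - p) =
    \sum_(u <- B) (occ R z u - p) * \sum_i c i * (u == x i)%:R.
  under [RHS]eq_bigr do rewrite mulr_sumr.
  rewrite exchange_big /=; apply: eq_bigr => i _.
  rewrite (bigD1_seq (x i)) ?AB //= eqxx mulr1n big1 ?addr0; first by ring.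
  by move=> u /negbTE ->; rewrite mulr0n !mulr0.
rewrite -sumrB; apply: eq_bigr => u _; rewrite /res; ring.
Qed.

Let tilt_energyE : 2^-1 * tilt_energy = \sum_i c i * h (x i) - \sum_(u <- B) h u * res u.
Proof.
have -> : 2^-1 * tilt_energy = - (2^-1 * \sum_(e <- arcs E B) grad e * (h e.1 - h e.2)).
  rewrite -mulrN -sumrN; congr (_ * _); apply: eq_bigr => e _; rewrite /grad; ring.
rewrite arcs_by_parts -sumrN.
have -> : \sum_i c i * h (x i) = \sum_(u <- B) h u * \sum_i c i * (u == x i)%:R.
  under [RHS]eq_bigr do rewrite mulr_sumr.
  rewrite exchange_big /=; apply: eq_bigr => i _.
  rewrite (bigD1_seq (x i)) ?AB //= eqxx mulr1n big1 ?addr0; first by ring.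
  by move=> u /negbTE ->; rewrite mulr0n !mulr0.
rewrite -sumrB; apply: eq_bigr => u _; rewrite /res; ring.
Qed.

(** Summation by parts turns half the energy into the values of [h] at the sources, close to those
    of the Green function, minus the pairing of [h] with the residue. *)
Lemma tilt_energy_close (s : R) : 0 < s <= 1 -> dl = s ^+ 2 ->
  `|2^-1 * tilt_energy - green_form| <= (\sum_i `|c i| + K + 1) * s.
Proof.
move=> /andP[s0 s1] dls; rewrite tilt_energyE.
have a1 : `|\sum_i c i * h (x i) - green_form| <= (\sum_i `|c i|) * s.
  rewrite /green_form -sumrB mulr_suml; apply: le_trans (ler_norm_sum _ _ _) _.
  apply: ler_sum => j _.
  have -> : \sum_i c i * c j * green R d Econn (x i) (x j) =
      c j * \sum_i c i * green R d Econn (x i) (x j).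
    by rewrite mulr_sumr; apply: eq_bigr => i _; ring.
  rewrite -mulrBr normrM ler_wpM2l //.
  case: pot => _ _ _ _ /(_ j) H; apply: le_trans H _; rewrite dls expr2.
  by rewrite ler_piMl // ltW.
have a2 : `|\sum_(u <- B) h u * res u| <= (K + 1) * s.
  apply: le_trans (ler_norm_sum _ _ _) _.
  (* AM-GM with weights [s] and [s^-1] balances the bounded energy of [h] against the residue energy
     [s ^+ 2]; both sides become of order [s]. *)
  apply: le_trans (_ : \sum_(u <- B) (s * h u ^+ 2 + s^-1 * res u ^+ 2) <= _).
    apply: ler_sum => u _; rewrite normrM.
    have q : 0 <= (s * `|h u| - `|res u|) ^+ 2 / s by rewrite divr_ge0 ?sqr_ge0 // ltW.
    have q2 : 0 <= `|h u| * `|res u| by rewrite mulr_ge0.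
    have e : (s * `|h u| - `|res u|) ^+ 2 / s =
        s * h u ^+ 2 + s^-1 * res u ^+ 2 - 2 * (`|h u| * `|res u|).
      rewrite -[h u ^+ 2]real_normK ?num_real // -[res u ^+ 2]real_normK ?num_real //.
      by field; rewrite gt_eqF.
    by rewrite e in q; lra.
  rewrite big_split /= -!mulr_sumr.
  case: pot => _ _ [_ H2] H3 _.
  have k1 : s * \sum_(u <- B) h u ^+ 2 <= s * K by rewrite ler_pM2l.
  have k2 : s^-1 * \sum_(u <- B) res u ^+ 2 <= s^-1 * dl by rewrite ler_pM2l // invr_gt0.
  have k3 : s^-1 * dl = s by rewrite dls expr2 mulrA mulVf ?mul1r // gt_eqF.
  lra.
have -> : \sum_i c i * h (x i) - \sum_(u <- B) h u * res u - green_form =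
   (\sum_i c i * h (x i) - green_form) - \sum_(u <- B) h u * res u by ring.
by apply: le_trans (ler_normB _ _) _; lra.
Qed.

Variable l : R.
Hypotheses (l0 : 0 <= l) (lK : l * (2 * K) <= 4^-1).

Definition tilt z : R := l * linear_stat p A h z.

Lemma tilt_cylinder : cylinder_fun tilt.
Proof. exact: (cylinder_op1 (fun a => l * a)) (linear_stat_cylinder p A h). Qed.

Let statAB z : linear_stat p A h z = linear_stat p B h z.
Proof.
rewrite /linear_stat [RHS](bigID (mem A)) /= [X in _ + X]big1 ?addr0; last first.
  by move=> u uA'; have -> : h u = 0; [apply/eqP; apply: contraNT uA' => /hA|rewrite mul0r].
rewrite -[RHS]big_filter; apply: perm_big; apply: uniq_perm; rewrite ?filter_uniq //.
by move=> u; rewrite mem_filter andb_idr // => /AB.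
Qed.

Let tilt_exchange z e : e \in arcs E B ->
  tilt (exchange e.1 e.2 z) - tilt z = l * grad e * (occ R z e.1 - occ R z e.2).
Proof.
rewrite mem_arcs => /and3P[Ee e1B e2B].
have e12 : e.2 != e.1 by apply/eqP => ee; rewrite ee Eirr in Ee.
rewrite /tilt !statAB -mulrBr -mulrA; congr (_ * _).
rewrite /linear_stat -sumrB (bigD1_seq e.1) //= -big_filter.
rewrite (bigD1_seq e.2) /=; last 2 first.
- by rewrite mem_filter e12.
- exact: filter_uniq.
rewrite big1_seq ?addr0.
  by rewrite /occ /exchange eqxx (negbTE e12) eqxx /grad; ring.
move=> u; rewrite mem_filter => /and3P[u2 u1 _].
by rewrite /occ /exchange (negbTE u1) (negbTE u2) subrr.
Qed.

Let drift_form z : ssep_generator E (fun z => expR (tilt z)) z =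
  expR (tilt z) * (2^-1 * \sum_(e <- arcs E B)
     (expR (l * grad e * (occ R z e.1 - occ R z e.2)) - 1)).
Proof.
rewrite (@genE R _ _ Esym _ nbP nb_uniq A B) //; last first.
  move=> z1 z2 zz; congr (expR (l * _)); rewrite /linear_stat big_seq [RHS]big_seq.
  by apply: eq_bigr => u /zz; rewrite /occ => ->.
rewrite /gen mulrCA; congr (_ * _); rewrite mulr_sumr big_seq [RHS]big_seq.
apply: eq_bigr => e eB; rewrite -(tilt_exchange z eB) mulrBr mulr1 -expRD.
by rewrite [tilt z + _]addrC subrK.
Qed.

Let W z : R := \sum_(e <- arcs E B) (h e.2 - h e.1) ^+ 2 * disagreement p e.1 e.2 z.

(** The exponential is expanded on each arc. The linear term is the Laplacian of [h], that is
    residue minus source; the quadratic one splits into its mean and [W]; the cubic one is at most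
    [2 * K * l ^+ 3] times the squared gradient. *)
Let drift_expansion z :
  `|log_drift E tilt z - (l * source z - l * linear_stat p B res z
      - l ^+ 2 / 4 * W z - l ^+ 2 / 2 * (p * (1 - p)) * tilt_energy)|
   <= K * tilt_energy * l ^+ 3.
Proof.
rewrite /log_drift drift_form mulrA -expRD addNr expR0 mul1r.
pose sg e := l * grad e * (occ R z e.1 - occ R z e.2).
have big1 : 2^-1 * \sum_(e <- arcs E B) sg e = l * (linear_stat p B res z - source z).
  rewrite -source_lap -arcs_by_parts mulrCA; congr (_ * _); rewrite mulr_sumr.
  by apply: eq_bigr => e _; rewrite /sg; ring.
have big2 : 2^-1 * \sum_(e <- arcs E B) sg e ^+ 2 / 2 =
    l ^+ 2 / 4 * W z + l ^+ 2 / 2 * (p * (1 - p)) * tilt_energy.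
  rewrite /W /tilt_energy !mulr_sumr -big_split /=; apply: eq_bigr => e _.
  by rewrite /sg /disagreement /grad; field.
have -> : - (2^-1 * \sum_(e <- arcs E B) (expR (l * grad e * (occ R z e.1 - occ R z e.2)) - 1)) -
   (l * source z - l * linear_stat p B res z - l ^+ 2 / 4 * W z -
    l ^+ 2 / 2 * (p * (1 - p)) * tilt_energy) =
   - (2^-1 * \sum_(e <- arcs E B) (expR (sg e) - 1 - sg e - sg e ^+ 2 / 2)).
  have -> : \sum_(e <- arcs E B) (expR (sg e) - 1 - sg e - sg e ^+ 2 / 2) =
    \sum_(e <- arcs E B) (expR (sg e) - 1) - \sum_(e <- arcs E B) sg e -
    \sum_(e <- arcs E B) sg e ^+ 2 / 2 by rewrite !sumrB.
  set X := \sum_(e <- _) (expR _ - 1).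
  set Y := \sum_(e <- _) sg e in big1 *; set Z := \sum_(e <- _) _ / 2 in big2 *.
  lra.
rewrite normrN normrM ger0_norm ?invr_ge0 //.
apply: le_trans (_ : 2^-1 * \sum_(e <- arcs E B) (2 * K * l ^+ 3) * (h e.2 - h e.1) ^+ 2 <= _).
  rewrite ler_pM2l ?invr_gt0 //; apply: le_trans (ler_norm_sum _ _ _) _.
  apply: ler_sum => e _.
  have gK : `|grad e| <= 2 * K.
    by rewrite (le_trans (ler_normB _ _)) //; have := hK e.1; have := hK e.2; lra.
  have sgl : `|sg e| <= l * `|grad e|.
    rewrite /sg !normrM (ger0_norm l0) ler_piMr ?mulr_ge0 // /occ.
    by case: (z e.1); case: (z e.2); rewrite ?subrr ?subr0 ?sub0r ?normrN ?normr0 ?normr1.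
  have sg4 : `|sg e| <= 4^-1.
    by apply: le_trans sgl _; apply: le_trans lK; rewrite ler_wpM2l.
  apply: le_trans (expR_taylor2 sg4) _.
  apply: le_trans (_ : (l * `|grad e|) ^+ 3 <= _).
    by rewrite lerXn2r ?nnegrE // mulr_ge0.
  have -> : (h e.2 - h e.1) ^+ 2 = `|grad e| ^+ 2 by rewrite real_normK ?num_real.
  have -> : (l * `|grad e|) ^+ 3 = `|grad e| * (l ^+ 3 * `|grad e| ^+ 2) by ring.
  have -> : 2 * K * l ^+ 3 * `|grad e| ^+ 2 = (2 * K) * (l ^+ 3 * `|grad e| ^+ 2) by ring.
  by rewrite ler_wpM2r // mulr_ge0 ?exprn_ge0.
rewrite -mulr_sumr -/tilt_energy le_eqVlt; apply/orP; left; apply/eqP; by field.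
Qed.

Let tilt_error z : R :=
  l * source z - l ^+ 2 / 2 * (p * (1 - p)) * tilt_energy - log_drift E tilt z.

Let tilt_error_cylinder : cylinder_fun tilt_error.
Proof.
have cd := @log_drift_cylinder R V E Esym nb nbP nb_uniq tilt tilt_cylinder.
apply: (cylinder_op2 (fun a b => a - b)) cd.
apply: (cylinder_op1 (fun a => l * a - _)).
exact: source_cylinder.
Qed.

Let tilt_error_close z :
  `|tilt_error z - (l * linear_stat p B res z + l ^+ 2 / 4 * W z)| <=
  K * tilt_energy * l ^+ 3.
Proof.
rewrite -normrN; apply: le_trans (drift_expansion z).
rewrite le_eqVlt; apply/orP; left; apply/eqP; congr (`|_|).
by rewrite /tilt_error; ring.
Qed.

Let path_error t n w : R := tilt (eta 0 w) - tilt (eta t w) +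
  path_sum eta tilt_error (t / n.+1%:R) n.+1 w.

Let bmeas_tilt s : 0 <= s -> bmeas (fun w => tilt (eta s w)).
Proof. by move=> s0; apply: (bmeas_eta meta s0); apply: cylinder_quasilocal; exact: tilt_cylinder. Qed.

Let bmeas_path_error t n : 0 < t -> bmeas (path_error t n).
Proof.
move=> t0; apply: bmeas_add; last exact: bmeas_path.
by apply: bmeas_sub; apply: bmeas_tilt => //; exact: ltW.
Qed.

Let tilt_LM k s : 0 <= s -> `|k| * l * K <= 4^-1 ->
  LM P (fun _ w => k * tilt (eta s w)) (k ^+ 2 * l ^+ 2 * K).
Proof.
move=> s0 kK; apply: LM_const; first by apply: bmeas_scale; exact: bmeas_tilt.
have -> : (fun w => expR (k * tilt (eta s w))) =
    (fun w => expR (linear_stat p A (fun u => k * l * h u) (eta s w))).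
  apply/funext => w; congr expR; rewrite /tilt /linear_stat mulrA mulr_sumr.
  by apply: eq_bigr => u _; rewrite mulrA.
have small u : u \in A -> `|k * l * h u| <= 4^-1.
  move=> _; apply: le_trans kK; rewrite !normrM (ger0_norm l0) ler_wpM2l //.
  by rewrite mulr_ge0.
apply: le_trans (linear_stat_exp Esym nbP nb_uniq nb_size fS gS p0 p1 meta law markov s0 uA small) _.
rewrite ler_expR; under eq_bigr do rewrite 2!exprMn.
rewrite -mulr_sumr ler_wpM2l //; first exact: (mulr_ge0 (sqr_ge0 _) (sqr_ge0 _)).
case: pot => _ _ [_ H] _ _; apply: le_trans H.
rewrite [leRHS](bigID (mem A)) /= -[leLHS]addr0 lerD ?sumr_ge0 //; last by move=> *; exact: sqr_ge0.
rewrite le_eqVlt; apply/orP; left; apply/eqP.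
rewrite -[RHS]big_filter; apply: perm_big; apply: uniq_perm; rewrite ?filter_uniq //.
by move=> u; rewrite mem_filter andb_idr // => /AB.
Qed.

Let residue_LM k t : 0 < t -> (k * l * t) ^+ 2 * dl <= 16^-1 ->
  LM P (fun n => path_sum eta (fun z => k * (l * linear_stat p B res z)) (t / n.+1%:R) n.+1)
    ((k * l * t) ^+ 2 * dl).
Proof.
move=> t0 small.
have cW : cylinder_fun (fun z => k * (l * linear_stat p B res z)).
  exact: (cylinder_op1 (fun a => k * (l * a))) (linear_stat_cylinder p B res).
apply: (path_static_LM Esym nbP nb_uniq nb_size fS gS meta law markov t0 cW).
rewrite /mean.
have -> : (fun w => expR (t * (k * (l * linear_stat p B res (eta 0 w))))) =
    (fun w => expR (linear_stat p B (fun u => k * l * t * res u) (eta 0 w))).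
  apply/funext => w; congr expR; rewrite /linear_stat !mulrA mulr_sumr.
  by apply: eq_bigr => u _; ring.
have sumres : \sum_(u <- B) res u ^+ 2 <= dl by case: pot.
have sm u : u \in B -> `|k * l * t * res u| <= 4^-1.
  (* A single term is dominated by the whole sum of squares, hence the [16^-1] in the hypothesis: it
     is the square of the [4^-1] required by [linear_stat_exp]. *)
  move=> uB'; rewrite -(@ler_pXn2r _ 2%N) ?nnegrE ?invr_ge0 // real_normK ?num_real //.
  have -> : 4^-1 ^+ 2 = 16^-1 :> R by field.
  rewrite exprMn; apply: le_trans small; rewrite ler_wpM2l ?sqr_ge0 //.
  apply: le_trans sumres; rewrite (bigD1_seq u) //= lerDl sumr_ge0 // => *; exact: sqr_ge0.
apply: le_trans (linear_stat_exp Esym nbP nb_uniq nb_size fS gS p0 p1 meta law markov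
  (lexx 0) uB sm) _.
rewrite ler_expR; under eq_bigr do rewrite exprMn.
by rewrite -mulr_sumr ler_wpM2l ?sqr_ge0.
Qed.

Let quadratic_LM k t : 0 < t ->
  LM P (fun n => path_sum eta (fun z => k * (l ^+ 2 / 4 * W z)) (t / n.+1%:R) n.+1)
    (32 * (k * (l ^+ 2 / 4) * tilt_energy) ^+ 2 * t + 1).
Proof.
move=> t0.
have := @weighted_disagreement_superexp R V E d Esym Eirr Econn Eacyc nb nbP nb_uniq nb_size d2
  S fS gS _ Omega P p eta p0 p1 meta law markov (arcs E B) (fun e => (h e.2 - h e.1) ^+ 2)
  (k * (l ^+ 2 / 4)) t tilt_energy.
rewrite (_ : (fun z => k * (l ^+ 2 / 4) * _) = (fun z => k * (l ^+ 2 / 4 * W z))); last first.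
  by apply/funext => z; rewrite -mulrA.
apply => //; last by move=> e; exact: sqr_ge0.
by move=> e; rewrite mem_arcs => /andP[].
Qed.

(** Boundary terms, residue and quadratic fluctuation get weight one third each, the boundary being
    halved again between its two times; this explains the factors 3 and 6. The cubic remainder is
    deterministic and is added outside. *)
Let path_error_LM k t : 0 < t -> 6 * `|k| * l * K <= 4^-1 ->
  (3 * k * l * t) ^+ 2 * dl <= 16^-1 ->
  LM P (fun n w => k * path_error t n w)
    (3^-1 * (36 * k ^+ 2 * l ^+ 2 * K + (3 * k * l * t) ^+ 2 * dl +
       (32 * (3 * k * (l ^+ 2 / 4) * tilt_energy) ^+ 2 * t + 1)) +
     `|k| * t * (K * tilt_energy * l ^+ 3)).
Proof.
move=> t0 k1 k2; set e := K * tilt_energy * l ^+ 3.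
have hX : LM P (fun _ w => (1 - 2^-1) * (6 * k * tilt (eta 0 w)) +
    2^-1 * (- (6 * k) * tilt (eta t w))) (36 * k ^+ 2 * l ^+ 2 * K).
  have n6 : `|6 * k| * l * K <= 4^-1 by rewrite normrM ger0_norm.
  have n6' : `|- (6 * k)| * l * K <= 4^-1 by rewrite normrN.
  have H0 := tilt_LM (lexx 0) n6; have Ht := tilt_LM (ltW t0) n6'.
  have {}H0 := LM_convex2 (k := 2^-1) _ H0 Ht.
  apply: LM_le (H0 _); last by apply/andP; split; lra.
  by rewrite sqrrN le_eqVlt; apply/orP; left; apply/eqP; field.
have := LM_avg3 hX (residue_LM t0 k2) (quadratic_LM (3 * k) t0).
move=> /(LM_addc (`|k| * t * e)); apply: LM_mono => n.
  by apply: bmeas_scale; exact: bmeas_path_error.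
move=> w; rewrite /path_error.
set S0 := path_sum eta tilt_error _ _ w.
set S1 := path_sum eta _ _ _ w; set S2 := path_sum eta _ _ _ w.
suff H : `|k * S0 - 3^-1 * (S1 + S2)| <= `|k| * t * e.
  by have := le_trans (ler_norm _) H; move=> {}H; lra.
have -> : 3^-1 * (S1 + S2) = k * path_sum eta
    (fun z => l * linear_stat p B res z + l ^+ 2 / 4 * W z) (t / n.+1%:R) n.+1 w.
  by rewrite /S1 /S2 /path_sum !mulr_sumr -big_split /= !mulr_sumr; apply: eq_bigr => i _; field.
rewrite -mulrBr normrM -mulrA ler_wpM2l // /S0 /path_sum -mulrBr -sumrB normrM.
have n0 : 0 < n.+1%:R :> R by rewrite ltr0n.
rewrite ger0_norm; last by rewrite divr_ge0 // ltW.
have -> : t * e = t / n.+1%:R * (n.+1%:R * e) by field; rewrite gt_eqF.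
rewrite ler_wpM2l ?divr_ge0 ?(ltW t0) //; apply: le_trans (ler_norm_sum _ _ _) _.
apply: le_trans (_ : \sum_(i < n.+1) e <= _).
  by apply: ler_sum => i _; exact: tilt_error_close.
by rewrite sumr_const card_ord -[leLHS]mulr_natl.
Qed.

Let martingale t n w : R := - tilt (eta 0 w) +
  path_sum eta (log_drift E tilt) (t / n.+1%:R) n.+1 w + tilt (eta t w).

Definition tilt_cost t : R := t * (l ^+ 2 / 2 * (p * (1 - p)) * tilt_energy).

(** An exact identity, in which all approximations are hidden in [path_error]. *)
Let source_split t n w : l * path_sum eta source (t / n.+1%:R) n.+1 w =
  martingale t n w + path_error t n w + tilt_cost t.
Proof.
rewrite /martingale /path_error /tilt_cost /path_sum /tilt_error.
have -> : \sum_(k < n.+1) (l * source (eta (k.+1%:R * (t / n.+1%:R)) w) -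
      l ^+ 2 / 2 * (p * (1 - p)) * tilt_energy -
      log_drift E tilt (eta (k.+1%:R * (t / n.+1%:R)) w)) =
   l * \sum_(k < n.+1) source (eta (k.+1%:R * (t / n.+1%:R)) w) -
   n.+1%:R * (l ^+ 2 / 2 * (p * (1 - p)) * tilt_energy) -
   \sum_(k < n.+1) log_drift E tilt (eta (k.+1%:R * (t / n.+1%:R)) w).
  by rewrite !sumrB sumr_const card_ord -[(_ * tilt_energy) *+ _]mulr_natl -mulr_sumr.
by field; rewrite gt_eqF // ltr0n.
Qed.

Definition error_cost k t : R :=
  3^-1 * (36 * k ^+ 2 * l ^+ 2 * K + (3 * k * l * t) ^+ 2 * dl +
     (32 * (3 * k * (l ^+ 2 / 4) * tilt_energy) ^+ 2 * t + 1)) +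
  `|k| * t * (K * tilt_energy * l ^+ 3).

(** [1 - ka] times [source_split], read as a convex combination of the exponential martingale,
    shifted by the deterministic cost, and [(1 - ka) / ka] times the error. *)
Lemma tilted_upper ka t : 0 < ka < 1 -> 0 < t ->
  6 * `|(1 - ka) / ka| * l * K <= 4^-1 ->
  (3 * ((1 - ka) / ka) * l * t) ^+ 2 * dl <= 16^-1 ->
  Ex P (fun w => expR ((1 - ka) * l * source_integral t w)) <=
  expR ((1 - ka) * tilt_cost t + ka * error_cost ((1 - ka) / ka) t).
Proof.
move=> /andP[ka0 ka1] t0 h1 h2.
have hM := exp_martingale_LM Esym nbP nb_uniq nb_size fS gS meta markov tilt_cylinder t0.
have H := LM_convex2 (k := ka) _ (LM_addc (tilt_cost t) hM) (path_error_LM t0 h1 h2).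
rewrite add0r in H; apply: LM_lim_le (H _) _; first by rewrite !ltW.
have -> : (fun n => Ex P (fun w => expR ((1 - ka) * (martingale t n w + tilt_cost t) +
    ka * ((1 - ka) / ka * path_error t n w)))) =
    (fun n => Ex P (fun w => expR ((1 - ka) * l * path_sum eta source (t / n.+1%:R) n.+1 w))).
  apply/funext => n; congr Ex; apply/funext => w; congr expR.
  by rewrite -[RHS]mulrA source_split; field; rewrite gt_eqF.
exact: Ex_exp_source_cvg.
Qed.

(** [source_split] solved for the martingale, a combination of the source at strength [l / (1 - ka)]
    and [- ka^-1] times the error. Were the bound below the cost, the mean of the exponential
    martingale would fall short of 1. *)
Lemma tilted_lower ka t : 0 < ka < 1 -> 0 < t -> 6 * `|- ka^-1| * l * K <= 4^-1 ->
  (3 * - ka^-1 * l * t) ^+ 2 * dl <= 16^-1 ->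
  tilt_cost t <= (1 - ka) * ln (Ex P (fun w => expR (l / (1 - ka) * source_integral t w))) +
    ka * error_cost (- ka^-1) t.
Proof.
move=> /andP[ka0 ka1] t0 h1 h2.
have ka1' : 0 < 1 - ka by rewrite subr_gt0.
set r := Ex P _; set b := _ + _.
have r0 : 0 < r.
  by apply: Ex_exp_gt0; apply: bmeas_scale; exact: bmeas_source_integral.
have bS n : bmeas (fun w => l / (1 - ka) * path_sum eta source (t / n.+1%:R) n.+1 w).
  by apply: bmeas_scale; apply: bmeas_path => //; exact: source_cylinder.
have hS := LM_cvg bS r0 (@Ex_exp_source_cvg (l / (1 - ka)) t t0).
have H := LM_convex2 (k := ka) _ hS (path_error_LM t0 h1 h2).
have {}H : LM P (fun n w => martingale t n w + tilt_cost t) b.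
  apply: LM_ext (H _); last by rewrite !ltW.
  move=> n w; have -> : (1 - ka) * (l / (1 - ka) * path_sum eta source (t / n.+1%:R) n.+1 w) =
    l * path_sum eta source (t / n.+1%:R) n.+1 w by field; rewrite gt_eqF.
  by rewrite source_split; field; rewrite gt_eqF.
have {H} := LM_addc (- tilt_cost t) H.
have -> : (fun (n : nat) w => martingale t n w + tilt_cost t - tilt_cost t) = martingale t.
  by apply/funext => n; apply/funext => w; rewrite addrK.
move=> [_ H]; rewrite leNgt; apply/negP => bc.
(* A third of the gap serves as slack in the upper and in the lower estimate, which leaves a
   contradiction. *)
have e0 : 0 < (tilt_cost t - b) / 3 by rewrite divr_gt0 // subr_gt0.
have [N1 hN1] := H _ e0.
have [N2 hN2] := exp_martingale_ge Esym nbP nb_uniq nb_size fS gS meta markov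
  tilt_cylinder t0 e0.
have := le_trans (hN2 (maxn N1 N2) (leq_maxr _ _)) (hN1 (maxn N1 N2) (leq_maxl _ _)).
by rewrite ler_expR => q; lra.
Qed.

End Tilted.
(** It is a limit of halves of energies, which are sums of squares. *)
Lemma green_form_ge0 : 0 <= green_form.
Proof.
have [K K0 hK] := approx_potential_ex Esym Eirr Econn Eacyc nbP nb_uniq nb_size d2 x c.
set C := \sum_i `|c i| + K + 1.
have C0 : 0 < C by rewrite ltr_wpDl // addr_ge0 // sumr_ge0.
apply/ler_addgt0Pl => e e0; pose s := Num.min 1 (e / C).
have s0 : 0 < s by rewrite lt_min ltr01 divr_gt0.
have s1 : 0 < s <= 1 by rewrite s0 ge_min lexx.
have [A [h pot]] := hK (s ^+ 2) (exprn_gt0 2 s0).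
have := tilt_energy_close pot s1 (erefl _); rewrite -/C ler_norml => /andP[_ H].
have En : 0 <= tilt_energy A h by apply: sumr_ge0 => ? _; exact: sqr_ge0.
have : C * s <= e by rewrite mulrC -ler_pdivlMr // ge_min lexx orbT.
lra.
Qed.

(** [C] and [l0] depend on [ka] but not on [t], although the potential does. With residue energy
    [t ^- 2] the residue costs O(l^2), the fluctuations O(1 + l^4 t) and the cubic remainder O(l^3
    t). *)
Lemma log_mgf_bounds ka : 0 < ka < 1 -> exists C l0, [/\ 0 <= C, 0 < l0 &
  forall l t, 0 < l < l0 -> 1 <= t ->
  ln (Ex P (fun w => expR ((1 - ka) * l * source_integral t w))) <=
    (1 - ka) * (l ^+ 2 * t * (p * (1 - p) * green_form)) + C * (1 + l ^+ 3 * t) /\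
  l ^+ 2 * t * (p * (1 - p) * green_form) <=
    (1 - ka) * ln (Ex P (fun w => expR (l / (1 - ka) * source_integral t w))) +
    C * (1 + l ^+ 3 * t)].
Proof.
move=> ka01; have /andP[ka0 ka1] := ka01.
have pq : 0 <= p * (1 - p) <= 1.
  by have := p0; have := p1; have := sqr_ge0 (1 - p); rewrite expr2 => *; apply/andP; split; nra.
have [K K0 hK] := approx_potential_ex Esym Eirr Econn Eacyc nbP nb_uniq nb_size d2 x c.
pose S1 := \sum_i `|c i| + K + 1.
have S10 : 0 <= S1 by rewrite !addr_ge0 // sumr_ge0.
pose K3 := 2 * (`|green_form| + S1).
have K30 : 0 <= K3 by rewrite mulr_ge0 // addr_ge0.
have ki0 : 0 < ka^-1 by rewrite invr_gt0.
(* A common bound for the two multiples of the error, [(1 - ka) / ka] and [- ka^-1]. *)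
pose kk := 1 + ka^-1.
have kk1 : 1 <= kk by rewrite lerDl ltW.
have kkE : kk = 1 + ka^-1 by [].
clearbody kk.
have k1 : `|(1 - ka) / ka| <= kk.
  rewrite ger0_norm; last by rewrite divr_ge0 ?ltW // subr_gt0.
  by rewrite mulrBl divff ?gt_eqF // mul1r kkE; lra.
have k2 : `|- ka^-1| <= kk by rewrite normrN gtr0_norm // kkE; lra.
have kk0 : 0 <= kk := le_trans ler01 kk1.
have b1 : 0 <= kk ^+ 2 * K by apply: mulr_ge0 => //; exact: sqr_ge0.
have b2 : 0 <= kk ^+ 2 * K3 ^+ 2 by apply: (mulr_ge0 (sqr_ge0 _) (sqr_ge0 _)).
have b3 : 0 <= kk * (K * K3) by apply: mulr_ge0 => //; exact: mulr_ge0.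
have b4 : 0 <= kk ^+ 2 by exact: sqr_ge0.
pose Ce := 12 * (kk ^+ 2 * K) + 3 * kk ^+ 2 + 6 * (kk ^+ 2 * K3 ^+ 2) + 1 + kk * (K * K3).
have Ce0 : 0 <= Ce.
  by rewrite /Ce; lra.
have den : 0 < 24 * (kk * (K + 1)).
  by rewrite mulr_gt0 // mulr_gt0 ?(lt_le_trans ltr01 kk1) // ltr_wpDl.
(* The threshold ensures [l * kk] and [l * kk * K] at most [24^-1], which covers the smallness
   conditions with the factors 2, 6 and 3 as well as [l <= 1]. *)
exists (Ce + S1), (24 * (kk * (K + 1)))^-1; split; first exact: addr_ge0.
  by rewrite invr_gt0.
move=> l t /andP[l0 ll] t1.
have t0 : 0 < t := lt_le_trans ltr01 t1.
have lkK : l * (kk * (K + 1)) <= 24^-1.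
  have := ltW ll; rewrite -[_^-1]mul1r ler_pdivlMr // -[24^-1]mul1r ler_pdivlMr // => q.
  by apply: le_trans q; rewrite le_eqVlt; apply/orP; left; apply/eqP; ring.
have lk : l * kk <= 24^-1.
  apply: le_trans lkK; rewrite mulrDr mulr1 mulrDr lerDr.
  by apply: mulr_ge0; [exact: ltW|exact: mulr_ge0].
have lkK' : l * (kk * K) <= 24^-1.
  apply: le_trans lkK; rewrite ler_pM2l // ler_wpM2l //; lra.
have lle : l <= 24^-1 by apply: le_trans lk; rewrite ler_peMr // ltW.
have l1 : l <= 1 by lra.
have lK1 : l * (2 * K) <= 4^-1.
  have : l * K <= l * (kk * K) by rewrite ler_pM2l // ler_peMl.
  have -> : l * (2 * K) = 2 * (l * K) by ring.
  lra.
(* The truncation precision is tied to [t]; the energy is then within [S1 / t] of its limit, which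
   costs a constant over time [t]. *)
pose s := t^-1; have s01 : 0 < s <= 1 by rewrite invr_gt0 t0 invf_le1.
have /andP[s0 s1] := s01.
have [A [h pot]] := hK (s ^+ 2) (exprn_gt0 2 s0).
have Eclose := tilt_energy_close pot s01 (erefl _).
set En := tilt_energy A h in Eclose.
have En0 : 0 <= En by apply: sumr_ge0 => e _; exact: sqr_ge0.
have EnK : En <= K3.
  have : S1 * s <= S1 by rewrite ler_piMr.
  move: Eclose; rewrite ler_norml => /andP[_ q] q2; rewrite /K3.
  have := ler_norm green_form; rewrite -/S1 in q; lra.
have l3t0 : 0 <= l ^+ 3 * t by rewrite mulr_ge0 ?exprn_ge0 // ltW.
have sq k : `|k| <= kk -> k ^+ 2 <= kk ^+ 2.
  by move=> hk; rewrite -[k ^+ 2]real_normK ?num_real // lerXn2r ?nnegrE.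
have err k : `|k| <= kk ->
    error_cost K (s ^+ 2) A h l k t <= Ce * (1 + l ^+ 3 * t).
  move=> hk; rewrite /error_cost -/En.
  have l2 : l ^+ 2 <= 1 by rewrite expr_le1 // ltW.
  have a0 : k ^+ 2 * l ^+ 2 <= kk ^+ 2.
    by rewrite -[leRHS]mulr1 ler_pM ?sqr_ge0 // sq.
  have a1 : k ^+ 2 * l ^+ 2 * K <= kk ^+ 2 * K by rewrite ler_wpM2r.
  have a2 : k ^+ 2 * En ^+ 2 * (l * (l ^+ 3 * t)) <= kk ^+ 2 * K3 ^+ 2 * (l ^+ 3 * t).
    apply: ler_pM.
    - exact: (mulr_ge0 (sqr_ge0 _) (sqr_ge0 _)).
    - by apply: mulr_ge0 => //; exact: ltW.
    - apply: ler_pM; [exact: sqr_ge0|exact: sqr_ge0|exact: sq|].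
      by rewrite lerXn2r ?nnegrE.
    - by rewrite ler_piMl.
  have a3 : `|k| * (K * En) <= kk * (K * K3).
    by apply: ler_pM => //; [exact: mulr_ge0|exact: ler_wpM2l].
  have a4 := ler_wpM2r l3t0 a3.
  have -> : 3^-1 * (36 * k ^+ 2 * l ^+ 2 * K + (3 * k * l * t) ^+ 2 * s ^+ 2 +
      (32 * (3 * k * (l ^+ 2 / 4) * En) ^+ 2 * t + 1)) + `|k| * t * (K * En * l ^+ 3) =
    12 * (k ^+ 2 * l ^+ 2 * K) + 3 * (k ^+ 2 * l ^+ 2) +
    6 * (k ^+ 2 * En ^+ 2 * (l * (l ^+ 3 * t))) + 3^-1 + `|k| * (K * En) * (l ^+ 3 * t).
    by rewrite /s; field; rewrite gt_eqF.
  have c1 := mulr_ge0 b1 l3t0; have c4 := mulr_ge0 b4 l3t0.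
  rewrite /Ce; lra.
have h1 (k : R) : `|k| <= kk -> 6 * `|k| * l * K <= 4^-1.
  move=> hk; have : `|k| * (l * K) <= kk * (l * K).
    by rewrite ler_wpM2r // mulr_ge0 // ltW.
  have -> : 6 * `|k| * l * K = 6 * (`|k| * (l * K)) by ring.
  have -> : kk * (l * K) = l * (kk * K) by ring.
  lra.
have h2 (k : R) : `|k| <= kk -> (3 * k * l * t) ^+ 2 * s ^+ 2 <= 16^-1.
  move=> hk; have -> : (3 * k * l * t) ^+ 2 * s ^+ 2 = 9 * (k ^+ 2 * l ^+ 2).
    by rewrite /s; field; rewrite gt_eqF.
  have : k ^+ 2 * l ^+ 2 <= 24^-1 ^+ 2.
    apply: le_trans (_ : (l * kk) ^+ 2 <= _).
      by rewrite exprMn mulrC ler_wpM2l ?sqr_ge0 ?sq.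
    by rewrite lerXn2r ?nnegrE ?invr_ge0 // mulr_ge0 // ltW.
  lra.
have costE : `|tilt_cost A h l t - l ^+ 2 * t * (p * (1 - p) * green_form)| <= S1.
  rewrite /tilt_cost -/En.
  have -> : t * (l ^+ 2 / 2 * (p * (1 - p)) * En) - l ^+ 2 * t * (p * (1 - p) * green_form) =
    l ^+ 2 * (p * (1 - p)) * t * (2^-1 * En - green_form) by field.
  have /andP[pq0 pq1] := pq.
  have q0 : 0 <= l ^+ 2 * (p * (1 - p)) <= 1.
    by rewrite mulr_ge0 ?sqr_ge0 //= mulr_ile1 ?sqr_ge0 // expr_le1 // ltW.
  have /andP[q1 q2] := q0.
  rewrite 2!normrM (ger0_norm q1) (ger0_norm (ltW t0)) -mulrA.
  have st : t * `|2^-1 * En - green_form| <= S1.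
    apply: le_trans (_ : t * (S1 * s) <= _); first by rewrite ler_pM2l.
    by rewrite mulrCA /s mulfV ?mulr1 // gt_eqF.
  by apply: le_trans st; rewrite ler_piMl // mulr_ge0 // ltW.
have up := tilted_upper pot (ltW l0) lK1 ka01 t0 (h1 _ k1) (h2 _ k1).
have lo := tilted_lower pot (ltW l0) lK1 ka01 t0 (h1 _ k2) (h2 _ k2).
have e1 := err _ k1; have e2 := err _ k2.
have ler1 : 1 <= 1 + l ^+ 3 * t by rewrite lerDl.
have Q0 : 0 <= Ce * (1 + l ^+ 3 * t) by rewrite mulr_ge0 // (le_trans ler01).
have S1Q : S1 <= S1 * (1 + l ^+ 3 * t) by rewrite ler_peMr.
move: costE; rewrite ler_norml => /andP[cE1 cE2].
set v := l ^+ 2 * t * _ in cE1 cE2 *; set tc := tilt_cost _ _ _ _ in cE1 cE2 up lo.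
set er := error_cost _ _ _ _ _ _ _ in up e1; set er' := error_cost _ _ _ _ _ _ _ in lo e2.
have ke1 : ka * er <= Ce * (1 + l ^+ 3 * t).
  apply: le_trans (_ : ka * (Ce * (1 + l ^+ 3 * t)) <= _); first by rewrite ler_pM2l.
  by rewrite ler_piMl // ltW.
have ke2 : ka * er' <= Ce * (1 + l ^+ 3 * t).
  apply: le_trans (_ : ka * (Ce * (1 + l ^+ 3 * t)) <= _); first by rewrite ler_pM2l.
  by rewrite ler_piMl // ltW.
split; last by rewrite mulrDl; lra.
rewrite -ler_expR lnK; last first.
  rewrite posrE; apply: Ex_exp_gt0; apply: bmeas_scale; exact: bmeas_source_integral.
apply: le_trans up _; rewrite ler_expR [(Ce + S1) * _]mulrDl.
have : (1 - ka) * (tc - v) <= S1.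
  apply: le_trans (_ : (1 - ka) * S1 <= _); first by rewrite ler_pM2l ?subr_gt0 //; lra.
  by rewrite ler_piMl //; lra.
lra.
Qed.

(** The two bounds are used at [l / (1 - ka)] and [l * (1 - ka)], so that both speak of the source
    at strength [l]. Small [l] absorbs the term [l ^+ 3 * t], a large [l ^+ 2 * t] absorbs the
    constant. *)
Lemma log_mgf_limit e : 0 < e -> exists dl M, 0 < dl /\
  forall l t, 0 < l < dl -> 1 <= t -> M <= l ^+ 2 * t ->
  `|ln (Ex P (fun w => expR (l * source_integral t w))) -
    l ^+ 2 * t * (p * (1 - p) * green_form)| <= e * (l ^+ 2 * t).
Proof.
move=> e0; set g := p * (1 - p) * green_form.
have den : 0 < 4 * `|g| + 2 * e + 1.
  by rewrite ltr_wpDl // addr_ge0 // mulr_ge0 // ltW.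
(* Chosen so that [ka] is at most one half and [ka] times the absolute value of [g] at most
   [e / 4]. *)
pose ka := e / (4 * `|g| + 2 * e + 1).
have ka0 : 0 < ka by rewrite divr_gt0.
have kg0 : 0 <= ka * `|g| by rewrite mulr_ge0 // ltW.
have kaE : ka * (4 * `|g| + 2 * e + 1) = e by rewrite /ka divfK // gt_eqF.
clearbody ka.
have ka2 : ka <= 2^-1.
  have : ka * (2 * e) <= e.
    by rewrite -[leRHS]kaE ler_pM2l //; have := normr_ge0 g; lra.
  by rewrite mulrA -{2}[e]mul1r ler_pM2r // => ?; lra.
have kag : ka * `|g| <= e / 4.
  have : ka * (4 * `|g|) <= e.
    by rewrite -[leRHS]kaE ler_pM2l //; have := normr_ge0 g; lra.
  by rewrite mulrCA => ?; lra.
have ka01 : 0 < ka < 1 by rewrite ka0; lra.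
have [C [l0 [C0 l00 hC]]] := log_mgf_bounds ka01.
pose r := (1 - ka)^-1.
have r1 : (1 - ka) * r = 1 by rewrite mulfV // gt_eqF // subr_gt0; lra.
have r0 : 0 < r by rewrite invr_gt0; lra.
have r2 : r <= 2 by rewrite -[leRHS]invrK lef_pV2 ?posrE //; lra.
exists (Num.min (l0 / 2) (e / (32 * C + 1))), (8 * C / e); split.
  by rewrite lt_min !divr_gt0 // ltr_wpDl // mulr_ge0.
move=> l t /andP[lp]; rewrite lt_min => /andP[ll0 le] t1 Mv.
have t0 : 0 < t := lt_le_trans ltr01 t1.
have v0 : 0 < l ^+ 2 * t by rewrite mulr_gt0 // exprn_gt0.
have lC : 8 * (C * l) <= e / 4.
  move: le; rewrite ltr_pdivlMr; last by rewrite ltr_wpDl // mulr_ge0.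
  rewrite mulrDr mulr1 => h.
  have : l * (32 * C) = 32 * (C * l) by ring.
  lra.
have vC : C <= e / 8 * (l ^+ 2 * t).
  by move: Mv; rewrite ler_pdivrMr // => h; lra.
have lr : 0 < l * r < l0.
  rewrite mulr_gt0 //=; apply: le_lt_trans (_ : l * 2 < l0); first by rewrite ler_pM2l.
  by move: ll0; rewrite ltr_pdivlMr.
have lk : 0 < l * (1 - ka) < l0.
  have h : l * (1 - ka) <= l by rewrite ger_pMr //; lra.
  rewrite mulr_gt0 ?subr_gt0 //; last by lra.
  by apply: le_lt_trans h _; lra.
have [up _] := hC _ t lr t1; have [_ lo] := hC _ t lk t1.
move: up lo; rewrite -/g.
have -> : (1 - ka) * (l * r) = l by rewrite mulrCA r1 mulr1.
have -> : l * (1 - ka) / (1 - ka) = l by rewrite mulfK // gt_eqF // subr_gt0; lra.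
set L := ln _; set v := l ^+ 2 * t in v0 vC *.
have -> : (1 - ka) * ((l * r) ^+ 2 * t * g) = ((1 - ka) * r) * (r * v * g) by rewrite /v; ring.
have -> : (l * r) ^+ 3 * t = r ^+ 3 * (l * v) by rewrite /v; ring.
have -> : (l * (1 - ka)) ^+ 2 * t * g = (1 - ka) ^+ 2 * (v * g) by rewrite /v; ring.
have -> : (l * (1 - ka)) ^+ 3 * t = (1 - ka) ^+ 3 * (l * v) by rewrite /v; ring.
rewrite r1 mul1r => up lo; clearbody v L.
have lv0 : 0 <= l * v by rewrite mulr_ge0 // ltW.
have Clv : 8 * (C * (l * v)) <= e / 4 * v.
  have -> : 8 * (C * (l * v)) = 8 * (C * l) * v by ring.
  by rewrite ler_pM2r.
have Clv0 : 0 <= C * (l * v) by rewrite mulr_ge0.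
have kgv : ka * `|g| * v <= e / 4 * v by rewrite ler_pM2r.
have gabs : - `|g| <= g <= `|g| by rewrite -ler_norml.
have /andP[g1 g2] := gabs.
rewrite ler_norml; apply/andP; split.
  have lo' : r * ((1 - ka) ^+ 2 * (v * g)) <=
     r * ((1 - ka) * L + C * (1 + (1 - ka) ^+ 3 * (l * v))) by rewrite ler_pM2l.
  have e1 : r * ((1 - ka) ^+ 2 * (v * g)) = (1 - ka) * (v * g).
    have -> : r * ((1 - ka) ^+ 2 * (v * g)) = ((1 - ka) * r) * ((1 - ka) * (v * g)) by ring.
    by rewrite r1 mul1r.
  have e2 : r * ((1 - ka) * L + C * (1 + (1 - ka) ^+ 3 * (l * v))) =
     L + r * C + (1 - ka) ^+ 2 * (C * (l * v)).
    have -> : r * ((1 - ka) * L + C * (1 + (1 - ka) ^+ 3 * (l * v))) =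
      ((1 - ka) * r) * (L + (1 - ka) ^+ 2 * (C * (l * v))) + r * C by ring.
    by rewrite r1 mul1r addrAC.
  rewrite e1 e2 in lo'.
  have f1 : r * C <= 2 * C by rewrite ler_wpM2r.
  have f2 : (1 - ka) ^+ 2 * (C * (l * v)) <= C * (l * v).
    by rewrite ler_piMl // expr_le1 //; lra.
  have f3 : ka * (v * g) <= ka * `|g| * v.
    by rewrite -mulrA ler_pM2l // mulrC ler_pM2r.
  lra.
have f1 : r ^+ 3 * (C * (l * v)) <= 8 * (C * (l * v)).
  rewrite ler_wpM2r //; have -> : 8 = 2 ^+ 3 :> R by rewrite -natrX.
  by rewrite lerXn2r ?nnegrE // ltW.
have rk : r - 1 = ka * r by have := r1; lra.
have f2 : (r - 1) * (v * g) <= 2 * (ka * `|g| * v).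
  rewrite rk; apply: le_trans (_ : ka * r * (v * `|g|) <= _).
    by rewrite ler_pM2l ?mulr_gt0 // ler_pM2l.
  have -> : ka * r * (v * `|g|) = r * (ka * `|g| * v) by ring.
  by rewrite ler_wpM2r // mulr_ge0 // ltW.
lra.
Qed.

End Mgf.

(** * Gartner-Ellis theorem with a Gaussian limit *)

Section ExtendedReals.
Context (R : realType).
Local Open Scope ereal_scope.

Let le_by_real (x y : \bar R) :
  (forall r e : R, y < r%:E -> (0 < e)%R -> x <= (r + e)%:E) -> x <= y.
Proof.
case: y => [y| |] h; last 2 first.
- exact: leey.
- case: x h => [x| |] // h.
    by have := h (x - 2)%R 1%R (ltNyr _) ltr01; rewrite lee_fin => ?; exfalso; lra.
  by have := h 0%R 1%R (ltNyr _) ltr01.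
apply/lee_addgt0Pr => e e0; rewrite -EFinD.
have e2 : (0 < e / 2)%R by rewrite divr_gt0.
have := h (y + e / 2)%R (e / 2)%R; rewrite lte_fin ltrDl => /(_ e2 e2).
by rewrite -addrA -splitr.
Qed.

Lemma limf_esup_le_near (f : R -> \bar R) (F : set_system R) (y : \bar R) : Filter F ->
  (forall r e : R, y < r%:E -> (0 < e)%R -> \forall t \near F, f t <= (r + e)%:E) ->
  limf_esup f F <= y.
Proof.
move=> FF h; apply: le_by_real => r e yr e0.
apply: le_trans (_ : ereal_sup (f @` [set t | f t <= (r + e)%:E]) <= _).
  by apply: ereal_inf_lbound; exists [set t | f t <= (r + e)%:E] => //; exact: h.
by apply: ge_ereal_sup => _ [t ft <-].
Qed.

(** When [r] is 0 the left side is minus infinity, by the convention for the logarithm of 0. *)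
Lemma scaled_lne_le (k z r : R) : (0 < k)%R -> (0 <= r)%R -> (r <= expR (k * z))%R ->
  (k^-1)%:E * lne r%:E <= z%:E.
Proof.
move=> k0; rewrite le_eqVlt => /orP[/eqP <- _|r0 rz].
  by rewrite le0_lneNy // gt0_muleNy ?lte_fin ?invr_gt0 // leNye.
by rewrite lne_EFin // -EFinM lee_fin ler_pdivrMl // -ler_expR lnK ?posrE.
Qed.

Lemma scaled_lne_ge (k z r : R) : (0 < k)%R -> (expR (k * z) <= r)%R ->
  z%:E <= (k^-1)%:E * lne r%:E.
Proof.
move=> k0 zr; have r0 : (0 < r)%R := lt_le_trans (expR_gt0 _) zr.
by rewrite lne_EFin // -EFinM lee_fin ler_pdivlMl // -ler_expR lnK ?posrE.
Qed.

End ExtendedReals.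

Section GartnerEllis.
Context (R : realType) (m : nat).
Implicit Types (c u : 'cV[R]_m) (C O : set 'cV[R]_m).

Lemma open_box O u : open O -> O u -> exists2 dl, 0 < dl &
  forall y : 'cV[R]_m, (forall i, `|u i 0 - y i 0| < dl) -> O y.
Proof.
move=> oO Ou; have : nbhs u O by exact: open_nbhs_nbhs.
move=> /nbhs_ballP[dl dl0 h]; exists dl => // y hy; apply: h; split => // i j.
by rewrite (ord1 j); exact: hy.
Qed.

Definition dot c u : R := (c^T *m u) 0 0.

Lemma dotE c u : dot c u = \sum_i c i 0 * u i 0.
Proof. by rewrite /dot mxE; apply: eq_bigr => i _; rewrite mxE. Qed.

Variable G : 'M[R]_m.
Hypotheses (Gsym : G^T = G) (Gpos : forall c, 0 <= dot c (G *m c)).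

Definition quad c : R := 2^-1 * dot c (G *m c).

Let quad0 c : 0 <= quad c. Proof. by rewrite mulr_ge0. Qed.

Let e_ (i : 'I_m) : 'cV[R]_m := delta_mx i 0.

Let dot_e i u : dot (e_ i) u = u i 0.
Proof.
rewrite dotE (bigD1 i) //= big1 ?addr0 => [|j ji]; first by rewrite mxE !eqxx mul1r.
by rewrite mxE (negbTE ji) mul0r.
Qed.

Let dotDl c c' u : dot (c + c') u = dot c u + dot c' u.
Proof. by rewrite /dot linearD mulmxDl mxE. Qed.

Let dotZl s c u : dot (s *: c) u = s * dot c u.
Proof. by rewrite /dot linearZ /= -scalemxAl mxE. Qed.

Let dot_sym c c' : dot c (G *m c') = dot c' (G *m c).
Proof.
rewrite /dot; have -> : (c^T *m (G *m c')) 0 0 = (c^T *m (G *m c'))^T 0 0 by rewrite [RHS]mxE.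
by rewrite !trmx_mul trmxK Gsym mulmxA.
Qed.

Let quadD c s i : quad (c + s *: e_ i) = quad c + s * (G *m c) i 0 + s ^+ 2 * quad (e_ i).
Proof.
rewrite /quad mulmxDr -scalemxAr.
have dotDr c1 u1 u2 : dot c1 (u1 + u2) = dot c1 u1 + dot c1 u2.
  by rewrite /dot mulmxDr mxE.
have dotZr s1 c1 u1 : dot c1 (s1 *: u1) = s1 * dot c1 u1.
  by rewrite /dot -scalemxAr mxE.
rewrite !dotDl !dotZl !dotDr !dotZr dot_e (dot_sym c (e_ i)) dot_e; by field.
Qed.

Lemma rate_ge c u : ((dot c u - quad c)%:E <= rate G u)%E.
Proof.
by apply: ereal_sup_ubound; exists c => //; rewrite /quad /dot mulmxA.
Qed.

(** [G] may be singular, for instance when sites are repeated. A vector outside its range is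
    detected by some [z] in the kernel, along which the quadratic term vanishes while the linear one
    is unbounded. *)
Lemma rate_finite u : (rate G u < +oo)%E -> exists c, u = G *m c.
Proof.
move=> fin; have [sub|] := boolP (u^T <= G)%MS.
  have [D uD] := submxP sub; exists D^T.
  by rewrite -[u]trmxK uD trmx_mul Gsym.
rewrite submxE => /eqP nz; exfalso.
have [k hk] : exists k, (u^T *m cokermx G) 0 k != 0.
  apply/existsP; rewrite -negb_forall; apply/negP => /forallP h; apply: nz.
  by apply/rowP => k; rewrite [RHS]mxE; apply/eqP.
pose z := col k (cokermx G).
have Gz : G *m z = 0 by rewrite /z colE mulmxA mulmx_coker mul0mx.
have zu : dot z u != 0.
  suff -> : dot z u = (u^T *m cokermx G) 0 k by [].
  by rewrite dotE mxE; apply: eq_bigr => i _; rewrite !mxE mulrC.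
suff : rate G u = +oo%E by move=> e; rewrite e ltxx in fin.
apply/eqyP => A A0.
have := rate_ge ((A / dot z u) *: z) u.
have -> : quad ((A / dot z u) *: z) = 0.
  by rewrite /quad -scalemxAr Gz scaler0 /dot mulmx0 mxE mulr0.
by rewrite subr0 dotZl divfK.
Qed.

(** Transports compactness of boxes of row vectors to the column vectors on which the events
    live. *)
Lemma continuous_trmx : continuous (fun y : 'rV[R]_m => (y^T : 'cV[R]_m)).
Proof.
move=> y B; rewrite /nbhs /= => -[Q hQ QB].
exists (fun i j => Q j i) => [i j|z hz]; first by have := hQ j i; rewrite mxE.
by apply: QB => i j; rewrite mxE.
Qed.

Let dot_close c u (y : 'cV[R]_m) (dl : R) : (forall i, `|u i 0 - y i 0| <= dl) ->
  `|dot c u - dot c y| <= (\sum_i `|c i 0|) * dl.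
Proof.
move=> h; rewrite !dotE -sumrB mulr_suml; apply: le_trans (ler_norm_sum _ _ _) _.
by apply: ler_sum => i _; rewrite -mulrBr normrM ler_wpM2l.
Qed.

Let open_halfspace c b : open [set y : 'rV[R]_m | b < dot c y^T].
Proof.
rewrite openE => y /= by'; apply/nbhs_ballP.
have S0 : 0 < \sum_i `|c i 0| + 1 by rewrite ltr_wpDl // sumr_ge0.
have s0 : 0 < dot c y^T - b by rewrite subr_gt0.
exists ((dot c y^T - b) / (\sum_i `|c i 0| + 1)) => [|z [_ yz] /=]; first exact: divr_gt0.
have : `|dot c y^T - dot c z^T| < dot c y^T - b.
  set dl := _ / _ in yz; have dl0 : 0 < dl by exact: divr_gt0.
  apply: le_lt_trans (_ : (\sum_i `|c i 0|) * dl < _).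
    by apply: dot_close => i; rewrite !mxE; apply: ltW; exact: yz.
  have -> : dot c y^T - b = (\sum_i `|c i 0| + 1) * dl by rewrite mulrC divfK // gt_eqF.
  by rewrite ltr_pM2r // ltrDl.
by move=> /(le_lt_trans (ler_norm _)); lra.
Qed.

(* Outside a large box one of the vectors [+- e_i] does; the box is compact. *)
Lemma halfspace_cover C b : closed C -> (forall u, C u -> exists c, b < dot c u - quad c) ->
  exists L : seq 'cV[R]_m, forall u, C u -> exists2 c, c \in L & b < dot c u - quad c.
Proof.
(* Large enough that a coordinate exceeding [r] in absolute value puts [u] in the half-space of one
   of the vectors [e_ i], [- e_ i]. *)
move=> cC hC; pose r := `|b| + \sum_i quad (e_ i) + 1.
(* The member [None] of the cover is the complement of [C], so that the whole box gets covered. *)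
pose f (o : option 'cV[R]_m) : set 'rV[R]_m :=
  if o is Some c then [set y | b < dot c y^T - quad c] else [set y | ~ C y^T].
have of_ o : [set: option 'cV[R]_m] o -> open (f o).
  move=> _; case: o => [c|].
    by have := @open_halfspace c (b + quad c); congr open; apply/seteqP; split => y /=; rewrite ltrBrDr.
  have : open ((fun y : 'rV[R]_m => (y^T : 'cV[R]_m)) @^-1` (~` C)).
    by apply: open_comp => [y _|]; [exact: continuous_trmx|exact: closed_openC].
  by [].
have cbox : compact [set y : 'rV[R]_m | forall i, `[- r, r]%classic (y ord0 i)].
  by apply: (@rV_compact R m (fun=> `[- r, r]%classic)) => i; exact: segment_compact.
rewrite compact_cover in cbox.
have [|D _ hD] := cbox _ setT f of_.
  move=> y _; have [Cy|nCy] := pselect (C y^T); last by exists None.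
  by have [c hc] := hC _ Cy; exists (Some c).
exists (pmap id (finmap.enum_fset D) ++ [seq e_ i | i : 'I_m] ++ [seq - e_ i | i : 'I_m]) => u Cu.
have qr i : `|b| + quad (e_ i) < r.
  rewrite /r (bigD1 i) //=; set S := \sum_(j | _) _.
  have : 0 <= S by apply: sumr_ge0.
  lra.
have bb := ler_norm b.
have [inbox|] := pselect (forall i, - r <= u i 0 <= r).
  have ub : [set y : 'rV[R]_m | forall i, `[- r, r]%classic (y ord0 i)] u^T.
    by move=> i /=; rewrite in_itv /= mxE.
  have [k kD] := hD _ ub; case: k kD => [c|] kD /=; rewrite trmxK // => hc; exists c => //.
  rewrite mem_cat; apply/orP; left; rewrite mem_pmap map_id; exact: kD.
move=> /existsNP[i] /negP; rewrite negb_and -!ltNge => /orP[lo|hi].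
  exists (- e_ i); first by rewrite !mem_cat; apply/orP; right; apply/orP; right; apply/mapP; exists i; rewrite ?mem_enum.
  have -> : - e_ i = 0 + (-1) *: e_ i by rewrite add0r scaleN1r.
  rewrite quadD mulmx0 /quad mulmx0 dotDl dotZl dot_e -/(quad _).
  have dz u' : dot 0 u' = 0 by rewrite /dot trmx0 mul0mx mxE.
  have := qr i; rewrite !dz mxE /quad; lra.
exists (e_ i); first by rewrite !mem_cat; apply/orP; right; apply/orP; left; apply/mapP; exists i; rewrite ?mem_enum.
by rewrite dot_e; have := qr i; lra.
Qed.

Context (dsp : measure_display) (Omega : measurableType dsp) (P : probability Omega R).
Variables (X : R -> Omega -> 'cV[R]_m) (v : R -> R).
Hypothesis bX : forall t i, 1 <= t -> bmeas (fun w => X t w i 0).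
Hypothesis v0 : forall t, 1 <= t -> 0 < v t.
Hypothesis vy : v t @[t --> +oo] --> +oo.
Hypothesis log_mgf : forall c e, 0 < e -> \forall t \near +oo,
  `|ln (Ex P (fun w => expR (v t * dot c (X t w)))) - v t * quad c| <= e * v t.

Let bdot c t : 1 <= t -> bmeas (fun w => v t * dot c (X t w)).
Proof.
move=> t1; apply: bmeas_scale; under [X in bmeas X]eq_fun do rewrite dotE.
by apply: bmeas_sum => i; apply: bmeas_scale; exact: bX.
Qed.

Let ge1 : \forall t \near (+oo : set_system R), 1 <= t.
Proof. exact: nbhs_pinfty_ge. Qed.

Let mgf_bounds c e : 0 < e -> \forall t \near +oo,
  expR (v t * (quad c - e)) <= Ex P (fun w => expR (v t * dot c (X t w))) <=
  expR (v t * (quad c + e)).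
Proof.
move=> e0; apply: filterS2 ge1 (log_mgf c e0) => t t1.
rewrite ler_norml => /andP[h1 h2].
rewrite -[Ex P _]lnK; last by rewrite posrE; apply: Ex_exp_gt0; exact: bdot.
by rewrite !ler_expR; apply/andP; split; lra.
Qed.

(** An open set is the countable union of the rational boxes that it contains, and boxes are tested
    coordinate by coordinate. *)
Lemma measurable_open_event O t : open O -> 1 <= t -> measurable [set w | O (X t w)].
Proof.
move=> oO t1; pose U : Type := ({ffun 'I_m -> rat} * rat)%type.
pose inside (k : U) := forall y : 'cV[R]_m, (forall i, `|ratr (k.1 i) - y i 0| < ratr k.2) -> O y.
pose F (k : U) := if `[< inside k >] then
  \bigcap_(i in [set: 'I_m]) [set w | `|ratr (k.1 i) - X t w i 0| < ratr k.2 :> R] else set0.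
have -> : [set w | O (X t w)] = \bigcup_k F k.
  apply/seteqP; split => [w /= Ow|w [k _]]; last first.
    by rewrite /F; case: asboolP => // hk hw; apply: hk => i; exact: hw.
  have [dl dl0 hdl] := open_box oO Ow.
  have [r] := @rat_in_itvoo R 0 (dl / 2) (divr_gt0 dl0 (ltr0n _ 2)).
  rewrite in_itv /= => /andP[r0 rdl].
  have /choice[q hq] : forall i, exists q : rat, `|ratr q - X t w i 0| < ratr r :> R.
    move=> i; have [|q] := @rat_in_itvoo R (X t w i 0 - ratr r) (X t w i 0 + ratr r); first lra.
    by rewrite in_itv /= => /andP[q1 q2]; exists q; rewrite ltr_norml; apply/andP; split; lra.
  exists ([ffun i => q i], r) => //; rewrite /F; case: asboolP => [_ i _|nin] /=.
    by rewrite ffunE.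
  exfalso; apply: nin => y hy; apply: hdl => i.
  have := hy i; have := hq i; rewrite /= ffunE !ltr_norml => /andP[a1 a2] /andP[b1 b2].
  by apply/andP; split; lra.
apply: countable_bigcupT_measurable => [|k]; first exact: countableP.
rewrite /F; case: asboolP => _ //; apply: fin_bigcap_measurable => // i _.
have [mXi _] := bX i t1.
have := mXi measurableT _ (measurable_itv `]ratr (k.1 i) - ratr k.2 : R, ratr (k.1 i) + ratr k.2[).
rewrite setTI; congr measurable; apply/seteqP; split => w /=;
  rewrite in_itv /= ltr_norml => /andP[a1 a2]; apply/andP; split; lra.
Qed.

Lemma measurable_closed_event C t : closed C -> 1 <= t -> measurable [set w | C (X t w)].
Proof.
move=> cC t1; rewrite (_ : [set w | _] = ~` [set w | (~` C) (X t w)]).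
  by apply: measurableC; apply: measurable_open_event => //; exact: closed_openC.
by apply/seteqP; split => w /=; [move=> ? ?|move=> /contrapT].
Qed.

Let PE A : measurable A -> fine (P A) = Ex P (\1_A).
Proof. by move=> mA; rewrite -Ex_indic. Qed.

(** Exponential Chebyshev bound on each of finitely many half-spaces; their number is absorbed by
    [expR (v t * (e / 2))]. *)
Lemma ld_upper_estimate C b e : closed C -> (forall u, C u -> exists c, b < dot c u - quad c) ->
  0 < e -> \forall t \near +oo, fine (P [set w | C (X t w)]) <= expR (- v t * (b - e)).
Proof.
move=> cC hC e0; have [L hL] := halfspace_cover cC hC.
have e2 : 0 < e / 2 by rewrite divr_gt0.
have bounds : \forall t \near +oo, forall c, c \in L ->
    Ex P (fun w => expR (v t * dot c (X t w))) <= expR (v t * (quad c + e / 2)).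
  elim: (L) => [|c L' IH]; first by near=> t.
  apply: filterS2 IH (mgf_bounds c e2) => t IH /andP[_ hc] c'.
  by rewrite inE => /orP[/eqP ->|/IH].
apply: filterS3 ge1 bounds (cvgry_ge vy ((size L)%:R / (e / 2))) => t t1 hb hv.
have vt0 := v0 t1.
rewrite PE; last exact: measurable_closed_event.
have bY c : bmeas (fun w => expR (- v t * (b + quad c)) * expR (v t * dot c (X t w))).
  by apply: bmeas_scale; apply: bmeas_exp; exact: bdot.
apply: le_trans (_ : Ex P (fun w => \sum_(c <- L)
    expR (- v t * (b + quad c)) * expR (v t * dot c (X t w))) <= _).
  apply: Ex_le; [by apply: bmeas_indic; exact: measurable_closed_event|exact: bmeas_sum|].
  move=> w; rewrite indicE; have [/set_mem /= Cw|_] := boolP (_ \in _); last first.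
    by apply: sumr_ge0 => c _; rewrite mulr_ge0 ?expR_ge0.
  have [c cL hc] := hL _ Cw.
  rewrite (big_rem c) //= -[1%:R]addr0 lerD //; last first.
    by apply: sumr_ge0 => ? _; rewrite mulr_ge0 ?expR_ge0.
  rewrite -expRD -[leLHS]expR0 ler_expR.
  have -> : - v t * (b + quad c) + v t * dot c (X t w) = v t * (dot c (X t w) - quad c - b) by ring.
  by rewrite mulr_ge0 ?(ltW vt0) //; lra.
rewrite Ex_sum //; apply: le_trans (_ : \sum_(c <- L) expR (- v t * (b - e / 2)) <= _).
  rewrite big_seq [leRHS]big_seq; apply: ler_sum => c cL; rewrite Ex_scale; last first.
    by apply: bmeas_exp; exact: bdot.
  apply: le_trans (ler_wpM2l (expR_ge0 _) (hb _ cL)) _.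
  by rewrite -expRD ler_expR le_eqVlt; apply/orP; left; apply/eqP; ring.
rewrite big_const_seq iter_addr_0 count_predT -[leLHS]mulr_natl.
have -> : - v t * (b - e) = v t * (e / 2) + - v t * (b - e / 2) by field.
rewrite expRD ler_pM2r ?expR_gt0 //; apply: le_trans (_ : v t * (e / 2) <= _).
  by rewrite -ler_pdivrMr.
by apply: le_trans (expR_ge1Dx _); rewrite lerDr.
Unshelve. all: by end_near.
Qed.

(* Under the law tilted by [exp (v * dot c X)] the vector concentrates at [G *m c]. *)
Lemma ld_lower_estimate O c e : open O -> O (G *m c) -> 0 < e ->
  \forall t \near +oo, expR (- v t * (quad c + e)) <= fine (P [set w | O (X t w)]).
Proof.
move=> oO Ou e0; set u := G *m c in Ou.
have [dl' dl'0 hdl'] := open_box oO Ou.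
pose S := \sum_i `|c i 0| + 1; have S0 : 0 < S by rewrite ltr_wpDl // sumr_ge0.
pose dl := Num.min dl' (e / 4 / S).
have dl0 : 0 < dl by rewrite lt_min dl'0 !divr_gt0.
have near_u (y : 'cV[R]_m) : (forall i, `|u i 0 - y i 0| < dl) -> O y /\ dot c y <= dot c u + e / 4.
  move=> hy; split; first by apply: hdl' => i; rewrite (lt_le_trans (hy i)) // ge_min lexx.
  have h : `|dot c u - dot c y| <= (\sum_i `|c i 0|) * dl by apply: dot_close => i; exact: ltW.
  have h2 : (\sum_i `|c i 0|) * dl <= e / 4.
    apply: le_trans (_ : S * dl <= _); first by rewrite ler_pM2r // lerDl.
    rewrite -ler_pdivlMl // mulrC; by rewrite ge_min lexx orbT.
  by move: h; rewrite ler_norml => /andP[? _]; lra.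
clearbody dl.
pose qs := \sum_i quad (e_ i) + 1; have qs0 : 0 < qs by rewrite ltr_wpDl // sumr_ge0.
have qi i : quad (e_ i) <= qs.
  by rewrite /qs (bigD1 i) //= -addrA lerDl addr_ge0 // sumr_ge0.
(* The extra tilt minimising [s ^+ 2 * qs - s * dl], the exponential rate bounding a deviation by
   [dl] in one coordinate. *)
pose sg := dl / (2 * qs); have sg0 : 0 < sg by rewrite divr_gt0 // mulr_gt0.
have sgq : sg ^+ 2 * qs = sg * dl / 2 by rewrite /sg; field; rewrite gt_eqF.
clearbody sg.
have sd0 : 0 < sg * dl by rewrite mulr_gt0.
(* The error of the moment generating function enters the tail estimate twice; one eighth of the
   gain leaves a quarter of it. *)
pose h := Num.min (sg * dl / 8) (e / 4).
have h0 : 0 < h by rewrite lt_min !divr_gt0.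
have h1 : h <= sg * dl / 8 by rewrite ge_min lexx.
have h2 : h <= e / 4 by rewrite ge_min lexx orbT.
clearbody h.
pose s (b : bool) : R := if b then sg else - sg.
have s2 b : s b ^+ 2 = sg ^+ 2 by case: b; rewrite /s ?sqrrN.
pose tl b i := c + s b *: e_ i.
have tails : \forall t \near +oo, forall b i,
    Ex P (fun w => expR (v t * dot (tl b i) (X t w))) <= expR (v t * (quad (tl b i) + h)).
  apply: (filter_forall (F := nbhs +oo)) => b; apply: (filter_forall (F := nbhs +oo)) => i.
  by apply: filterS (mgf_bounds (tl b i) h0) => t /andP[].
have main_t : \forall t \near +oo,
    expR (v t * (quad c - h)) <= Ex P (fun w => expR (v t * dot c (X t w))) /\
    Num.max (2 / (e / 2)) (4 * m%:R / (sg * dl / 4)) <= v t.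
  by apply: filterS2 (mgf_bounds c h0) (cvgry_ge vy _) => t /andP[q1 _] q2; split; [exact: q1|exact: q2].
apply: filterS3 ge1 tails main_t => t t1 ht [hc].
rewrite ge_max => /andP[hv1 hv2].
have vt0 := v0 t1.
have mO := measurable_open_event oO t1.
rewrite PE //; set A := [set w | _].
have bT b i : bmeas (fun w => expR (- v t * (s b * u i 0 + sg * dl)) *
    expR (v t * dot (tl b i) (X t w))).
  by apply: bmeas_scale; apply: bmeas_exp; exact: bdot.
(* The exponential moment is split: where [X] is near [u] it is controlled by the probability of
   [A], and otherwise some coordinate is off by [dl], which one of the [2 * m] further tilts
   detects. *)
have key : Ex P (fun w => expR (v t * dot c (X t w))) <=
    expR (v t * (dot c u + e / 4)) * Ex P (\1_A) +
    \sum_i \sum_b expR (- v t * (s b * u i 0 + sg * dl)) *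
      Ex P (fun w => expR (v t * dot (tl b i) (X t w))).
  have -> : \sum_i \sum_b expR (- v t * (s b * u i 0 + sg * dl)) *
      Ex P (fun w => expR (v t * dot (tl b i) (X t w))) =
    Ex P (fun w => \sum_i \sum_b expR (- v t * (s b * u i 0 + sg * dl)) *
      expR (v t * dot (tl b i) (X t w))).
    rewrite Ex_sum => [|i]; last exact: bmeas_sum.
    apply: eq_bigr => i _; rewrite Ex_sum //; apply: eq_bigr => b _.
    by rewrite Ex_scale //; apply: bmeas_exp; exact: bdot.
  have bA : bmeas (\1_A : Omega -> R) by exact: bmeas_indic.
  rewrite -Ex_scale // -Ex_add; last 2 first.
  - exact: bmeas_scale.
  - by apply: bmeas_sum => i; exact: bmeas_sum.
  apply: Ex_le; first by apply: bmeas_exp; exact: bdot.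
    by apply: bmeas_add; [exact: bmeas_scale|apply: bmeas_sum => i; exact: bmeas_sum].
  move=> w; have tail0 : 0 <= \sum_i \sum_b expR (- v t * (s b * u i 0 + sg * dl)) *
      expR (v t * dot (tl b i) (X t w)).
    by apply: sumr_ge0 => i _; apply: sumr_ge0 => b _; rewrite mulr_ge0 ?expR_ge0.
  have [inb|] := pselect (forall i, `|u i 0 - X t w i 0| < dl).
    have [Ow hw] := near_u _ inb.
    rewrite indicE mem_set // mulr1; apply: le_trans (_ : expR (v t * (dot c u + e / 4)) <= _).
      by rewrite ler_expR ler_pM2l.
    by rewrite lerDl.
  move=> /existsNP[i /negP]; rewrite -leNgt => far.
  apply: le_trans (_ : \sum_i \sum_b expR (- v t * (s b * u i 0 + sg * dl)) *
      expR (v t * dot (tl b i) (X t w)) <= _); last first.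
    by rewrite lerDr mulr_ge0 ?expR_ge0 // indicE ler0n.
  rewrite (bigD1 i) //= -[leLHS]addr0 lerD //; last first.
    by apply: sumr_ge0 => j _; apply: sumr_ge0 => b _; rewrite mulr_ge0 ?expR_ge0.
  have [b hb] : exists b, sg * dl <= s b * (X t w i 0 - u i 0).
    move: far; rewrite ler_normr => /orP[far|far].
      exists false; rewrite /s.
      have -> : - sg * (X t w i 0 - u i 0) = sg * (u i 0 - X t w i 0) by ring.
      by rewrite ler_pM2l.
    by exists true; rewrite /s ler_pM2l // -opprB.
  rewrite (bigD1 b) //= -[leLHS]addr0 lerD //; last first.
    by apply: sumr_ge0 => b' _; rewrite mulr_ge0 ?expR_ge0.
  rewrite -expRD ler_expR /tl dotDl dotZl dot_e.
  have -> : - v t * (s b * u i 0 + sg * dl) + v t * (dot c (X t w) + s b * X t w i 0) =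
    v t * dot c (X t w) + v t * (s b * (X t w i 0 - u i 0) - sg * dl) by ring.
  by rewrite lerDl mulr_ge0 ?subr_ge0 // ltW.
(* At [u = G *m c] the linear term is twice the quadratic one, so dividing the moment by
   [expR (v t * dot c u)] leaves [quad c] with a minus sign. *)
have dcu : dot c u = 2 * quad c by rewrite /quad mulrA divff ?mul1r // gt_eqF.
have tailb : \sum_i \sum_b expR (- v t * (s b * u i 0 + sg * dl)) *
      Ex P (fun w => expR (v t * dot (tl b i) (X t w))) <=
    2^-1 * expR (v t * (quad c - h)).
  apply: le_trans (_ : \sum_(i < m) \sum_(b : bool)
      expR (- (v t * (sg * dl / 4))) * expR (v t * (quad c - h)) <= _).
    apply: ler_sum => i _; apply: ler_sum => b _.
    apply: le_trans (ler_wpM2l (expR_ge0 _) (ht b i)) _.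
    rewrite -!expRD ler_expR /tl quadD -/u s2.
    have : sg ^+ 2 * quad (e_ i) <= sg * dl / 2 by rewrite -sgq ler_wpM2l ?sqr_ge0.
    set q := sg ^+ 2 * _ => hq.
    have -> : - v t * (s b * u i 0 + sg * dl) + v t * (quad c + s b * u i 0 + q + h) =
      v t * (quad c + q + h - sg * dl) by ring.
    have -> : - (v t * (sg * dl / 4)) + v t * (quad c - h) = v t * (quad c - h - sg * dl / 4) by ring.
    by rewrite ler_pM2l //; lra.
  rewrite !sumr_const card_bool card_ord -mulrnA -[leLHS]mulr_natl mulrA ler_pM2r ?expR_gt0 //.
  rewrite expRN ler_pdivrMr ?expR_gt0 //; apply: le_trans (_ : 2^-1 * (v t * (sg * dl / 4)) <= _).
    move: hv2; rewrite ler_pdivrMr ?divr_gt0 // natrM => q; lra.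
  rewrite ler_pM2l ?invr_gt0 //; apply: le_trans (expR_ge1Dx _); by rewrite lerDr.
have main : 2^-1 * expR (v t * (quad c - h)) <= expR (v t * (dot c u + e / 4)) * Ex P (\1_A).
  have := le_trans hc key; move: (expR (v t * (quad c - h))) tailb => y; lra.
have half : expR (- (v t * (e / 2))) <= 2^-1.
  rewrite expRN lef_pV2 ?posrE ?expR_gt0 //; apply: le_trans (_ : v t * (e / 2) <= _).
    by rewrite -ler_pdivrMr // divr_gt0.
  by apply: le_trans (expR_ge1Dx _); rewrite lerDr.
rewrite -(ler_pM2l (expR_gt0 (v t * (dot c u + e / 4)))); apply: le_trans main.
apply: le_trans (ler_wpM2r (expR_ge0 _) half).
rewrite -!expRD ler_expR dcu.
have -> : v t * (2 * quad c + e / 4) + - v t * (quad c + e) = v t * (quad c + e / 4 - e) by ring.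
have -> : - (v t * (e / 2)) + v t * (quad c - h) = v t * (quad c - h - e / 2) by ring.
by rewrite ler_pM2l //; lra.
Qed.

Theorem gaussian_gartner_ellis :
  (forall C, closed C ->
    (limf_esup (fun t => ((v t)^-1)%:E * lne (P [set w | C (X t w)])) +oo_R
     <= - ereal_inf [set rate G u | u in C])%E) /\
  (forall O, open O ->
    (- ereal_inf [set rate G u | u in O] <=
     limf_einf (fun t => ((v t)^-1)%:E * lne (P [set w | O (X t w)])) +oo_R)%E).
Proof.
split => [C cC|O oO].
  apply: limf_esup_le_near => r e Ir e0.
  have hC u : C u -> exists c, - r < dot c u - quad c.
    move=> Cu; have : ((- r)%:E < rate G u)%E.
      apply: lt_le_trans (_ : ereal_inf [set rate G u | u in C] <= _)%E.
        by rewrite EFinN lteNl.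
      by apply: ereal_inf_lbound; exists u.
    move=> /ereal_sup_gt[_ [c _ <-]]; rewrite lte_fin => h; exists c.
    by move: h; rewrite /quad /dot mulmxA.
  apply: filterS2 ge1 (ld_upper_estimate cC hC e0) => t t1 h.
  have mC := measurable_closed_event cC t1.
  rewrite -[P _]fineK; last exact: fin_num_measure.
  apply: scaled_lne_le => //; [exact: v0|exact: fine_ge0|].
  by apply: le_trans h _; rewrite ler_expR le_eqVlt; apply/orP; left; apply/eqP; ring.
rewrite /limf_einf leeN2; apply: limf_esup_le_near => r e Ir e0.
have [_ [u Ou <-] ur] := ereal_inf_lt Ir.
(* A near-minimiser of the rate has finite rate, hence is of the form [G *m c], and [quad c] is at
   most its rate. *)
have [c uc] := rate_finite (lt_le_trans ur (leey _)).
have qr : quad c < r.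
  rewrite -lte_fin; apply: le_lt_trans ur; apply: le_trans (rate_ge c u).
  by rewrite lee_fin uc /quad; lra.
rewrite uc in Ou.
apply: filterS2 ge1 (ld_lower_estimate oO Ou e0) => t t1 h.
have mO := measurable_open_event oO t1.
rewrite -[P _]fineK; last exact: fin_num_measure.
rewrite leeNl -EFinN; apply: scaled_lne_ge; first exact: v0.
apply: le_trans h; rewrite ler_expR mulNr -mulrN ler_pM2l ?v0 //; lra.
Qed.

End GartnerEllis.

(** * Moderate deviations *)

Lemma neighbour_list (V : choiceType) (d : nat) (E : rel V) : regular_tree d E ->
  exists nb : V -> seq V, [/\ forall x y, (y \in nb x) = E x y,
    forall x, uniq (nb x) & forall x, size (nb x) = d.+1].
Proof.
move=> hE; exists (fun x => finmap.enum_fset (fset_set [set y | E x y])).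
have fin x : finite_set [set y | E x y].
  by apply/finite_setP; exists d.+1; exact: rtree_degree hE x.
split=> [x y|x|x]; last 2 first.
- exact: finmap.fset_uniq.
- exact: card_fset_set (rtree_degree hE x).
have K : is_true (y \in finmap.enum_fset (fset_set [set y | E x y])) = is_true (E x y) :=
  congr1 (fun A : set V => A y) (fset_setK (fin x)).
by apply/idP/idP; rewrite K.
Qed.

Theorem theorem2p1 (R : realType) (d : nat) (hd : (2 <= d)%N)
    (V : choiceType) (E : rel V) (hE : regular_tree d E)
    (p : R) (hp0 : 0 < p) (hp1 : p < 1)
    (q : R -> V -> V -> R) (hq : walk_transition E q)
    (dsp : measure_display) (Omega : measurableType dsp)
    (P : probability Omega R) (eta : R -> Omega -> config V)
    (heta : is_ssep P E eta) (hnu : has_law_nu P p (eta 0))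
    (a : R -> R) (ha : forall t : R, 0 <= t -> 0 < a t)
    (ha1 : a t / t @[t --> +oo] --> 0)
    (ha2 : Num.sqrt t / a t @[t --> +oo] --> 0)
    (m : nat) (hm : (1 <= m)%N) (x : 'I_m -> V) :
  (forall C : set 'cV[R]_m, closed C ->
    (limf_esup (fun t : R => (t / a t ^+ 2)%:E *
        lne (P [set w | C ((a t)^-1 *: occupation_vector p eta x t w)%R]))
      +oo_R
    <= - ereal_inf [set rate (Gamma p q x) u | u in C])%E) /\
  (forall O : set 'cV[R]_m, open O ->
    (- ereal_inf [set rate (Gamma p q x) u | u in O] <=
     limf_einf (fun t : R => (t / a t ^+ 2)%:E *
        lne (P [set w | O ((a t)^-1 *: occupation_vector p eta x t w)%R]))
      +oo_R)%E).
Proof.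
have [nb [nbP nb_uniq nb_size]] := neighbour_list hE.
have [Esym Eirr Econn Eacyc _] := hE.
have [meta cad [S [fS gS markov]]] := heta.
(* The speed. With tilt strength [l = a t / t] it equals [l ^+ 2 * t], the scale of the moment
   estimates. *)
pose v (t : R) : R := a t ^+ 2 / t.
pose X (t : R) (w : Omega) : 'cV[R]_m := (a t)^-1 *: occupation_vector p eta x t w.
have vE t : t / a t ^+ 2 = (v t)^-1 by rewrite /v invf_div.
have scaleE (A : set 'cV[R]_m) : (fun t : R => ((t / a t ^+ 2)%:E *
    lne (P [set w | A ((a t)^-1 *: occupation_vector p eta x t w)%R]))%E) =
    (fun t => (((v t)^-1)%:E * lne (P [set w | A (X t w)]))%E).
  by apply/funext => t; rewrite vE.
suff [ub lb] : (forall C, closed C ->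
    (limf_esup (fun t => ((v t)^-1)%:E * lne (P [set w | C (X t w)])) +oo_R
     <= - ereal_inf [set rate (Gamma p q x) u | u in C])%E) /\
  (forall O, open O ->
    (- ereal_inf [set rate (Gamma p q x) u | u in O] <=
     limf_einf (fun t => ((v t)^-1)%:E * lne (P [set w | O (X t w)])) +oo_R)%E).
  by split => [C cC|O oO]; rewrite scaleE; [exact: ub|exact: lb].
have GammaE i j : Gamma p q x i j = 2 * p * (1 - p) * green R d Econn (x i) (x j).
  by rewrite mxE (integral_green Esym Eirr Econn Eacyc nbP nb_uniq nb_size hd _ _ hq).
(* The factor 2 in [Gamma] cancels the one half in [quad]. *)
have quadE c : quad (Gamma p q x) c = p * (1 - p) * green_form d Econn x (fun i => c i 0).
  rewrite /quad dotE /green_form exchange_big !mulr_sumr; apply: eq_bigr => i _ /=.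
  rewrite mxE !mulr_sumr; apply: eq_bigr => j _; rewrite GammaE; by field.
have pq0 : 0 <= p * (1 - p) by rewrite mulr_ge0 ?subr_ge0 // ltW.
have v0 t : 1 <= t -> 0 < v t.
  by move=> t1; have t0 := lt_le_trans ltr01 t1; rewrite divr_gt0 // exprn_gt0 // ha // ltW.
have ge1 : \forall t \near (+oo : set_system R), 1 <= t by exact: nbhs_pinfty_ge.
(* The second growth hypothesis says that the square root of [v t] has inverse tending to 0. *)
have vy : v t @[t --> +oo] --> +oo.
  apply/cvgryPge => A; pose B := Num.sqrt (`|A| + 1).
  have A1 : 0 < `|A| + 1 by rewrite ltr_wpDl.
  have B0 : 0 < B by rewrite sqrtr_gt0.
  have B1 : 0 < B^-1 by rewrite invr_gt0.
  move/cvgrPdist_le: ha2 => /(_ _ B1) near_t.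
  apply: filterS2 ge1 near_t => t t1; have t0 := lt_le_trans ltr01 t1.
  have at0 : 0 < a t := ha t (ltW t0).
  rewrite sub0r normrN ger0_norm; last by rewrite divr_ge0 ?sqrtr_ge0 ?ltW.
  rewrite ler_pdivrMr // ler_pdivlMl // => h.
  have : (B * Num.sqrt t) ^+ 2 <= a t ^+ 2.
    by rewrite lerXn2r ?nnegrE ?mulr_ge0 ?sqrtr_ge0 // ltW.
  rewrite exprMn !sqr_sqrtr ?(ltW A1) ?(ltW t0) // => h2.
  by rewrite ler_pdivlMr //; apply: le_trans h2; rewrite ler_pM2r //; have := ler_norm A; lra.
apply: gaussian_gartner_ellis => //.
- by apply/matrixP => i j; rewrite mxE !GammaE (green_sym R d Esym Econn Eacyc).
- move=> c; have : 0 <= quad (Gamma p q x) c.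
    rewrite quadE mulr_ge0 //.
    exact: (green_form_ge0 Esym Eirr Econn Eacyc nbP nb_uniq nb_size hd).
  by rewrite /quad pmulr_rge0 // invr_gt0.
- move=> t i t1; have t0 := lt_le_trans ltr01 t1.
  (* A single coordinate is the source integral with one source of strength 1. *)
  have := bmeas_source_integral hp0 hp1 meta (fun _ : 'I_1 => x i) (fun=> 1) cad t0.
  move=> /(bmeas_scale (a t)^-1); congr bmeas; apply/funext => w.
  by rewrite /source_integral big_ord1 mul1r !mxE.
move=> c e e0.
have [dl [M [dl0 lim]]] := log_mgf_limit Esym Eirr Econn Eacyc nbP nb_uniq nb_size hd
  fS gS hp0 hp1 meta hnu markov x (fun i => c i 0) cad e0.
have small : \forall t \near +oo, a t / t < dl by exact: cvgr_lt ha1 _ dl0.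
have big : \forall t \near +oo, M <= v t by exact: cvgry_ge vy M.
apply: filterS3 ge1 small big => t t1 lt_dl vM; have t0 := lt_le_trans ltr01 t1.
have at0 : 0 < a t := ha t (ltW t0).
have l2 : (a t / t) ^+ 2 * t = v t by rewrite /v; field; rewrite gt_eqF.
have l01 : 0 < a t / t < dl by rewrite divr_gt0.
have bound := lim (a t / t) t l01 t1; rewrite l2 in bound; have {}bound := bound vM.
have -> : (fun w => expR (v t * dot c (X t w))) =
    (fun w => expR (a t / t * source_integral p eta x (fun i => c i 0) t w)).
  apply/funext => w; congr expR.
  rewrite dotE /source_integral !mulr_sumr; apply: eq_bigr => i _.
  by rewrite !mxE /v; field; rewrite !gt_eqF.
by rewrite quadE.
Qed.
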